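(* Let $n\ge1$. For every $a,b\in\mathbb{R}^n$, the Cheeger constant of the symmetric Gaussian mixture, i.e. the probability measure on $\mathbb{R}^n$ with Lebesgue density $\mu(x)=\frac12\gamma(x-a)+\frac12\gamma(x-b)$, is given by $$h_\mu=\sqrt{\frac{2}{\pi}}\,e^{-\frac18|a-b|^2}.$$ Moreover, if $a\neq b$, then a Borel set $E\subseteq\mathbb{R}^n$ is a Cheeger set for $\mu$ if and only if $E=H^-_{a\cdot\nu+t,\nu}$ or $E=H^+_{a\cdot\nu+t,\nu}$, where $\nu=\frac{b-a}{|b-a|}$ and $t=\frac12|b-a|$ (equality of Borel sets being meant up to $\mu$-null sets).
   Context: $\gamma(x)=(2\pi)^{-n/2}e^{-|x|^2/2}$ is the standard Gaussian density on $\mathbb{R}^n$. $\mathcal{B}(\mathbb{R}^n)$ is the Borel $\sigma$-algebra. For a Borel probability measure $\mu$ on $\mathbb{R}^n$ and $A\in\mathcal{B}(\mathbb{R}^n)$, the lower Minkowski content is $\mu_+(A)=\liminf_{\varepsilon\to0}\frac{\mu(A^\varepsilon\setminus A)}{\varepsilon}$ ($\varepsilon>0$), where $A^\varepsilon=\{x\in\mathbb{R}^n:\mathrm{dist}(A,x)<\varepsilon\}$ is the open $\varepsilon$-neighborhood of $A$. The Cheeger constant of $\mu$ is $$h_\mu=\inf_{A\in\mathcal{B}(\mathbb{R}^n),\ 0<\mu(A)<1}\frac{\mu_+(A)}{\min\{\mu(A),1-\mu(A)\}}.$$ A set $S$ at which this infimum is attained is called a Cheeger set for $\mu$. For $c\in\mathbb{R}$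 and a unit vector $\nu\in\mathbb{S}^{n-1}$: $H^-_{c,\nu}=\{x\in\mathbb{R}^n:x\cdot\nu<c\}$ and $H^+_{c,\nu}=\{x\in\mathbb{R}^n:x\cdot\nu>c\}$. Convention: whenever two Borel sets $A,B$ are said to satisfy $A=B$, equality is meant up to $\mu$-null sets, i.e. $\mu(A\Delta B)=0$.
   Formalization: ''E is a Cheeger set'' in the equivalence is read up to null sets (E equals mod null some set attaining the infimum), since adding a dense null set to H^- makes its Minkowski content infinite; both half-spaces are also shown to attain the infimum themselves. *)

(* Defs.v *)
From HB Require Import structures.
From mathcomp Require Import all_boot all_order all_algebra.
From mathcomp Require Import all_classical all_reals all_analysis.
From mathcomp Require Import measurable_realfun.

Set Implicit Arguments.
Unset Strict Implicit.
Unset Printing Implicit Defensive.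
Import Order.TTheory GRing.Theory Num.Theory.
Import numFieldNormedType.Exports.
Local Open Scope classical_set_scope.
Local Open Scope ring_scope.

Definition borel_display : measure_display. Proof. by []. Qed.

(* Row vectors 'rV[R]_n model R^n; their measurable sets are the Borel sets, *)
(* generated by the open sets of the library's (product) topology.           *)
Section borel_rV.
Context (R : realType) (n : nat).

HB.instance Definition _ := @isMeasurable.Build borel_display 'rV[R]_n
  <<s @open 'rV[R]_n >> (@sigma_algebra0 _ setT _) (@sigma_algebraC _ _)
  (@sigma_algebra_bigcup _ setT _).

End borel_rV.

Section borel_rV_lemmas.
Context (R : realType).

Lemma open_measurable_rV n (U : set 'rV[R]_n) : open U -> measurable U.
Proof. by move=> oU; exact: sub_sigma_algebra. Qed.

Lemma continuous_measurable_rV n (f : 'rV[R]_n -> R) :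
  continuous f -> measurable_fun setT f.
Proof.
move=> /continuousP cf; apply: (measurability _ (RGenOpens.measurableE R)).
move=> _ [_ [a [b ->] <-]]; rewrite setTI; apply: open_measurable_rV.
exact/cf/interval_open.
Qed.

Lemma measurable_fun_rV d (T : measurableType d) n (f : T -> 'rV[R]_n) :
  (forall U, open U -> measurable (f @^-1` U)) -> measurable_fun setT f.
Proof.
move=> fU; apply: (measurability _ (erefl : measurable = <<s @open 'rV[R]_n >>)).
by move=> _ [U oU <-]; rewrite setTI; exact: fU.
Qed.

Definition rV_cons n (p : R * 'rV[R]_n) : 'rV[R]_n.+1 :=
  row_mx (p.1%:M : 'rV_1) p.2.

Definition rV_uncons n (v : 'rV[R]_n.+1) : R * 'rV[R]_n :=
  (v 0 0, rsubmx (v : 'rV_(1 + n))).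

Lemma rV_cons0 n (p : R * 'rV[R]_n) : rV_cons p 0 0 = p.1.
Proof.
rewrite (_ : rV_cons p 0 0 = rV_cons p 0 (lshift n (0 : 'I_1))).
  apply: etrans (row_mxEl _ _ _ _) _.
  by rewrite mxE eqxx mulr1n.
by congr (rV_cons p _ _); exact: val_inj.
Qed.

Lemma rV_consS n (p : R * 'rV[R]_n) i : rV_cons p 0 (lift 0 i) = p.2 0 i.
Proof.
rewrite (_ : rV_cons p 0 (lift 0 i) = rV_cons p 0 (rshift 1 i)).
  exact: row_mxEr.
by congr (rV_cons p _ _); exact: val_inj.
Qed.

Lemma rV_consK n : cancel (@rV_cons n) (@rV_uncons n).
Proof.
by move=> [x v]; rewrite /rV_uncons rV_cons0 /rV_cons row_mxKr.
Qed.

Lemma rV_unconsK n : cancel (@rV_uncons n) (@rV_cons n).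
Proof.
move=> v; apply/rowP => j; have [i ->|->] := unliftP 0 j.
  by rewrite rV_consS /= mxE; congr (v _ _); exact: val_inj.
by rewrite rV_cons0.
Qed.

Lemma measurable_rV_cons n : measurable_fun setT (@rV_cons n).
Proof.
apply: measurable_fun_rV => U oU.
pose W (i : rat * 'rV[rat]_n * nat) : set (R * 'rV[R]_n) :=
  ball (ratr i.1.1 : R) i.2.+1%:R^-1
    `*` ball (map_mx ratr i.1.2 : 'rV[R]_n) i.2.+1%:R^-1.
pose F i := [set p | W i p /\ W i `<=` @rV_cons n @^-1` U].
have mF i : measurable (F i).
  have [WU|nWU] := pselect (W i `<=` @rV_cons n @^-1` U); last first.
    by rewrite (_ : F i = set0) // -subset0 => p [].
  rewrite (_ : F i = W i); last by apply/seteqP; split => [p []//|p pW]; split.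
  apply: measurableX; first by apply: open_measurable; exact: ball_open.
  by apply: open_measurable_rV; exact: ball_open.
rewrite (_ : _ @^-1` _ = \bigcup_i F i); last first.
  apply/seteqP; split => [[x v] /= xvU|p [i _ [pW]]]; last exact.
  have := open_nbhs_nbhs (conj oU xvU).
  rewrite -nbhs_ballE => -[_/posnumP[e] eU].
  have [k] : exists k, 0 + k.+1%:R^-1 < e%:num / 2 by exact: ltr_add_invr.
  rewrite add0r => ke.
  have approx (y : R) : exists q : rat, ball (ratr q : R) k.+1%:R^-1 y.
    have : y - k.+1%:R^-1 < y + k.+1%:R^-1.
      by rewrite ltrD2l gtrN// invr_gt0.
    move=> /rat_in_itvoo[q]; rewrite in_itv/= => /andP[q1 q2]; exists q.
    by rewrite /ball/= ltr_distlC ltrBlDr -ltrBlDr; apply/andP; split => //;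
      rewrite ?ltrBlDr// -ltrBlDr.
  have [q xq] := approx x.
  have [w vw] : exists w : 'rV[rat]_n,
      ball (map_mx ratr w : 'rV[R]_n) k.+1%:R^-1 v.
    have /choice[f fP] := fun i => approx (v 0 i).
    exists (\row_i f i); split; first by rewrite invr_gt0.
    by move=> i j; rewrite !mxE ord1.
  exists (q, w, k) => //; split => // -[y u] [/= yq [_ uw]].
  move: vw => [_ vw]; apply: eU; split => // i j; rewrite ord1.
  have tri (r s t : R) : ball t k.+1%:R^-1 r -> ball t k.+1%:R^-1 s ->
      ball r e%:num s.
    move=> /ball_sym rt ts; rewrite (splitr e%:num).
    by apply: ball_triangle; [apply: le_ball rt|apply: le_ball ts]; exact: ltW.
  have [l ->|->] := unliftP 0 j; last by rewrite !rV_cons0; exact: tri xq yq.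
  by rewrite !rV_consS; exact: tri (vw 0 l) (uw 0 l).
by apply: countable_bigcupT_measurable.
Qed.

Lemma measurable_rV_uncons n : measurable_fun setT (@rV_uncons n).
Proof.
apply/measurable_fun_pairP; split.
  by apply: continuous_measurable_rV; exact: coord_continuous.
apply: measurable_fun_rV => U oU; apply: open_measurable_rV.
rewrite openE => v /= vU; have := open_nbhs_nbhs (conj oU vU).
rewrite -!nbhs_ballE => -[e e0 eU]; rewrite /interior -nbhs_ballE; exists e => //.
move=> w [_ vw]; apply: eU; split => // i j.
by rewrite !mxE; exact: vw.
Qed.

End borel_rV_lemmas.

(* The image of lebesgue_measure \x m under (x, v) |-> row_mx x v. *)
Section lebesgue_rV_cons.
Context (R : realType) (n : nat).
Variable m : {sigma_finite_measure set 'rV[R]_n -> \bar R}.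
Local Open Scope ereal_scope.

Definition lebesgue_rV_cons : set 'rV[R]_n.+1 -> \bar R :=
  pushforward (lebesgue_measure \x m) (@rV_cons R n).

Let mpre A : measurable A -> measurable (@rV_cons R n @^-1` A).
Proof.
by move=> mA; rewrite -[X in measurable X]setTI; exact: measurable_rV_cons.
Qed.

Let cons0 : lebesgue_rV_cons set0 = 0.
Proof. by rewrite /lebesgue_rV_cons /pushforward preimage_set0 measure0. Qed.

Let cons_ge0 A : 0 <= lebesgue_rV_cons A.
Proof. by rewrite /lebesgue_rV_cons /pushforward measure_ge0. Qed.

Let cons_additive : semi_sigma_additive lebesgue_rV_cons.
Proof.
move=> F mF tF mUF; rewrite /lebesgue_rV_cons /pushforward preimage_bigcup.
apply: measure_semi_sigma_additive.
- by move=> k; exact: mpre.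
- apply/trivIsetP => /= i j _ _ ij; rewrite -preimage_setI.
  by move/trivIsetP : tF => /(_ _ _ _ _ ij) ->//; rewrite preimage_set0.
- by rewrite -preimage_bigcup; exact: mpre.
Qed.

HB.instance Definition _ := isMeasure.Build _ _ _ lebesgue_rV_cons
  cons0 cons_ge0 cons_additive.

Let cons_sigma_finite : sigma_finite setT lebesgue_rV_cons.
Proof.
have /sigma_finiteP[F [TF ndF Foo]] := sigma_finiteT (@lebesgue_measure R).
have /sigma_finiteP[G [TG ndG Goo]] := sigma_finiteT m.
exists (fun k => @rV_uncons R n @^-1` (F k `*` G k)).
  rewrite -preimage_bigcup (_ : \bigcup_k _ = setT) ?preimage_setT//.
  rewrite -setXTT TF TG predeqE => -[x y]; split => [[k _ []/= ? ?]|].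
    by split; exists k.
  move=> [/= [k _ Fkx] [l _ Gly]]; exists (maxn k l) => //; split.
    by move: x Fkx; exact/subsetPset/ndF/leq_maxl.
  by move: y Gly; exact/subsetPset/ndG/leq_maxr.
move=> k; have [mF Fk] := Foo k; have [mG Gk] := Goo k; split.
  rewrite -[X in measurable X]setTI; apply: measurable_rV_uncons => //.
  exact: measurableX.
rewrite /lebesgue_rV_cons /pushforward -comp_preimage.
rewrite (_ : _ \o _ = id); last by apply/funext => p /=; rewrite rV_consK.
by rewrite preimage_id product_measure1E// lte_mul_pinfty// ge0_fin_numE.
Qed.

HB.instance Definition _ := Measure_isSigmaFinite.Build _ _ _ lebesgue_rV_cons
  cons_sigma_finite.

End lebesgue_rV_cons.

Fixpoint lebesgue_rV (R : realType) (n : nat) :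
    {sigma_finite_measure set 'rV[R]_n -> \bar R} :=
  match n with
  | 0 => [the {sigma_finite_measure set 'rV[R]_0 -> \bar R} of
           @dirac _ 'rV[R]_0 0 R]
  | k.+1 => lebesgue_rV_cons (lebesgue_rV R k)
  end.

Section euclid.
Context (R : realType) (n : nat).
Implicit Types x y : 'rV[R]_n.

Definition dotv x y : R := \sum_(i < n) x 0 i * y 0 i.

(* Needed because the norm `|x| of the library on row vectors is the sup norm. *)
Definition enorm x : R := Num.sqrt (dotv x x).

Definition gaussian_pdf x : R :=
  (2 * pi) `^ (- (n%:R / 2)) * expR (- (enorm x ^+ 2 / 2)).

Lemma gaussian_pdf_prod a x :
  gaussian_pdf (x - a) = \prod_(i < n) normal_pdf (a 0 i) 1 (x 0 i).
Proof.
rewrite /gaussian_pdf /enorm sqr_sqrtr; last first.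
  by apply: sumr_ge0 => i _; rewrite -expr2 sqr_ge0.
under eq_bigr do rewrite normal_pdfE ?oner_neq0// /normal_peak /normal_fun.
rewrite big_split/= prodr_const card_ord -expR_sum; congr (_ * expR _).
  rewrite expr1n mul1r powRN exprVn; congr (_^-1).
  rewrite (mulrC n%:R) powRrM powR12_sqrt; last by rewrite mulr_ge0 ?pi_ge0.
  by rewrite powR_mulrn ?sqrtr_ge0// mulr_natl.
rewrite /dotv mulr_suml -sumrN; apply: eq_bigr => i _.
by rewrite !mxE expr1n mulNr expr2.
Qed.

Lemma gaussian_pdf_ge0 x : 0 <= gaussian_pdf x.
Proof. by rewrite mulr_ge0 ?powR_ge0 ?expR_ge0. Qed.

Lemma measurable_gaussian_pdf a :
  measurable_fun setT (fun x => gaussian_pdf (x - a)).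
Proof.
under eq_fun do rewrite gaussian_pdf_prod.
apply: measurable_prod => i _.
apply: (measurableT_comp (measurable_normal_pdf _ _)).
by apply: continuous_measurable_rV; exact: coord_continuous.
Qed.

End euclid.

Lemma integral_gaussian_pdf (R : realType) (n : nat) (a : 'rV[R]_n) :
  (\int[lebesgue_rV R n]_x (gaussian_pdf (x - a))%:E = 1)%E.
Proof.
elim: n a => [|n IH] a.
  rewrite integral_dirac//; last first.
    by apply/measurable_EFinP; exact: measurable_gaussian_pdf.
  by rewrite diracT mul1e gaussian_pdf_prod big_ord0.
have mg : measurable_fun setT (fun x : 'rV[R]_n.+1 => (gaussian_pdf (x - a))%:E).
  by apply/measurable_EFinP; exact: measurable_gaussian_pdf.
rewrite ge0_integral_pushforward//=; last 2 first.
  exact: measurable_rV_cons.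
  by move=> x _; rewrite lee_fin gaussian_pdf_ge0.
rewrite preimage_setT fubini_tonelli1//=; last 2 first.
  by apply: (measurableT_comp mg); exact: measurable_rV_cons.
  by move=> x; rewrite lee_fin gaussian_pdf_ge0.
pose a' : 'rV[R]_n := \row_i a 0 (lift 0 i).
rewrite -[RHS](integral_normal_pdf (a 0 0) 1); apply: eq_integral => x _.
rewrite /fubini_F /=.
transitivity (\int[lebesgue_rV R n]_v ((normal_pdf (a 0 0) 1 x)%:E *
    (gaussian_pdf (v - a'))%:E))%E.
  apply: eq_integral => v _; rewrite -EFinM !gaussian_pdf_prod big_ord_recl.
  rewrite rV_cons0; congr (_ * _)%:E; apply: eq_bigr => i _.
  by rewrite rV_consS mxE.
rewrite ge0_integralZl//; last 3 first.
  by apply/measurable_EFinP; exact: measurable_gaussian_pdf.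
  by move=> v _; rewrite lee_fin gaussian_pdf_ge0.
  by rewrite lee_fin normal_pdf_ge0.
by rewrite IH mule1.
Qed.

Section gaussian_mixture.
Context (R : realType) (n : nat).
Implicit Types a b x : 'rV[R]_n.

Definition gaussian_mixture_pdf a b x : R :=
  2^-1 * gaussian_pdf (x - a) + 2^-1 * gaussian_pdf (x - b).

Definition gaussian_mixture a b : set 'rV[R]_n -> \bar R := fun A =>
  (\int[lebesgue_rV R n]_(x in A) (gaussian_mixture_pdf a b x)%:E)%E.

Variables a b : 'rV[R]_n.
Local Open Scope ereal_scope.

Let pdf_ge0 x : 0 <= (gaussian_mixture_pdf a b x)%:E.
Proof. by rewrite lee_fin addr_ge0// mulr_ge0// gaussian_pdf_ge0. Qed.

Let measurable_pdf :
  measurable_fun setT (fun x => (gaussian_mixture_pdf a b x)%:E).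
Proof.
apply/measurable_EFinP; apply: measurable_funD;
  by apply: measurable_funM => //; exact: measurable_gaussian_pdf.
Qed.

Let mixture0 : gaussian_mixture a b set0 = 0.
Proof. exact: integral_set0. Qed.

Let mixture_ge0 A : 0 <= gaussian_mixture a b A.
Proof. by apply: integral_ge0 => x _; exact: pdf_ge0. Qed.

Let mixture_additive : semi_sigma_additive (gaussian_mixture a b).
Proof.
move=> F mF tF mUF; rewrite /gaussian_mixture ge0_integral_bigcup//.
  by apply: is_cvg_ereal_nneg_natsum_cond => k _ _; exact: mixture_ge0.
exact: measurable_funS measurable_pdf.
Qed.

HB.instance Definition _ := isMeasure.Build _ _ _ (gaussian_mixture a b)
  mixture0 mixture_ge0 mixture_additive.

Let mixture_setT : gaussian_mixture a b setT = 1.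
Proof.
have half_ge0 : 0 <= (2^-1 : R)%:E by rewrite lee_fin.
have mg c : measurable_fun setT (fun x : 'rV[R]_n => (gaussian_pdf (x - c))%:E).
  by apply/measurable_EFinP; exact: measurable_gaussian_pdf.
rewrite /gaussian_mixture; under eq_integral => x _.
  rewrite EFinD (EFinM 2^-1 (gaussian_pdf (x - a))).
  rewrite (EFinM 2^-1 (gaussian_pdf (x - b))); over.
rewrite ge0_integralD//; last 4 first.
- by move=> x _; rewrite -EFinM lee_fin mulr_ge0// gaussian_pdf_ge0.
- exact: (measurable_funeM _ (mg _)).
- by move=> x _; rewrite -EFinM lee_fin mulr_ge0// gaussian_pdf_ge0.
- exact: (measurable_funeM _ (mg _)).
rewrite !ge0_integralZl//; try by move=> x _; rewrite lee_fin gaussian_pdf_ge0.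
by rewrite !integral_gaussian_pdf !mule1 -EFinD -div1r -splitr.
Qed.

HB.instance Definition _ := Measure_isProbability.Build _ _ R
  (gaussian_mixture a b) mixture_setT.

End gaussian_mixture.

Section cheeger.
Context (R : realType) (n : nat).
Implicit Types (A B : set 'rV[R]_n) (mu : probability 'rV[R]_n R).
Local Open Scope ereal_scope.

Definition edist_to_set A (x : 'rV[R]_n) : \bar R :=
  ereal_inf [set (enorm (x - y))%:E | y in A].

Definition open_nbhd A (e : R) : set 'rV[R]_n :=
  [set x | edist_to_set A x < e%:E].

(* The liminf is taken as e tends to 0 with e > 0. *)
Definition lower_minkowski mu A : \bar R :=
  limf_einf (fun e : R => mu (open_nbhd A e `\` A) / e%:E) (0%R : R)^'+.

Definition admissible mu A : Prop := measurable A /\ 0 < mu A < 1.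

Definition cheeger_ratio mu A : \bar R :=
  lower_minkowski mu A / mine (mu A) (1 - mu A).

Definition cheeger_constant mu : \bar R :=
  ereal_inf [set cheeger_ratio mu A | A in admissible mu].

Definition is_cheeger_set mu A : Prop :=
  admissible mu A /\ cheeger_ratio mu A = cheeger_constant mu.

Definition eq_mod_null mu A B : Prop := mu (A `+` B) = 0.

(* Adding a null set to A may change lower_minkowski mu A (add a countable    *)
(* dense set), so being a Cheeger set is not invariant under eq_mod_null; the *)
(* following is its saturation, to be used when Borel sets are identified     *)
(* modulo null sets.                                                          *)
Definition is_cheeger_set_mod_null mu A : Prop :=
  exists2 S, is_cheeger_set mu S & eq_mod_null mu A S.

Definition halfspace_lt (c : R) (nu : 'rV[R]_n) : set 'rV[R]_n :=
  [set x | (dotv x nu < c)%R].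

Definition halfspace_gt (c : R) (nu : 'rV[R]_n) : set 'rV[R]_n :=
  [set x | (c < dotv x nu)%R].

End cheeger.

(* Main.v *)
From HB Require Import structures.
Require Import Defs.
From mathcomp Require Import all_boot all_order all_algebra.
From mathcomp Require Import all_classical all_reals all_analysis.
From mathcomp Require Import measurable_realfun ring lra.

(** The mixture is the mean of two unit Gaussians centred at [a] and [b]. If a
    set [A] has measures [Phi u] and [Phi v] under them, the Gaussian
    isoperimetric inequality gives [mu_+(A) >= (phi u + phi v) / 2], and the
    Neyman-Pearson lemma gives [|u - v| <= |a - b| = 2 t]. Under this constraint
    and [u + v <= 0], a one-variable argument shows that the quotient
    [(phi u + phi v) / (Phi u + Phi v)] is minimal exactly when [{u, v}] is
    [{t, -t}]. Equality in Neyman-Pearson then makes [A] a half-space up to a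
    null set, so the equality cases of the isoperimetric inequality are never
    needed.

    The isoperimetric inequality follows by induction on the dimension from a
    functional inequality in dimension one, by looking at the slices of [A] and
    of its neighbourhood. In dimension one, after reduction to step functions,
    let [w] evolve by the Ornstein-Uhlenbeck semigroup: [u = Phi^-1 w] solves
    [u_t = u'' - u u'^2 - x u'], and, as observed by Borell, the maximum
    principle propagates the inequality
    [v(x + r sin al) >= u(x) + r cos al] to infinite time. A step function
    mollified by a Gaussian evolves as an explicit combination of [Phi]'s. *)

(** The induction on the dimension dictates the shape of the one-dimensional inequality: it concerns
    the measures [G], [K] of the slices of a set and of its neighbourhood, and its hypothesis is
    isoperimetry one dimension lower. The angle [al] splits a radius [r] into a horizontal shift
    [r sin al] and a quantile gain [r cos al].

    Two obstacles shape the rest. Quantiles exist only strictly between 0 and 1, whereas slice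
    measures may be 0 or 1; and a minimum is sought on the non-compact line. Both are met by floors:
    the first step function stays above [Phi (- M)], the second above [Phi (- M + eps)], and off the
    grid they equal these floors, whose quantiles already differ by [eps]. Sampling, mollification
    and truncation each lose a little, paid for by lowering the radius or [z] slightly.

    Mollifying with variance [eta ^+ 2] makes it possible to stop the flow at the positive time
    [s = eta], where its value at 0 is exactly the standard normal mean of the step function; no
    limit [s -> 0] is taken. *)

Set Implicit Arguments.
Unset Strict Implicit.
Unset Printing Implicit Defensive.
Import Order.TTheory GRing.Theory Num.Theory.
Import numFieldNormedType.Exports.
Local Open Scope classical_set_scope.
Local Open Scope ring_scope.

(** * One-variable calculus *)

Section one_variable.
Context {R : realType}.
Implicit Types (f g df : R -> R) (x y a b l : R).

Lemma is_derive_compE f g x a b :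
  is_derive (g x) 1 f a -> is_derive x 1 g b ->
  is_derive x 1 (fun y => f (g y)) (a * b).
Proof. by move=> fa gb; exact: is_derive1_comp. Qed.

Lemma is_deriveNE f x a : is_derive x 1 f a ->
  is_derive x 1 (fun y => - f y) (- a).
Proof. exact: is_deriveN. Qed.

Lemma is_deriveDE f g x a b : is_derive x 1 f a -> is_derive x 1 g b ->
  is_derive x 1 (fun y => f y + g y) (a + b).
Proof. exact: is_deriveD. Qed.

Lemma is_deriveBE f g x a b : is_derive x 1 f a -> is_derive x 1 g b ->
  is_derive x 1 (fun y => f y - g y) (a - b).
Proof. exact: is_deriveB. Qed.

Lemma is_deriveME f g x a b : is_derive x 1 f a -> is_derive x 1 g b ->
  is_derive x 1 (fun y => f y * g y) (f x * b + g x * a).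
Proof. exact: is_deriveM. Qed.

Lemma is_deriveZE k f x a : is_derive x 1 f a ->
  is_derive x 1 (fun y => k * f y) (k * a).
Proof. exact: is_deriveZ. Qed.

Lemma is_derive_sqrE f x a : is_derive x 1 f a ->
  is_derive x 1 (fun y => f y ^+ 2) (2 * f x * a).
Proof.
move=> fa; rewrite (_ : (fun y => _) = (fun y => f y * f y)); last first.
  by apply/funext => y; rewrite expr2.
by apply: is_derive_eq (is_deriveME fa fa) _; ring.
Qed.

Lemma is_derive_idE x : is_derive x 1 ((fun y => y) : R -> R) 1.
Proof. exact: is_derive_id. Qed.

Lemma is_derive_cstE k x : is_derive x 1 ((fun=> k) : R -> R) 0.
Proof. exact: is_derive_cst. Qed.

Lemma is_derive_continuous f x l : is_derive x 1 f l -> {for x, continuous f}.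
Proof.
move=> [df _]; apply: differentiable_continuous.
exact/derivable1_diffP.
Qed.

Lemma mean_value f df a b : (forall x, is_derive x 1 f (df x)) -> a < b ->
  exists c, [/\ a < c, c < b & f b - f a = df c * (b - a)].
Proof.
move=> fdf ab; have [|c] := MVT ab (fun x _ => fdf x).
  by apply: continuous_subspaceT => x; exact: is_derive_continuous (fdf x).
by rewrite in_itv/= => /andP[ac cb] e; exists c.
Qed.

Lemma derive_gt0_right f x l : is_derive x 1 f l -> 0 < l ->
  \forall y \near x^'+, f x < f y.
Proof.
move=> [df fl] l0.
have : (fun h => h^-1 *: ((f \o shift x) h - f x)) @ 0^' --> l.
  have := df; rewrite /derivable => /cvg_ex[/= k kP].
  suff <- : k = l.
    apply: cvg_trans kP; apply: near_eq_cvg; near=> h.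
    by rewrite /= [h%:A]mulr1.
  by rewrite -fl; apply/esym/cvg_lim.
move=> /cvgrPdist_lt /(_ l l0) [e /= e0 He].
exists e => //= y yx xy.
have := He (y - x); rewrite /ball_/= sub0r normrN distrC => /(_ yx).
rewrite subr_eq0 gt_eqF// => /(_ isT); rewrite subrK ltr_distlC => /andP[+ _].
rewrite subrr; rewrite /GRing.scale/= pmulr_rgt0 ?invr_gt0 ?subr_gt0//.
Unshelve. all: by end_near. Qed.

(** Only points to the right of [x] are compared: this is all that is available for the time
    variable, whose minimum is taken over larger [s]. *)
Lemma derive_ge0_right f x l d : is_derive x 1 f l -> 0 < d ->
  (forall y, x < y < x + d -> f x <= f y) -> 0 <= l.
Proof.
move=> fl d0 H; rewrite leNgt; apply/negP => l0.
have Nfl : is_derive x 1 (- f) (- l) by exact: is_deriveN.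
have := derive_gt0_right Nfl; rewrite oppr_gt0 => /(_ l0) fx.
near x^'+ => y.
have : (- f) x < (- f) y by near: y.
rewrite ltrN2 ltNge H//; apply/andP; split; near: y.
  exact: nbhs_right_gt.
by apply: nbhs_right_lt; rewrite ltrDl.
Unshelve. all: by end_near. Qed.

Lemma derive_min_eq0 f x l : is_derive x 1 f l -> (forall y, f x <= f y) ->
  l = 0.
Proof.
move=> fl fx; apply: le_anti; apply/andP; split; last first.
  by apply: derive_ge0_right fl ltr01 _ => y _.
rewrite -oppr_ge0.
have fl' : is_derive (- x) 1 (fun y => f (- y)) (- l).
  rewrite (_ : - l = l * -1); last by rewrite mulrN1.
  apply: (@is_derive_compE f (fun y => - y) (- x)); by rewrite opprK.
by apply: derive_ge0_right fl' ltr01 _ => y _; rewrite opprK.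
Qed.

(** If [l < 0], then [df], which vanishes at the minimum, is negative just to the right of [x], and
    the mean value theorem makes [f] drop below [f x]. *)
Lemma derive2_min_ge0 f df x l : (forall y, is_derive y 1 f (df y)) ->
  is_derive x 1 df l -> (forall y, f x <= f y) -> 0 <= l.
Proof.
move=> fdf dfl fx; have dfx0 := derive_min_eq0 (fdf x) fx.
rewrite leNgt; apply/negP => l0.
have Nfl : is_derive x 1 (- df) (- l) by exact: is_deriveN.
have := derive_gt0_right Nfl; rewrite oppr_gt0 => /(_ l0) [e /= e0 He].
have [|c [xc cy]] := @mean_value f df x (x + e / 2) fdf.
- by rewrite ltrDl divr_gt0.
- have : (- df) x < (- df) c.
    apply: He => //=; rewrite ltr0_norm ?subr_lt0// opprB.
    by rewrite ltrBlDl (lt_le_trans cy)// lerD2l ler_pdivrMr// ler_pMr// ler1n.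
  rewrite ltrN2 dfx0 [x + _]addrC addrK => dc fy.
  have := fx (e / 2 + x); rewrite -subr_ge0 fy leNgt nmulr_rlt0// => /negP.
  by apply; rewrite divr_gt0.
Qed.

End one_variable.

(** * The standard normal distribution function *)

Section normal_cdf.
Context {R : realType}.
Implicit Types x y z p : R.
Local Notation leb := (@lebesgue_measure R).

Definition phi x : R := normal_pdf 0 1 x.

Definition Phi x : R := (\int[leb]_(t in `]-oo, x]) phi t)%R.

Lemma phiE x : phi x = (Num.sqrt (2 * pi))^-1 * expR (- (x ^+ 2 / 2)).
Proof.
rewrite /phi normal_pdfE ?oner_neq0// /normal_peak /normal_fun.
by rewrite expr1n mul1r subr0 !mulr_natl mulNr.
Qed.

Lemma normal_pdf_phi m x : normal_pdf m 1 x = phi (x - m).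
Proof. by rewrite /phi !normal_pdfE ?oner_neq0// /normal_fun subr0. Qed.

Lemma phi_gt0 x : 0 < phi x.
Proof.
rewrite phiE mulr_gt0 ?expR_gt0// invr_gt0 sqrtr_gt0 mulr_gt0// ?pi_gt0//.
Qed.

Lemma phiN x : phi (- x) = phi x.
Proof. by rewrite !phiE sqrrN. Qed.

Lemma is_derive_phi x : is_derive x 1 phi (- x * phi x).
Proof.
rewrite phiE (_ : phi = fun y => (Num.sqrt (2 * pi))^-1 *
    expR ((- 2^-1) * y ^+ 2)); last first.
  by apply/funext => y; rewrite phiE; congr (_ * expR _); field.
have D2 := is_deriveZE (- 2^-1) (is_derive_sqrE (is_derive_idE x)).
have D := is_deriveZE (Num.sqrt (2 * pi))^-1 (is_derive_compE (is_derive_expR _) D2).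
apply: is_derive_eq D _; rewrite (_ : - 2^-1 * x ^+ 2 = - (x ^+ 2 / 2)).
  by set c := (Num.sqrt _)^-1; set e := expR _; field.
by field.
Qed.

Lemma continuous_phi : continuous phi.
Proof. by move=> x; exact: is_derive_continuous (is_derive_phi x). Qed.

Lemma measurable_phi : measurable_fun setT phi.
Proof. exact: measurable_normal_pdf. Qed.

Lemma PhiE x : normal_prob 0 1 `]-oo, x] = (Phi x)%:E.
Proof.
rewrite /Phi /Rintegral fineK// -/(normal_prob (0 : R) 1 `]-oo, x]).
by rewrite fin_num_measure.
Qed.

Lemma is_derive_Phi x : is_derive x 1 Phi (phi x).
Proof.
have [||||dP eP] := @continuous_FTC1 R phi -oo%O x (x + 1).
- by rewrite ltrDl.
- by apply: integrableS (integrable_normal_pdf 0 1).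
- by rewrite ltNyr.
- exact: continuous_phi.
by apply: DeriveDef => //; rewrite -derive1E.
Qed.

Lemma continuous_Phi : continuous Phi.
Proof. by move=> x; exact: is_derive_continuous (is_derive_Phi x). Qed.

Lemma Phi_lt : {mono Phi : x y / x < y}.
Proof.
apply: leW_mono; apply: le_mono => x y xy.
have [c [_ _ e]] := mean_value is_derive_Phi xy.
by rewrite -subr_gt0 e mulr_gt0 ?phi_gt0// subr_gt0.
Qed.

Lemma Phi_le : {mono Phi : x y / x <= y}.
Proof. by move=> x y; rewrite !leNgt Phi_lt. Qed.

Lemma Phi_inj : injective Phi.
Proof. by move=> x y e; apply: le_anti; rewrite -(Phi_le x y) -(Phi_le y x) e lexx. Qed.

Lemma Phi_le1 x : Phi x <= 1.
Proof. by rewrite -lee_fin -PhiE probability_le1. Qed.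

Lemma Phi_ge0 x : 0 <= Phi x.
Proof. by rewrite -lee_fin -PhiE measure_ge0. Qed.

Lemma Phi_lt1 x : Phi x < 1.
Proof. by apply: lt_le_trans (Phi_le1 (x + 1)); rewrite Phi_lt ltrDl. Qed.

Lemma Phi_gt0 x : 0 < Phi x.
Proof. by apply: le_lt_trans (Phi_ge0 (x - 1)) _; rewrite Phi_lt ltrBlDr ltrDl. Qed.

(** The identity seen as a random variable: [Phi] is its distribution function under
    [normal_prob 0 1], whence the limits at infinity. *)
Let idTR : measurableTypeR R -> R := idfun.

#[local] HB.instance Definition _ :=
  @isMeasurableFun.Build _ _ _ _ idTR (@measurable_id _ _ setT).

Lemma cvg_Phiy : Phi x @[x --> +oo] --> (1 : R).
Proof.
have := @cvg_cdfy1 _ _ R (normal_prob 0 1) idTR.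
rewrite (_ : cdf _ = EFin \o Phi); last by apply/funext => x /=; rewrite -PhiE.
by move/fine_cvg.
Qed.

Lemma cvg_PhiNy : Phi x @[x --> -oo] --> (0 : R).
Proof.
have := @cvg_cdfNy0 _ _ R (normal_prob 0 1) idTR.
rewrite (_ : cdf _ = EFin \o Phi); last by apply/funext => x /=; rewrite -PhiE.
by move/fine_cvg.
Qed.

Lemma PhiN x : Phi (- x) = 1 - Phi x.
Proof.
pose f y := Phi y + Phi (- y).
have df y : is_derive y 1 f 0.
  have D := is_deriveDE (is_derive_Phi y)
    (is_derive_compE (is_derive_Phi (- y)) (is_deriveNE (is_derive_idE y))).
  by apply: is_derive_eq D _; rewrite phiN mulrN1 subrr.
suff : f x = 1 by rewrite /f => <-; rewrite addrC addKr.
have fy : f y @[y --> +oo] --> (1 : R).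
  rewrite -[1]addr0; apply: cvgD; first exact: cvg_Phiy.
  by have /cvgNy_compNP := cvg_PhiNy.
apply/esym/(cvg_unique _ fy) => //.
rewrite (_ : f = cst (f x)); first exact: cvg_cst.
by apply/funext => y; exact: is_derive_0_is_cst.
Qed.

Lemma Phi_small e : 0 < e -> exists M, forall x, x <= M -> Phi x < e.
Proof.
move=> e0; have /cvgrPdist_lt /(_ e e0) [M [_ HM]] := cvg_PhiNy.
exists (M - 1) => x xM; have := HM x; rewrite sub0r normrN ger0_norm ?Phi_ge0//.
by apply; lra.
Qed.

Lemma Phi_surj p : 0 < p < 1 -> exists x, Phi x = p.
Proof.
move=> /andP[p0 p1]; have [M HM] := Phi_small p0.
have [|N HN] := @Phi_small (1 - p); first by lra.
have MN : Num.min M N <= Num.max M (- N) by rewrite ge_min !le_max lexx.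
have [||x _ <-] := @IVT _ Phi (Num.min M N) (Num.max M (- N)) p MN; last by exists x.
  exact/continuous_subspaceT/continuous_Phi.
rewrite ge_min le_max; apply/andP; split; apply/orP; [left|right].
  by apply/ltW/HM; rewrite ge_min lexx.
apply: (@le_trans _ _ (Phi (- N))); last by rewrite Phi_le le_max lexx orbT.
by rewrite PhiN; have := HN N (lexx _); lra.
Qed.

(** Outside []0, 1[] the value is the meaningless default 0, so every flow fed to it must first be
    shown to stay strictly between 0 and 1. *)
Definition quantile p : R := xget 0 [set x | Phi x = p].

Lemma quantileK p : 0 < p < 1 -> Phi (quantile p) = p.
Proof.
move=> /Phi_surj[x xp]; rewrite /quantile; case: xgetP => // /(_ x).
by move=> /(_ xp).
Qed.

Lemma PhiK : cancel Phi quantile.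
Proof. by move=> x; apply: Phi_inj; rewrite quantileK// Phi_gt0 Phi_lt1. Qed.

Lemma is_derive_quantile p : 0 < p < 1 ->
  is_derive p 1 quantile (phi (quantile p))^-1.
Proof.
move=> p01; rewrite -{1}(quantileK p01).
apply: (@is_derive_inverse _ Phi).
- by near=> z; exact: PhiK.
- by near=> z; exact: continuous_Phi.
- exact: is_derive_Phi.
- by rewrite gt_eqF// phi_gt0.
Unshelve. all: by end_near. Qed.

Lemma phi_lip x : phi x <= phi 0.
Proof.
rewrite !phiE ler_pM2l; last by rewrite invr_gt0 sqrtr_gt0 mulr_gt0// pi_gt0.
by rewrite ler_expR expr0n/= mul0r oppr0 oppr_le0 divr_ge0// sqr_ge0.
Qed.

Lemma phi_decr x y : x ^+ 2 <= y ^+ 2 -> phi y <= phi x.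
Proof.
move=> xy; rewrite !phiE ler_pM2l; last by rewrite invr_gt0 sqrtr_gt0 mulr_gt0// pi_gt0.
by rewrite ler_expR; lra.
Qed.

End normal_cdf.

(** * Maximum principle for the Ornstein-Uhlenbeck flow *)

Section maximum_principle.
Context {R : realType}.
Implicit Types (r s x y z al eta : R) (u v : R -> R -> R).

(* [u = quantile \o w] for an Ornstein-Uhlenbeck flow [w]; the time is        *)
(* [s = exp (- t)], which decreases from [1] to [0].                          *)
Definition ou_quantile_flow (u u1 u2 ut : R -> R -> R) :=
  forall s x, 0 < s <= 1 ->
  [/\ is_derive x 1 (u s) (u1 s x), is_derive x 1 (u1 s) (u2 s x),
      is_derive s 1 (fun s' => u s' x) (ut s x),
      {for (s, x), continuous (fun p : R * R => u p.1 p.2)} &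
      - s * ut s x = u2 s x - u s x * u1 s x ^+ 2 - x * u1 s x].

(** Makes the range of the angle compact; the sign of the arc cosine is chosen to match the sine. *)
Lemma cos_sin_reduce al : exists2 be, be \in `[- pi, pi]%R &
  cos be = cos al /\ sin be = sin al :> R.
Proof.
have c1 : -1 <= cos al <= 1 by rewrite cos_geN1 cos_le1.
have [/andP[a0 api] ca] : 0 <= acos (cos al) <= pi /\ cos (acos (cos al)) = cos al.
  by split; [rewrite acos_ge0// acos_lepi | rewrite acosK// in_itv].
have sa : sin (acos (cos al)) ^+ 2 = sin al ^+ 2.
  by rewrite !sin2cos2 ca.
have /eqP := sa; rewrite eqf_sqr => /orP[] /eqP e.
  exists (acos (cos al)) => //.
  by rewrite in_itv/= api andbT (le_trans _ a0)// oppr_le0 pi_ge0.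
exists (- acos (cos al)).
  by rewrite in_itv/= lerN2 api/= (le_trans _ (pi_ge0 R))// oppr_le0.
by rewrite cosN sinN e opprK.
Qed.

(* At a negative minimum of [v(y) - u(x) - r cos al], [y = x + r sin al], the *)
(* first-order conditions read [v' = u' = m] and [m cos al = - sin al], so    *)
(* the equations force the time derivative to have the sign of [- m^2 C].     *)
Lemma flow_no_negative_min r eta (s0 x0 al0 : R) u u1 u2 ut v v1 v2 vt :
  let C s x al := v s (x + r * sin al) - u s x - r * cos al in
  ou_quantile_flow u u1 u2 ut -> ou_quantile_flow v v1 v2 vt ->
  0 < eta -> 0 < s0 -> s0 < 1 -> C s0 x0 al0 < 0 ->
  (forall x al, C s0 x0 al0 <= C s0 x al) ->
  (forall s, s0 < s < 1 ->
    C s0 x0 al0 + eta * (1 - s0) <= C s x0 al0 + eta * (1 - s)) -> False.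
Proof.
move=> C hu hv eta0 s00 s0lt1 C0neg Dmin Dmint.
have s0I : 0 < s0 <= 1 by rewrite s00 ltW.
pose y0 := x0 + r * sin al0.
have [du1 du2 dut _ pu] := hu s0 x0 s0I.
have [dv1 dv2 dvt _ pv] := hv s0 y0 s0I.
have dv1' y : is_derive y 1 (v s0) (v1 s0 y) by case: (hv s0 y s0I).
have du1' y : is_derive y 1 (u s0) (u1 s0 y) by case: (hu s0 y s0I).
have dv2' y : is_derive y 1 (v1 s0) (v2 s0 y) by case: (hv s0 y s0I).
have du2' y : is_derive y 1 (u1 s0) (u2 s0 y) by case: (hu s0 y s0I).
have shift_derive k y : is_derive y 1 (fun z : R => k + z) 1.
  by apply: is_derive_eq (is_deriveDE (is_derive_cstE k y) (is_derive_idE y)) _; rewrite add0r.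
have Ex : v1 s0 y0 - u1 s0 x0 = 0.
  have dE z : is_derive z 1 (fun z => v s0 (y0 + z) - u s0 (x0 + z))
      (v1 s0 (y0 + z) - u1 s0 (x0 + z)).
    by apply: is_derive_eq (is_deriveBE (is_derive_compE (dv1' _) (shift_derive y0 z))
      (is_derive_compE (du1' _) (shift_derive x0 z))) _; rewrite !mulr1.
  have := derive_min_eq0 (dE 0); rewrite !addr0; apply=> z.
  by have := Dmin (x0 + z) al0; rewrite /C /y0 (addrAC x0 z); lra.
have Exx : 0 <= v2 s0 y0 - u2 s0 x0.
  have dE z : is_derive z 1 (fun z => v s0 (y0 + z) - u s0 (x0 + z))
      (v1 s0 (y0 + z) - u1 s0 (x0 + z)).
    by apply: is_derive_eq (is_deriveBE (is_derive_compE (dv1' _) (shift_derive y0 z))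
      (is_derive_compE (du1' _) (shift_derive x0 z))) _; rewrite !mulr1.
  have ddE : is_derive (0 : R) 1 (fun z => v1 s0 (y0 + z) - u1 s0 (x0 + z))
      (v2 s0 (y0 + 0) - u2 s0 (x0 + 0)).
    by apply: is_derive_eq (is_deriveBE (is_derive_compE (dv2' _) (shift_derive y0 0))
      (is_derive_compE (du2' _) (shift_derive x0 0))) _; rewrite !mulr1.
  have := derive2_min_ge0 dE ddE; rewrite !addr0; apply=> z.
  by have := Dmin (x0 + z) al0; rewrite /C /y0 (addrAC x0 z); lra.
have Eal : v1 s0 y0 * (r * cos al0) + r * sin al0 = 0.
  have dE : is_derive al0 1 (fun be => v s0 (x0 + r * sin be) - r * cos be)
      (v1 s0 y0 * (r * cos al0) + r * sin al0).
    have Ds := is_deriveDE (is_derive_cstE x0 al0)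
      (is_deriveZE r (is_derive_sin al0)).
    have Dv := @is_derive_compE _ (v s0) (fun be => x0 + r * sin be) _ _ _
      (dv1' _) Ds.
    apply: is_derive_eq (is_deriveBE Dv (is_deriveZE r (is_derive_cos al0))) _.
    by rewrite /y0 add0r mulrN opprK.
  apply: (derive_min_eq0 dE) => be.
  by have := Dmin x0 be; rewrite /C; lra.
(* Larger [s] are earlier times, so the condition is one-sided; the term [eta * (1 - s)] makes it
   strict. *)
have Et : 0 <= vt s0 y0 - ut s0 x0 - eta.
  have dE : is_derive s0 1 (fun s' => v s' y0 - u s' x0 + eta * (1 - s'))
      (vt s0 y0 - ut s0 x0 - eta).
    have D1 := is_deriveZE eta (is_deriveBE (is_derive_cstE 1 s0) (is_derive_idE s0)).
    apply: is_derive_eq (is_deriveDE (is_deriveBE dvt dut) D1) _.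
    by rewrite sub0r mulrN1.
  apply: (derive_ge0_right dE (d := 1 - s0)); first by rewrite subr_gt0.
  move=> s'; rewrite subrKC => s's.
  by have := Dmint s' s's; rewrite /C /y0; lra.
move: Ex => /eqP; rewrite subr_eq0 => /eqP Ex; move: pv Eal Exx Et pu.
move: C0neg; rewrite /C /= -/y0 Ex.
set m := u1 s0 x0; set V := v s0 y0; set U := u s0 x0.
have : y0 = x0 + r * sin al0 by [].
move: (sin al0) (cos al0) (v2 s0 y0) (u2 s0 x0) (vt s0 y0) (ut s0 x0) => S T V2 U2 VT UT.
move=> -> C0 pv Eal V2U2 Et pu.
have : - s0 * (VT - UT) = (V2 - U2) - m ^+ 2 * (V - U - r * T)
   - m * (m * (r * T) + r * S) by rewrite mulrBr pv pu; ring.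
rewrite Eal mulr0 subr0 => E.
have : 0 <= m ^+ 2 * - (V - U - r * T) by rewrite mulr_ge0 ?sqr_ge0// oppr_ge0 ltW.
have : 0 < s0 * (VT - UT) by rewrite mulr_gt0//; lra.
by lra.
Qed.

(** A violation would give a negative minimum of the gap on a compact box of times, positions and
    angles. The hypothesis at large [x] excludes positions outside the box, and the initial
    condition excludes [s = 1]. The other end of the time interval is harmless, since
    [flow_no_negative_min] compares with larger [s] only. *)
Lemma flow_comparison r u u1 u2 ut v v1 v2 vt :
  ou_quantile_flow u u1 u2 ut -> ou_quantile_flow v v1 v2 vt ->
  (forall s1, 0 < s1 -> exists X : R, forall s x al, s1 <= s <= 1 -> X <= `|x| ->
     r * cos al <= v s (x + r * sin al) - u s x) ->
  (forall x al, r * cos al <= v 1 (x + r * sin al) - u 1 x) ->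
  forall s x al, 0 < s <= 1 -> r * cos al <= v s (x + r * sin al) - u s x.
Proof.
move=> hu hv far init s x al /andP[s_gt0 s_le1].
rewrite leNgt; apply/negP => neg.
have [X HX] := far s s_gt0.
pose C (p : R * R * R) : R :=
  v p.1.1 (p.1.2 + r * sin p.2) - u p.1.1 p.1.2 - r * cos p.2.
pose c := C (s, x, al).
have c0 : c < 0 by rewrite /c /C/= subr_lt0.
(* The perturbation [eta * (1 - s)] vanishes at the initial time and is at most [- c / 2], so the
   violation remains negative. *)
pose eta := - c / 2.
have eta0 : 0 < eta by rewrite /eta; lra.
pose D p := C p + eta * (1 - p.1.1).
pose K : set (R * R * R) := `[s, 1] `*` `[- `|X|, `|X|] `*` `[- pi, pi].
have K0 : K !=set0.
  exists (s, 0, 0); split => //=; [split => //=|]; rewrite in_itv/=.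
  - by rewrite lexx.
  - by rewrite oppr_le0 normr_ge0.
  - by rewrite oppr_le0 pi_ge0.
have cK : compact K.
  by apply: compact_setX; [apply: compact_setX|]; exact: segment_compact.
have Dcont : {within K, continuous D}.
  apply: continuous_in_subspaceT => -[[s' x'] al']; rewrite inE => -[[/=]].
  rewrite in_itv/= => /andP[ss' s'1] _ _.
  have s'01 : 0 < s' <= 1 by rewrite (lt_le_trans s_gt0 ss') s'1.
  have [_ _ _ cu _] := hu s' x' s'01.
  have [_ _ _ cv _] := hv s' (x' + r * sin al') s'01.
  have c1 : {for (s', x', al'), continuous (fun p : R * R * R => p.1.1)}.
    by apply: continuous_comp; exact: cvg_fst.
  have c2 : {for (s', x', al'), continuous (fun p : R * R * R => p.1.2)}.
    by apply: continuous_comp; [exact: cvg_fst|exact: cvg_snd].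
  have c3 : {for (s', x', al'), continuous (fun p : R * R * R => p.2)}.
    exact: cvg_snd.
  have csin : {for (s', x', al'), continuous (fun p : R * R * R => r * sin p.2)}.
    apply: continuousM; first exact: cst_continuous.
    by apply: continuous_comp c3 _; exact: continuous_sin.
  have ccos : {for (s', x', al'), continuous (fun p : R * R * R => r * cos p.2)}.
    apply: continuousM; first exact: cst_continuous.
    by apply: continuous_comp c3 _; exact: continuous_cos.
  apply: continuousD.
    apply: continuousB; last exact: ccos.
    apply: continuousB.
      apply: (@continuous_comp _ _ _
        (fun p : R * R * R => (p.1.1, p.1.2 + r * sin p.2))
        (fun q : R * R => v q.1 q.2)); last exact: cv.
      exact: (cvg_pair c1 (continuousD c2 csin)).
    apply: (@continuous_comp _ _ _ (fun p : R * R * R => p.1)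
      (fun q : R * R => u q.1 q.2)); last exact: cu.
    exact: cvg_fst.
  apply: continuousM; first exact: cst_continuous.
  by apply: continuousB; [exact: cst_continuous|exact: c1].
have [[[s0 x0] al0] /set_mem[[/=]]] := compact_EVT_min K0 cK Dcont.
rewrite !in_itv/= => /andP[ss0 s01] x0I al0I Dmin.
have s0I : 0 < s0 <= 1 by rewrite (lt_le_trans s_gt0 ss0) s01.
(* the minimum over the compact set is a minimum over all [x] and [al] *)
have D0neg : D (s0, x0, al0) < 0.
  have [be beI [cbe sbe]] := cos_sin_reduce al.
  have [xX|xX] := leP `|X| `|x|.
    have := HX s x al; rewrite lexx s_le1 => /(_ isT).
    by rewrite (le_trans (ler_norm _) xX) => /(_ isT); rewrite leNgt neg.
  apply: (@le_lt_trans _ _ (D (s, x, be))).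
    apply: Dmin; rewrite inE; split => //=; split => /=.
      by rewrite in_itv/= lexx.
    by rewrite in_itv/= -ler_norml ltW.
  rewrite /D/=; have -> : C (s, x, be) = c by rewrite /c /C /= cbe sbe.
  by rewrite /eta; nra.
have {}Dmin s' x' al' : s <= s' <= 1 -> D (s0, x0, al0) <= D (s', x', al').
  move=> s'I; have [xX|xX] := leP `|X| `|x'|.
    have /andP[_ s'1] := s'I.
    have := HX s' x' al' s'I (le_trans (ler_norm _) xX).
    rewrite -subr_ge0 => CX; apply: (le_trans (ltW D0neg)).
    by rewrite /D addr_ge0// mulr_ge0 ?(ltW eta0)// subr_ge0.
  have [be beI [cbe sbe]] := cos_sin_reduce al'.
  have -> : D (s', x', al') = D (s', x', be) by rewrite /D /C /= cbe sbe.
  apply: Dmin; rewrite inE; split => //=; split => /=.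
    by rewrite in_itv.
  by rewrite in_itv/= -ler_norml ltW.
have s0lt1 : s0 < 1.
  rewrite lt_neqAle s01 andbT; apply/eqP => s0E.
  move: D0neg; rewrite /D /C /= s0E subrr mulr0 addr0.
  by rewrite ltNge subr_ge0 init.
have C0neg : C (s0, x0, al0) < 0.
  by apply: le_lt_trans D0neg; rewrite /D lerDl mulr_ge0 ?(ltW eta0)//= subr_ge0.
have s0s : s <= s0 <= 1 by rewrite ss0.
have {}Dmin s' x' al' : s <= s' <= 1 -> C (s0, x0, al0) + eta * (1 - s0) <=
    C (s', x', al') + eta * (1 - s') by exact: Dmin.
apply: (flow_no_negative_min hu hv eta0 _ s0lt1 C0neg).
- exact: lt_le_trans ss0.
- by move=> x' be; have := Dmin s0 x' be s0s; rewrite lerD2r.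
- move=> s' /andP[s0s' s'1]; apply: Dmin.
  by rewrite (le_trans ss0 (ltW s0s')) (ltW s'1).
Qed.

End maximum_principle.


(** * Explicit solutions of the flow *)

Section mollified_step.
Context {R : realType}.
Implicit Types (s x y z a c tau : R) (w wt : R -> R -> R).

(** The Ornstein-Uhlenbeck equation [w_t = w'' - x w'] in the variable [s = exp (- t)], for which
    [w_t = - s w_s]. *)
Definition ou_flow w w1 w2 wt :=
  forall s x, 0 < s <= 1 ->
  [/\ is_derive x 1 (w s) (w1 s x), is_derive x 1 (w1 s) (w2 s x),
      is_derive s 1 (fun s' => w s' x) (wt s x),
      {for (s, x), continuous (fun p : R * R => w p.1 p.2)} &
      - s * wt s x = w2 s x - x * w1 s x].

Lemma is_derive_phiV y : is_derive y 1 (fun z => (phi z)^-1) (y / phi y).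
Proof.
have py : phi y != 0 by rewrite gt_eqF// phi_gt0.
apply: is_derive_eq (is_deriveV py (is_derive_phi y)) _.
by rewrite /GRing.scale/=; field.
Qed.

(** With [w = Phi u] one has [w' = phi(u) u'] and, since [phi'(u) = - u phi(u)], also
    [w'' = phi(u) (u'' - u u'^2)]: this is the origin of the nonlinear term in the equation for
    [u]. *)
Lemma quantile_flow w w1 w2 wt : ou_flow w w1 w2 wt ->
  (forall s x, 0 < s <= 1 -> 0 < w s x < 1) ->
  let u s x := quantile (w s x) in
  let u1 s x := (phi (u s x))^-1 * w1 s x in
  ou_quantile_flow u u1
    (fun s x => (phi (u s x))^-1 * w2 s x + u s x * u1 s x ^+ 2)
    (fun s x => (phi (u s x))^-1 * wt s x).
Proof.
move=> hw w01 u u1 s x s01.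
have [d1 d2 dt cw pde] := hw s x s01.
have pu : phi (u s x) != 0 by rewrite gt_eqF// phi_gt0.
have dq := is_derive_quantile (w01 s x s01).
have du1 : is_derive x 1 (u s) (u1 s x) := is_derive_compE dq d1.
split.
- exact: du1.
- have D := is_deriveME (is_derive_compE (is_derive_phiV (u s x)) du1) d2.
  by apply: is_derive_eq D _; rewrite /u1; field.
- exact: @is_derive_compE _ quantile (fun s' => w s' x) _ _ _ dq dt.
- apply: (@continuous_comp _ _ _ (fun p : R * R => w p.1 p.2) quantile) => //.
  exact: is_derive_continuous dq.
- by rewrite mulrCA pde /u1; field.
Qed.

Variable tau : R.
Hypothesis tau1 : 1 < tau.

Let sg s := Num.sqrt (tau - s ^+ 2).

(** [Phi (ou_arg a s x)] is the probability that [s x + (tau - s^2)^(1/2) Z] exceeds [a], for [Z]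
    standard normal: the flow at [s] of the indicator of [[a, +oo[], mollified beforehand with
    variance [tau - 1]. *)
Definition ou_arg a s x : R := (s * x - a) / Num.sqrt (tau - s ^+ 2).

Lemma ou_var_gt0 s : 0 < s <= 1 -> 0 < tau - s ^+ 2.
Proof. move=> /andP[s0 s1]; rewrite subr_gt0 (le_lt_trans _ tau1)//.
by rewrite expr_le1// ltW. Qed.

Let sg_gt0 s : 0 < s <= 1 -> 0 < sg s.
Proof. by move=> s01; rewrite sqrtr_gt0 ou_var_gt0. Qed.

Let dsgV s : 0 < s <= 1 -> is_derive s 1 (fun s' => (sg s')^-1) (s / sg s ^+ 3).
Proof.
move=> s01; have sg0 : sg s != 0 by rewrite gt_eqF// sg_gt0.
have D := is_deriveBE (is_derive_cstE tau s) (is_derive_sqrE (is_derive_idE s)).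
have Ds := @is_derive_compE _ Num.sqrt (fun s' => tau - s' ^+ 2) _ _ _
  (is_derive1_sqrt (ou_var_gt0 s01)) D.
apply: is_derive_eq (is_deriveV sg0 Ds) _.
by rewrite /GRing.scale/= -/(sg s); field.
Qed.

Lemma ou_flow_Phi a :
  let N := ou_arg a in
  ou_flow (fun s x => Phi (N s x)) (fun s x => phi (N s x) * (s / sg s))
    (fun s x => - N s x * phi (N s x) * (s / sg s) ^+ 2)
    (fun s x => phi (N s x) * (x / sg s + N s x * s / sg s ^+ 2)).
Proof.
move=> N s x s01; have sg0 : sg s != 0 by rewrite gt_eqF// sg_gt0.
have dN : is_derive x 1 (N s) (s / sg s).
  have D := is_deriveBE (is_deriveZE s (is_derive_idE x)) (is_derive_cstE a x).
  apply: is_derive_eq (is_deriveME D (is_derive_cstE (sg s)^-1 x)) _.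
  by field.
have dNs : is_derive s 1 (fun s' => N s' x) (x / sg s + N s x * s / sg s ^+ 2).
  have D := is_deriveBE (is_deriveME (is_derive_idE s) (is_derive_cstE x s))
    (is_derive_cstE a s).
  apply: is_derive_eq (is_deriveME D (dsgV s01)) _.
  by rewrite /N /ou_arg -/(sg s); field.
split.
- exact: is_derive_compE (is_derive_Phi (N s x)) dN.
- have D := is_deriveME (is_derive_compE (is_derive_phi (N s x)) dN)
    (is_derive_cstE (s / sg s) x).
  by apply: is_derive_eq D _; ring.
- exact: @is_derive_compE _ Phi (fun s' => N s' x) _ _ _ (is_derive_Phi _) dNs.
- apply: (@continuous_comp _ _ _ (fun p : R * R => N p.1 p.2) Phi); last first.
    exact: continuous_Phi.
  have c1 : {for (s, x), continuous (fun p : R * R => p.1)} by exact: cvg_fst.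
  have c2 : {for (s, x), continuous (fun p : R * R => p.2)} by exact: cvg_snd.
  apply: continuousM.
    apply: continuousB; last exact: cst_continuous.
    exact: continuousM.
  apply: (@continuous_comp _ _ _ (fun p : R * R => p.1) (fun s' => (sg s')^-1)).
    exact: c1.
  exact: is_derive_continuous (dsgV s01).
- have : N s x * sg s = s * x - a by rewrite /N /ou_arg -/(sg s) divfK.
  by set p := phi _; set n := N s x; set g := sg s => e; field.
Qed.

Lemma ou_flow_sum (n : nat) (c0 : R) (c : 'I_n -> R) (W W1 W2 Wt : 'I_n -> R -> R -> R) :
  (forall k, ou_flow (W k) (W1 k) (W2 k) (Wt k)) ->
  ou_flow (fun s x => c0 + \sum_k c k * W k s x)
    (fun s x => \sum_k c k * W1 k s x) (fun s x => \sum_k c k * W2 k s x)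
    (fun s x => \sum_k c k * Wt k s x).
Proof.
move=> hW s x s01.
have dsum (F dF : 'I_n -> R -> R) y : (forall k, is_derive y 1 (F k) (dF k y)) ->
    is_derive y 1 (fun z => \sum_k c k * F k z) (\sum_k c k * dF k y).
  move=> FdF; rewrite (_ : (fun z => _) = \sum_k (fun z => c k * F k z)).
    by apply: is_derive_sum => k; exact: is_deriveZE.
  by apply/funext => z; rewrite fct_sumE.
have dc0 F y l : is_derive y 1 F l -> is_derive y 1 (fun z => c0 + F z) l.
  move=> Fl; apply: is_derive_eq (is_deriveDE (is_derive_cstE c0 y) Fl) _.
  by rewrite add0r.
split.
- apply: dc0; apply: (dsum (fun k => W k s) (fun k => W1 k s)) => k.
  by have [] := hW k s x s01.
- apply: (dsum (fun k => W1 k s) (fun k => W2 k s)) => k.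
  by have [] := hW k s x s01.
- apply: dc0; apply: (dsum (fun k s' => W k s' x) (fun k s' => Wt k s' x)) => k.
  by have [] := hW k s x s01.
- apply: continuousD; first exact: cst_continuous.
  apply: cvg_big => [|k _]; first exact: add_continuous.
  apply: continuousM; first exact: cst_continuous.
  by have [] := hW k s x s01.
- rewrite !mulr_sumr -sumrB; apply: eq_bigr => k _.
  have [_ _ _ _ e] := hW k s x s01.
  by rewrite mulrCA e mulrBr (mulrCA x).
Qed.

End mollified_step.

(** * Mollified step functions *)


Section step_functions.
Context {R : realType}.
Implicit Types (s x y z c tau d eta : R) (g h : R -> R).

Lemma ou_flowB (w w1 w2 wt v v1 v2 vt : R -> R -> R) :
  ou_flow w w1 w2 wt -> ou_flow v v1 v2 vt ->
  ou_flow (fun s x => w s x - v s x) (fun s x => w1 s x - v1 s x)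
    (fun s x => w2 s x - v2 s x) (fun s x => wt s x - vt s x).
Proof.
move=> hw hv s x s01.
have [a1 a2 at_ ca ea] := hw s x s01; have [b1 b2 bt cb eb] := hv s x s01.
split; [exact: is_deriveBE|exact: is_deriveBE|exact: is_deriveBE| |].
  exact: continuousB.
by rewrite !mulrBr ea eb; ring.
Qed.

Variables (xs : nat -> R) (n : nat).
Hypothesis xs_nd : {homo xs : i j / (i <= j)%N >-> i <= j}.

(** The mass that the Gaussian kernel centred at [s x], of variance [tau - s^2], gives to the [i]-th
    cell. *)
Definition cell_weight tau i s x : R :=
  Phi (ou_arg tau (xs i) s x) - Phi (ou_arg tau (xs i.+1) s x).

(* [g] is sampled at the left end of each cell and replaced by [c] off the grid. *)
Definition mollify c g tau s x : R :=
  c + \sum_(i < n) (g (xs i) - c) * cell_weight tau i s x.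

Lemma mollify_flow c g tau : 1 < tau ->
  exists w wt, ou_flow (mollify c g tau) w.1 w.2 wt.
Proof.
move=> tau1; have F (k : 'I_n) :=
  ou_flowB (ou_flow_Phi tau1 (xs k)) (ou_flow_Phi tau1 (xs k.+1)).
have /= := ou_flow_sum c (fun k : 'I_n => g (xs k) - c) F.
set w1 := (X in ou_flow _ X); set w2 := (X in ou_flow _ _ X).
by set wt := (X in ou_flow _ _ _ X) => H; exists (w1, w2), wt.
Qed.

Lemma ou_arg_ge a a' tau s x : a <= a' -> ou_arg tau a' s x <= ou_arg tau a s x.
Proof.
by move=> aa'; rewrite /ou_arg ler_wpM2r ?invr_ge0 ?sqrtr_ge0// lerD2l lerN2.
Qed.

Lemma cell_weight_ge0 tau i s x : 0 <= cell_weight tau i s x.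
Proof. by rewrite subr_ge0 Phi_le ou_arg_ge// xs_nd. Qed.

Lemma sum_cell_weight tau s x : \sum_(i < n) cell_weight tau i s x =
  Phi (ou_arg tau (xs 0) s x) - Phi (ou_arg tau (xs n) s x).
Proof.
rewrite -(big_mkord xpredT (fun i => cell_weight tau i s x)).
rewrite -(opprB (Phi _)) -(telescope_sumr (fun i => Phi (ou_arg tau (xs i) s x)))//.
by rewrite -sumrN; apply: eq_bigr => i _; rewrite opprB.
Qed.

Lemma sum_cell_weight_le1 tau s x : \sum_(i < n) cell_weight tau i s x <= 1.
Proof.
rewrite sum_cell_weight; have := Phi_le1 (ou_arg tau (xs 0) s x).
by have := Phi_ge0 (ou_arg tau (xs n) s x); lra.
Qed.

Lemma mollifyE c g tau s x : mollify c g tau s x =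
  c * (1 - \sum_(i < n) cell_weight tau i s x) +
  \sum_(i < n) g (xs i) * cell_weight tau i s x.
Proof.
rewrite /mollify; under eq_bigr do rewrite mulrBl.
by rewrite sumrB -mulr_sumr; ring.
Qed.

Lemma mollify_le c g m tau s x : c <= m -> (forall y, g y <= m) ->
  mollify c g tau s x <= m.
Proof.
move=> cm gm; rewrite mollifyE.
set q := \sum_(i < n) _.
have q1 : q <= 1 by exact: sum_cell_weight_le1.
have : \sum_(i < n) g (xs i) * cell_weight tau i s x <= m * q.
  by rewrite mulr_sumr; apply: ler_sum => i _; rewrite ler_wpM2r ?cell_weight_ge0.
have : c * (1 - q) <= m * (1 - q) by rewrite ler_wpM2r// subr_ge0.
by lra.
Qed.

(** Complements exchange upper and lower bounds, so that only upper estimates of [mollify] are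
    proved directly. *)
Lemma mollifyC c g tau s x :
  mollify (1 - c) (fun y => 1 - g y) tau s x = 1 - mollify c g tau s x.
Proof.
rewrite /mollify [in RHS]opprD addrA -sumrN; congr (_ + _).
by apply: eq_bigr => i _; ring.
Qed.

Lemma mollify_ge c g m tau s x : m <= c -> (forall y, m <= g y) ->
  m <= mollify c g tau s x.
Proof.
move=> cm gm; have : mollify (1 - c) (fun y => 1 - g y) tau s x <= 1 - m.
  by apply: mollify_le => [|y]; rewrite lerD2l lerN2.
by rewrite mollifyC; lra.
Qed.

(** Clipping the grid at [y] leaves the cells to the left of [y] unchanged and gives the others a
    nonnegative contribution, so the sum is bounded by a telescoping one. *)
Lemma sum_cell_weight_left tau s x y :
  \sum_(i < n | xs i.+1 <= y) cell_weight tau i s x <= Phi (- ou_arg tau y s x).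
Proof.
pose f i := Phi (ou_arg tau (Num.min (xs i) y) s x).
rewrite PhiN; apply: (@le_trans _ _ (\sum_(i < n) (f i - f i.+1))).
  rewrite big_mkcond/=; apply: ler_sum => i _; case: ifPn => [xy|_].
    rewrite /f /cell_weight !min_l//; apply: le_trans xy; exact: xs_nd.
  rewrite subr_ge0 Phi_le ou_arg_ge// le_min !ge_min lexx orbT andbT.
  by rewrite xs_nd.
rewrite (_ : \sum_(i < n) _ = f 0%N - f n); last first.
  rewrite -(big_mkord xpredT (fun i => f i - f i.+1)).
  rewrite -(opprB (f n)) -(telescope_sumr f)//.
  by rewrite -sumrN; apply: eq_bigr => i _; rewrite opprB.
by rewrite lerB// ?Phi_le1// Phi_le ou_arg_ge// ge_min lexx orbT.
Qed.

Lemma sum_cell_weight_right tau s x y :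
  \sum_(i < n | y <= xs i) cell_weight tau i s x <= Phi (ou_arg tau y s x).
Proof.
pose f i := Phi (ou_arg tau (Num.max (xs i) y) s x).
apply: (@le_trans _ _ (\sum_(i < n) (f i - f i.+1))).
  rewrite big_mkcond/=; apply: ler_sum => i _; case: ifPn => [xy|_].
    rewrite /f /cell_weight !max_l//; apply: (le_trans xy); exact: xs_nd.
  rewrite subr_ge0 Phi_le ou_arg_ge// ge_max !le_max lexx orbT andbT.
  by rewrite xs_nd.
rewrite (_ : \sum_(i < n) _ = f 0%N - f n); last first.
  rewrite -(big_mkord xpredT (fun i => f i - f i.+1)).
  rewrite -(opprB (f n)) -(telescope_sumr f)//.
  by rewrite -sumrN; apply: eq_bigr => i _; rewrite opprB.
rewrite lerBlDr; apply: (@le_trans _ _ (Phi (ou_arg tau y s x))); last by rewrite lerDl Phi_ge0.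
by rewrite Phi_le ou_arg_ge// le_max lexx orbT.
Qed.

Lemma ou_arg1 eta a x : 0 < eta -> ou_arg (1 + eta ^+ 2) a 1 x = (x - a) / eta.
Proof.
by move=> eta0; rewrite /ou_arg mul1r expr1n [1 + _]addrC addrK sqrtr_sqr gtr0_norm.
Qed.

(** At [s = 1] the kernel has standard deviation [eta], so each side beyond distance [d] has mass
    [Phi (- (d / eta))]. Two such tails bound the distant cells and two more the mass off the grid,
    whence the factor 4. *)
Lemma mollify_local eta c g m d x :
  0 < eta -> c <= 1 -> (forall y, g y <= 1) -> 0 <= m ->
  c <= m \/ (xs 0 <= x - d /\ x + d <= xs n) ->
  (forall i, (i < n)%N -> x - d < xs i.+1 -> xs i < x + d -> g (xs i) <= m) ->
  mollify c g (1 + eta ^+ 2) 1 x <= m + 4 * Phi (- (d / eta)).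
Proof.
move=> eta0 c1 g1 m0 cout gnear; set T := Phi _; set tau := 1 + _.
have T0 : 0 <= T by exact: Phi_ge0.
rewrite mollifyE; set q := \sum_(i < n) _.
have q1 : 0 <= 1 - q by rewrite subr_ge0 sum_cell_weight_le1.
have out : (c - m) * (1 - q) <= 2 * T.
  case: cout => [cm|[x0 xn]].
    by apply: (@le_trans _ _ 0); [rewrite mulr_le0_ge0// subr_le0|rewrite mulr_ge0].
  have : 1 - q <= 2 * T.
    rewrite /q sum_cell_weight opprB addrCA -PhiN !ou_arg1//.
    rewrite (_ : 2 * T = T + T); last by ring.
    apply: lerD; rewrite Phi_le.
      by rewrite -mulNr ler_pM2r ?invr_gt0//; lra.
    by rewrite lerN2 ler_pM2r ?invr_gt0//; lra.
  by apply: le_trans; rewrite ler_piMl//; lra.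
have inn : \sum_(i < n) (g (xs i) - m) * cell_weight tau i 1 x <= T + T.
  have L := sum_cell_weight_left tau 1 x (x - d).
  have U := sum_cell_weight_right tau 1 x (x + d).
  rewrite ou_arg1// in L; rewrite ou_arg1// in U.
  apply: (@le_trans _ _ (\sum_(i < n | xs i.+1 <= x - d) cell_weight tau i 1 x +
      \sum_(i < n | x + d <= xs i) cell_weight tau i 1 x)); last first.
    apply: lerD; first by rewrite (le_trans L)// Phi_le lerN2 ler_pM2r ?invr_gt0//; lra.
    by rewrite (le_trans U)// Phi_le -mulNr ler_pM2r ?invr_gt0//; lra.
  rewrite [X in _ <= X + _]big_mkcond [X in _ <= _ + X]big_mkcond -big_split/=.
  apply: ler_sum => i _; have w0 := cell_weight_ge0 tau i 1 x.
  have gw : (g (xs i) - m) * cell_weight tau i 1 x <= cell_weight tau i 1 x.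
    by rewrite ler_piMl//; have := g1 (xs i); lra.
  case: ifPn => [_|]; first by case: ifPn => _; lra.
  rewrite -ltNge => xi; case: ifPn => [_|]; first by lra.
  rewrite -ltNge => ix; rewrite addr0 mulr_le0_ge0// subr_le0.
  exact: gnear.
have : \sum_(i < n) (g (xs i) - m) * cell_weight tau i 1 x =
    \sum_(i < n) g (xs i) * cell_weight tau i 1 x - m * q.
  by under eq_bigr do rewrite mulrBl; rewrite sumrB -mulr_sumr.
by lra.
Qed.

End step_functions.


(** * Isoperimetry for step functions *)

Section step_isoperimetry.
Context {R : realType}.
Implicit Types (r s x y z al tau delta eta : R) (g k : R -> R).

(** The triangle inequality in the plane: [(D, s)] has length [r] and is displaced by at most
    [(4 * delta, 2 * c)]. *)
Lemma enlarged_sqr_sum_le (D D' s r delta c : R) : 0 < delta -> 0 < c -> 0 <= D ->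
  0 <= D' -> 0 <= s -> D <= r -> s <= r -> D ^+ 2 + s ^+ 2 = r ^+ 2 ->
  D' <= D + 4 * delta ->
  D' ^+ 2 + (s + 2 * c) ^+ 2 <= (r + 4 * delta + 2 * c) ^+ 2.
Proof.
move=> delta0 c0 D0 D'0 s0 Dr sr E DD'.
have h1 : D' ^+ 2 <= (D + 4 * delta) ^+ 2.
  by rewrite lerXn2r// nnegrE addr_ge0// mulr_ge0// ltW.
have h2 : 0 <= c * (r - s) by rewrite mulr_ge0 ?subr_ge0// ltW.
have h3 : 0 <= delta * (r - D) by rewrite mulr_ge0 ?subr_ge0// ltW.
have h4 : 0 < delta * c by rewrite mulr_gt0.
by move: h1 h2 h3 h4 E; clear; nra.
Qed.

Variables (xs : nat -> R) (n : nat).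
Hypothesis xs_nd : {homo xs : i j / (i <= j)%N >-> i <= j}.

(** The kernel always leaves some mass off the grid, where the value is [c < 1]; hence [g] may reach
    1 and its flow still has a quantile. *)
Lemma mollify_lt1 (c : R) g tau s x : c < 1 -> (forall y, g y <= 1) ->
  mollify xs n c g tau s x < 1.
Proof.
move=> c1 g1; rewrite mollifyE.
have : \sum_(i < n) g (xs i) * cell_weight xs tau i s x <=
    \sum_(i < n) cell_weight xs tau i s x.
  by apply: ler_sum => i _; rewrite ler_piMl// cell_weight_ge0.
have q1 : \sum_(i < n) cell_weight xs tau i s x < 1.
  rewrite sum_cell_weight; have := Phi_lt1 (ou_arg tau (xs 0) s x).
  by have := Phi_gt0 (ou_arg tau (xs n) s x); lra.
move: q1; set q := \sum_(i < n) cell_weight _ _ _ _ _ => q1.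
have : c * (1 - q) < 1 * (1 - q) by rewrite ltr_pM2r// subr_gt0.
by lra.
Qed.

(** The standard normal mean of the step function equal to [g (xs i)] on the [i]-th cell and to [c]
    off the grid. *)
Definition step_mass (c : R) g : R :=
  c + \sum_(i < n) (g (xs i) - c) * (Phi (xs i.+1) - Phi (xs i)).

(* At time [s = eta] and [x = 0] the kernel has variance exactly [1]. *)
Lemma mollify_end (c : R) g eta : mollify xs n c g (1 + eta ^+ 2) eta 0 =
  step_mass c g.
Proof.
congr (_ + _); apply: eq_bigr => i _; congr (_ * _).
rewrite /cell_weight /ou_arg addrK sqrtr1 !divr1 mulr0 !sub0r !PhiN; ring.
Qed.

(** The kernel is centred at [s x], which leaves the bounded grid as [x] grows, uniformly in [s]
    because [s >= s1 > 0]; its width stays below the square root of [tau]. *)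
Lemma cell_mass_small tau (L s1 : R) : 1 < tau -> 0 < L -> 0 < s1 ->
  exists X : R, forall s x, s1 <= s <= 1 -> X <= `|x| ->
    \sum_(i < n) cell_weight xs tau i s x <= L.
Proof.
move=> tau1 L0 s10; have [T HT] := Phi_small L0.
exists ((`|xs 0| + `|xs n| + `|T| * Num.sqrt tau) / s1) => s x /andP[s1s s1'].
rewrite ler_pdivrMr// => Xx.
have s0 : 0 < s := lt_le_trans s10 s1s.
have s01 : 0 < s <= 1 by rewrite s0.
have sg0 : 0 < Num.sqrt (tau - s ^+ 2) by rewrite sqrtr_gt0 ou_var_gt0.
have sgt : Num.sqrt (tau - s ^+ 2) <= Num.sqrt tau.
  by rewrite ler_wsqrtr// lerBlDr lerDl sqr_ge0.
have Tsg : `|T| * Num.sqrt (tau - s ^+ 2) <= `|T| * Num.sqrt tau by rewrite ler_wpM2l.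
have sx : `|x| * s1 <= `|x| * s by rewrite ler_wpM2l.
have T0 : Phi (- `|T|) <= L.
  by apply/ltW/HT; rewrite lerNl (le_trans (ler_norm _))// normrN.
have n0 := ler_norm (xs 0); have n0' := ler_norm (- xs 0); rewrite normrN in n0'.
have nn := ler_norm (xs n); have nn' := ler_norm (- xs n); rewrite normrN in nn'.
have t0 := normr_ge0 (xs 0); have tn := normr_ge0 (xs n).
rewrite sum_cell_weight; have [x0|x0] := leP 0 x.
  have : Phi (- ou_arg tau (xs n) s x) <= Phi (- `|T|).
    rewrite Phi_le lerN2 /ou_arg ler_pdivlMr//.
    by move: Xx sx; rewrite (ger0_norm x0); lra.
  by rewrite PhiN; have := Phi_le1 (ou_arg tau (xs 0) s x); lra.
have : Phi (ou_arg tau (xs 0) s x) <= Phi (- `|T|).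
  rewrite Phi_le /ou_arg ler_pdivrMr// mulNr.
  by move: Xx sx; rewrite (ltr0_norm x0); lra.
by have := Phi_ge0 (ou_arg tau (xs n) s x); lra.
Qed.

Lemma Phi_increment (m c z : R) : 0 < c -> - m <= z -> z + c <= m ->
  c * phi m <= Phi (z + c) - Phi z.
Proof.
move=> c0 mz zm; have [||w [zw wc ->]] := @mean_value _ Phi phi z (z + c).
- exact: is_derive_Phi.
- by rewrite ltrDl.
- rewrite [z + c]addrC addrK mulrC ler_pM2r//; apply: phi_decr.
  rewrite -subr_ge0 (_ : _ - _ = (m - w) * (m + w)); last by ring.
  by rewrite mulr_ge0//; lra.
Qed.

(** In the margin [eps - r], the part [4 * delta] covers the distance from points to nearby samples
    and the rest pays for the mollification. The floors settle the comparison far away. Where [g]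
    exceeds its floor there is room [eps] up to the ends of the grid, so [k] is still sampled around
    the shifted point. *)
Lemma step_isoperimetry (M eps delta r : R) g k :
  0 < delta -> 0 <= r -> r + 4 * delta < eps ->
  (forall i, (i < n)%N -> xs i.+1 <= xs i + delta) ->
  (forall y, Phi (- M) <= g y <= Phi M) ->
  (forall y, Phi (- M + eps) <= k y <= 1) ->
  (forall x, Phi (- M) < g x -> xs 0 + eps <= x <= xs n - eps) ->
  (forall x y z s, 0 <= s -> Phi z <= g x -> (x - y) ^+ 2 + s ^+ 2 <= eps ^+ 2 ->
    Phi (z + s) <= k y) ->
  Phi (quantile (step_mass (Phi (- M)) g) + r) <= step_mass (Phi (- M + eps)) k.
Proof.
move=> delta0 r0 rdeps mesh gM kM gsupp gk.
(* [c] is spent twice: a sample of [g] near [x] is found at level [u - c], and [k] is bounded below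
   by level [u + s + c], a gain of [s + 2 * c]. *)
pose c := (eps - r - 4 * delta) / 2; have c0 : 0 < c by rewrite /c; lra.
have ceps : r + 4 * delta + 2 * c = eps by rewrite /c; field.
pose e := c * phi (M + eps + c) / 4.
have e0 : 0 < e by rewrite divr_gt0// mulr_gt0// phi_gt0.
have [T0 HT0] := Phi_small e0.
(* So small that the four tails at distance [delta] cost less than an increment of [Phi] over a step
   [c] in the relevant range. *)
pose eta := Num.min 1 (delta / (`|T0| + 1)).
have T1 : 0 < `|T0| + 1 by rewrite ltr_wpDl.
have eta0 : 0 < eta by rewrite lt_min ltr01 divr_gt0.
have eta1 : 0 < eta <= 1 by rewrite eta0 ge_min lexx.
have tau1 : 1 < 1 + eta ^+ 2 by rewrite ltrDl exprn_gt0.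
set tau := 1 + eta ^+ 2 in tau1.
have Te : 4 * Phi (- (delta / eta)) < c * phi (M + eps + c).
  have : Phi (- (delta / eta)) < e.
    apply: HT0; rewrite lerNl (@le_trans _ _ (`|T0| + 1))//.
      by rewrite (le_trans (ler_norm _))// normrN lerDl.
    rewrite ler_pdivlMr// mulrC -ler_pdivlMr//.
    by rewrite ge_min lexx orbT.
  by rewrite /e; lra.
pose G := mollify xs n (Phi (- M)) g tau.
pose K := mollify xs n (Phi (- M + eps)) k tau.
have GM s x : Phi (- M) <= G s x <= Phi M.
  apply/andP; split.
    by apply: mollify_ge => // y; have /andP[] := gM y.
  apply: mollify_le => [//||y]; last by have /andP[] := gM y.
  by have /andP[] := gM 0; apply: le_trans.
have G01 s x : 0 < G s x < 1.
  have /andP[a b] := GM s x.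
  by rewrite (lt_le_trans (Phi_gt0 _) a) (le_lt_trans b (Phi_lt1 _)).
have Kk s x : Phi (- M + eps) <= K s x.
  by apply: mollify_ge => // y; have /andP[] := kM y.
have K01 s x : 0 < K s x < 1.
  rewrite (lt_le_trans (Phi_gt0 _) (Kk s x))/=.
  by apply: mollify_lt1 => [|y]; [exact: Phi_lt1|have /andP[] := kM y].
have [G12 [Gt GF]] := mollify_flow xs n (Phi (- M)) g tau1.
have [K12 [Kt KF]] := mollify_flow xs n (Phi (- M + eps)) k tau1.
have := @flow_comparison _ r _ _ _ _ _ _ _ _ (quantile_flow GF (fun s x _ => G01 s x))
  (quantile_flow KF (fun s x _ => K01 s x)).
rewrite -/G -/K => comp.
have Kv s x : - M + eps <= quantile (K s x) by rewrite -Phi_le quantileK.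
have far (s1 : R) : 0 < s1 -> exists X : R, forall s x al, s1 <= s <= 1 ->
    X <= `|x| -> r * cos al <= quantile (K s (x + r * sin al)) - quantile (G s x).
  (* Once the grid has mass at most [L], the quantile of [G] is at most [- M + eps - r], while that
     of [K] is never below [- M + eps]. *)
  move=> s10; pose L := Phi (- M + eps - r) - Phi (- M).
  have L0 : 0 < L by rewrite subr_gt0 Phi_lt; lra.
  have [X HX] := cell_mass_small tau1 L0 s10.
  exists X => s x al sI xX; have qL := HX s x sI xX.
  have uM : quantile (G s x) <= - M + eps - r.
    rewrite -Phi_le quantileK// (@le_trans _ _ (Phi (- M) + L))//; last by rewrite /L; lra.
    rewrite lerD2l (le_trans _ qL)//; apply: ler_sum => i _.
    rewrite ler_piMl ?cell_weight_ge0//.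
    have /andP[_] := gM (xs i); have := Phi_le1 M; have := Phi_ge0 (- M); lra.
  have := Kv s (x + r * sin al).
  have : r * cos al <= r by rewrite ler_piMr// cos_le1.
  by lra.
have init x al : r * cos al <= quantile (K 1 (x + r * sin al)) - quantile (G 1 x).
  set y := x + r * sin al; set u := quantile (G 1 x).
  have uI : - M <= u <= M by rewrite -(Phi_le (- M)) -(Phi_le u) quantileK.
  pose s := r * `|cos al|.
  have s0 : 0 <= s by rewrite mulr_ge0.
  have sr : s <= r by rewrite ler_piMr// ler_norml cos_geN1 cos_le1.
  have cs : r * cos al <= s by rewrite ler_wpM2l// ler_norm.
  have xys : (x - y) ^+ 2 + s ^+ 2 = r ^+ 2.
    rewrite /y /s exprMn real_normK ?num_real// -[X in _ = X]mulr1 -(cos2Dsin2 al).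
    by ring.
  suff : Phi (u + s) <= K 1 y.
    move=> us; have : u + s <= quantile (K 1 y) by rewrite -Phi_le quantileK.
    by lra.
  pose B := Phi (u + s + c).
  have local : B <= Phi (- M + eps) \/ (xs 0 <= y - delta /\ y + delta <= xs n) ->
      (forall i, (i < n)%N -> y - delta < xs i.+1 -> xs i < y + delta -> B <= k (xs i)) ->
      Phi (u + s) <= K 1 y.
    move=> Bout Bin.
    have /(_ (1 - Phi (- M + eps)) (fun z => 1 - k z) (1 - B) delta y) :=
      @mollify_local _ xs n xs_nd eta.
    have -> : 1 - Phi (- M + eps) <= 1 by have := Phi_ge0 (- M + eps); lra.
    rewrite eta0 subr_ge0 Phi_le1 => /(_ isT isT) H.
    have {H} := H _ isT; rewrite mollifyC -/tau -/(K 1 y) => H.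
    have {H} : 1 - K 1 y <= 1 - B + 4 * Phi (- (delta / eta)).
      apply: H.
      - by move=> z; have /andP[] := kM z; have := Phi_ge0 (- M + eps); lra.
      - by case: Bout => [h|h]; [left; rewrite lerD2l lerN2|right].
      - by move=> i i_n a b; rewrite lerD2l lerN2; exact: Bin.
    have : c * phi (M + eps + c) <= Phi (u + s + c) - Phi (u + s).
      by apply: Phi_increment => //; lra.
    by rewrite -/B; lra.
  (* If [u - c] lies below the floor of [g], the floor of [k] suffices. *)
  have [uc|uc] := ltP (u - c) (- M).
    have BM : B <= Phi (- M + eps) by rewrite Phi_le; lra.
    by apply: local => [|i _ _ _]; [left|have /andP[+ _] := kM (xs i); exact: le_trans].
  (* Otherwise some sample near [x] exceeds [Phi (u - c)]: if none did, the tails, which cost less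
     than the increment from [u - c] to [u], would leave [G 1 x] below [Phi u]. *)
  have [i [i_n [xi ix gi]]] : exists i, (i < n)%N /\
      [/\ x - delta < xs i.+1, xs i < x + delta & Phi (u - c) < g (xs i)].
    apply: contrapT => /forallNP noi.
    have : G 1 x <= Phi (u - c) + 4 * Phi (- (delta / eta)).
      apply: mollify_local => //.
      - exact: Phi_le1.
      - by move=> z; have /andP[_ h] := gM z; rewrite (le_trans h)// Phi_le1.
      - exact: Phi_ge0.
      - by left; rewrite Phi_le.
      - move=> i i_n a b; rewrite leNgt; apply/negP => gi.
        by apply: (noi i); split.
    have -> : G 1 x = Phi u by rewrite quantileK.
    have := @Phi_increment (M + eps + c) c (u - c) c0; rewrite subrK.
    have -> : - (M + eps + c) <= u - c by lra.
    have -> : u <= M + eps + c by lra.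
    by move=> /(_ isT isT); lra.
  have gi0 : Phi (- M) < g (xs i) by rewrite (le_lt_trans _ gi)// Phi_le.
  have /andP[i0 i1] := gsupp _ gi0.
  have di := mesh i i_n.
  have xyr : `|x - y| <= r.
    rewrite -(@ler_pXn2r _ 2) ?nnegrE// real_normK ?num_real// -xys.
    by rewrite lerDl sqr_ge0.
  move: (xyr); rewrite ler_norml => /andP[xy1 xy2].
  apply: local; first by right; lra.
  move=> j j_n yj jy; have dj := mesh j j_n.
  have -> : B = Phi ((u - c) + (s + 2 * c)) by rewrite /B; congr Phi; ring.
  apply: (gk (xs i)); [lra|exact: ltW|].
  have dij : `|xs i - xs j| <= `|x - y| + 4 * delta.
    have := ler_norm (x - y); have := ler_norm (- (x - y)); rewrite normrN.
    by rewrite ler_norml; lra.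
  rewrite -ceps -[(xs i - xs j) ^+ 2]real_normK ?num_real//.
  apply: enlarged_sqr_sum_le dij => //.
  by rewrite real_normK ?num_real.
have := comp far init eta 0 0 eta1.
rewrite sin0 cos0 mulr1 mulr0 addr0 /G /K /tau !mollify_end.
move=> H.
have Kq : 0 < step_mass (Phi (- M + eps)) k < 1 by rewrite -(mollify_end _ _ eta).
by rewrite -[leRHS](quantileK Kq) Phi_le; lra.
Qed.

End step_isoperimetry.


(** * Normal integrals over half-lines and cells *)

Section normal_intervals.
Context {R : realType}.
Implicit Types (m sigma x y a b : R).
Local Notation leb := (@lebesgue_measure R).

Let idTR : measurableTypeR R -> R := idfun.

#[local] HB.instance Definition _ :=
  @isMeasurableFun.Build _ _ _ _ idTR (@measurable_id _ _ setT).

Lemma normal_pdf_scale m sigma x : 0 < sigma ->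
  normal_pdf m sigma x = sigma^-1 * phi ((x - m) / sigma).
Proof.
move=> s0; have s0' : sigma != 0 by rewrite gt_eqF.
rewrite phiE normal_pdfE// /normal_peak /normal_fun mulrA; congr (_ * expR _).
  rewrite -mulrnAr sqrtrM ?sqr_ge0// sqrtr_sqr gtr0_norm// invfM.
  by rewrite mulr_natl.
by field.
Qed.

(** Both sides have the same derivative in [x] and tend to 0 at [-oo]. General [sigma] serves the
    sum of two independent normal variables in [normal_Phi_integral]. *)
Lemma normal_prob_sigma_Nyc m sigma x : 0 < sigma ->
  normal_prob m sigma `]-oo, x] = (Phi ((x - m) / sigma))%:E.
Proof.
move=> s0; have s0' : sigma != 0 by rewrite gt_eqF.
pose F y : R := (\int[leb]_(t in `]-oo, y]) normal_pdf m sigma t)%R.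
have FE y : normal_prob m sigma `]-oo, y] = (F y)%:E.
  rewrite /F /Rintegral fineK// -/(normal_prob m sigma `]-oo, y]).
  by rewrite fin_num_measure.
have dF y : is_derive y 1 F (phi ((y - m) / sigma) * sigma^-1).
  have [||||dP eP] := @continuous_FTC1 R (normal_pdf m sigma) -oo%O y (y + 1).
  - by rewrite ltrDl.
  - by apply: integrableS (integrable_normal_pdf m sigma).
  - by rewrite ltNyr.
  - exact: continuous_normal_pdf.
  by apply: DeriveDef => //; rewrite -derive1E mulrC -normal_pdf_scale.
pose D y := F y - Phi ((y - m) / sigma).
have dD y : is_derive y 1 D 0.
  have Dm := is_deriveBE (is_derive_idE y) (is_derive_cstE m y).
  have Ds := is_deriveME Dm (is_derive_cstE sigma^-1 y).
  have := is_deriveBE (dF y)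
    (@is_derive_compE _ Phi (fun z => (z - m) / sigma) _ _ _ (is_derive_Phi _) Ds).
  move/is_derive_eq; apply; set p := phi _; field.
  exact: s0'.
suff : D x = 0 by rewrite FE => /eqP; rewrite subr_eq0 => /eqP ->.
have FNy : F y @[y --> -oo] --> (0 : R).
  have := @cvg_cdfNy0 _ _ R (normal_prob m sigma) idTR.
  rewrite (_ : cdf _ = EFin \o F); last by apply/funext => z /=; rewrite -FE.
  by move/fine_cvg.
have DNy : D y @[y --> -oo] --> (0 : R).
  rewrite -[0]subr0; apply: cvgB => //.
  apply: cvg_comp cvg_PhiNy.
  apply: gt0_cvgMlNy; first by rewrite invr_gt0.
  exact: cvg_addrr_Ny.
apply/esym/(cvg_unique _ DNy) => //.
rewrite (_ : D = cst (D x)); first exact: cvg_cst.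
by apply/funext => y; exact: is_derive_0_is_cst.
Qed.

Lemma normal_prob_Nyc m x : normal_prob m 1 `]-oo, x] = (Phi (x - m))%:E.
Proof. by rewrite normal_prob_sigma_Nyc// divr1. Qed.

Lemma measurable_normal_pdfE m (D : set R) :
  measurable_fun D (fun x : R => (normal_pdf m 1 x)%:E : \bar R).
Proof.
by apply/measurable_EFinP; apply: measurable_funTS; exact: measurable_normal_pdf.
Qed.

Lemma normal_prob_Nyo m x : normal_prob m 1 `]-oo, x[ = (Phi (x - m))%:E.
Proof.
rewrite -normal_prob_Nyc /normal_prob integral_itv_bndo_bndc//.
exact: measurable_normal_pdfE.
Qed.

Lemma setU_itvNy a b : a <= b -> `]-oo, b[%classic = `]-oo, a[ `|` `[a, b[ :> set R.
Proof.
move=> ab; apply/seteqP; split => [x /=|x [|]/=]; rewrite !in_itv/=.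
- by move=> xb; have [xa|xa] := ltP x a; [left|right; rewrite ?xa].
- by move=> xa; exact: lt_le_trans ab.
- by case/andP.
Qed.

Lemma disjoint_itvNy a b : [disjoint `]-oo, a[ & (`[a, b[ : set R)].
Proof.
apply/disj_setPS => x [/=]; rewrite !in_itv/= => xa /andP[ax _].
by move: (lt_le_trans xa ax); rewrite ltxx.
Qed.

Lemma normal_prob_co m a b : a <= b ->
  normal_prob m 1 `[a, b[ = (Phi (b - m) - Phi (a - m))%:E.
Proof.
move=> ab; have := normal_prob_Nyo m b; rewrite (setU_itvNy ab) measureU//.
- rewrite [X in (X + _)%E](_ : _ = (Phi (a - m))%:E); last exact: normal_prob_Nyo.
  by move=> e; rewrite EFinB -e addeAC subee// add0e.
- by apply/eqP; have := disjoint_itvNy a b; rewrite /disj_set.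
Qed.

Variables (xs : nat -> R) (m : R).
Hypothesis xs_nd : {homo xs : i j / (i <= j)%N >-> i <= j}.
Variables (h : R -> R) (b : nat -> R).
Hypotheses (mh : measurable_fun setT h) (h0 : forall x, 0 <= h x).
Hypothesis b0 : forall i, 0 <= b i.
Local Notation J D := (\int[leb]_(x in D) (normal_pdf m 1 x * h x)%:E)%E.

Let mph (D : set R) :
  measurable_fun D (fun x : R => (normal_pdf m 1 x * h x)%:E : \bar R).
Proof.
apply/measurable_EFinP; apply: measurable_funTS; apply: measurable_funM => //.
exact: measurable_normal_pdf.
Qed.

Let ph0 x : (0 <= (normal_pdf m 1 x * h x)%:E)%E.
Proof. by rewrite lee_fin mulr_ge0 ?normal_pdf_ge0. Qed.

Let cell_cst i c : 0 <= c ->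
  (\int[leb]_(x in `[(m + xs i)%R, (m + xs i.+1)%R[) (normal_pdf m 1 x * c)%:E =
  (c * (Phi (xs i.+1) - Phi (xs i)))%:E)%E.
Proof.
move=> c0; under eq_integral do rewrite mulrC EFinM.
rewrite ge0_integralZl_EFin//; last 2 first.
  by move=> x _; rewrite lee_fin normal_pdf_ge0.
  exact: measurable_normal_pdfE.
rewrite -/(normal_prob m 1 _) normal_prob_co ?lerD2l ?xs_nd//.
by rewrite ![m + _]addrC !addrK.
Qed.

Let Jrec i : (J `]-oo, (m + xs i.+1)%R[ =
  J `]-oo, (m + xs i)%R[ + J `[(m + xs i)%R, (m + xs i.+1)%R[)%E.
Proof.
rewrite -ge0_integral_setU//; last 2 first.
  exact: mph.
  exact: disjoint_itvNy.
by rewrite -setU_itvNy// lerD2l xs_nd.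
Qed.

Lemma normal_integral_cell_le n : (forall i x, (i < n)%N ->
    m + xs i <= x < m + xs i.+1 -> h x <= b i) ->
  (J `]-oo, (m + xs n)%R[ <= J `]-oo, (m + xs 0)%R[ +
     (\sum_(i < n) b i * (Phi (xs i.+1) - Phi (xs i)))%:E)%E.
Proof.
elim: n => [|n IH] hb; first by rewrite big_ord0 adde0.
rewrite big_ord_recr/= EFinD addeA Jrec; apply: leeD.
  by apply: IH => i x i_n; apply: hb; rewrite ltnS ltnW.
rewrite -cell_cst//; apply: ge0_le_integral => //.
- exact: mph.
- apply/measurable_EFinP; apply: measurable_funM => //.
  by apply: measurable_funTS; exact: measurable_normal_pdf.
- move=> x /=; rewrite in_itv/= => xI; rewrite lee_fin ler_wpM2l ?normal_pdf_ge0//.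
  exact: hb.
Qed.

Lemma normal_integral_cell_ge n : (forall i x, (i < n)%N ->
    m + xs i <= x < m + xs i.+1 -> b i <= h x) ->
  ((\sum_(i < n) b i * (Phi (xs i.+1) - Phi (xs i)))%:E <= J `]-oo, (m + xs n)%R[)%E.
Proof.
elim: n => [|n IH] hb; first by rewrite big_ord0 integral_ge0.
rewrite big_ord_recr/= EFinD Jrec; apply: leeD.
  by apply: IH => i x i_n; apply: hb; rewrite ltnS ltnW.
rewrite -cell_cst//; apply: ge0_le_integral => //.
- by move=> x _; rewrite lee_fin mulr_ge0 ?normal_pdf_ge0.
- apply/measurable_EFinP; apply: measurable_funM => //.
  by apply: measurable_funTS; exact: measurable_normal_pdf.
- exact: mph.
- move=> x /=; rewrite in_itv/= => xI; rewrite lee_fin ler_wpM2l ?normal_pdf_ge0//.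
  exact: hb.
Qed.

End normal_intervals.

(** * Functional isoperimetric inequality in dimension one *)


Section normal_isoperimetry.
Context {R : realType}.
Implicit Types (x y z s t w : R).
Local Notation leb := (@lebesgue_measure R).

Lemma Phi_lip z t : 0 < t -> Phi z <= Phi (z - t) + t * phi 0.
Proof.
move=> t0; have [|w [_ _ e]] := @mean_value _ Phi phi (z - t) z is_derive_Phi.
  by rewrite ltrBlDr ltrDl.
rewrite -lerBlDl e opprB addrC subrK mulrC ler_pM2l//; exact: phi_lip.
Qed.

(** The triangle inequality in the plane for a displacement [(d, d)], whose length is less than
    [2 * d]. *)
Lemma sqr_sum_le (D s d e : R) : 0 <= D -> 0 <= s -> 0 < d -> 0 <= e ->
  D ^+ 2 + s ^+ 2 <= e ^+ 2 -> (D + d) ^+ 2 + (s + d) ^+ 2 < (e + 2 * d) ^+ 2.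
Proof.
move=> D0 s0 d0 e0 Dse.
have De : D <= e by rewrite -(@ler_pXn2r _ 2) ?nnegrE// (le_trans _ Dse)// lerDl sqr_ge0.
have se : s <= e by rewrite -(@ler_pXn2r _ 2) ?nnegrE// (le_trans _ Dse)// lerDr sqr_ge0.
have : 0 <= d * (e - D) by rewrite mulr_ge0 ?subr_ge0// ltW.
have : 0 <= d * (e - s) by rewrite mulr_ge0 ?subr_ge0// ltW.
have : 0 < d * d by rewrite mulr_gt0.
by clear -Dse; nra.
Qed.

(** [G] is sampled by suprema and [K] by infima over cells: each step function then bounds its
    integral on the side needed, and the hypothesis linking [G] and [K] survives up to the cell
    length. *)
Definition cell_sup (m : R) (h : R -> R) d y : R :=
  sup [set h (m + w) | w in `[y, y + d[].

Definition cell_inf (m : R) (h : R -> R) d y : R :=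
  inf [set h (m + w) | w in `[y, y + d[].

Lemma cell_has_sup (m : R) (h : R -> R) (d y : R) : (forall x, 0 <= h x <= 1) -> 0 < d ->
  has_sup [set h (m + w) | w in `[y, y + d[].
Proof.
move=> h01 d0; split; last by exists 1 => _ [w _ <-]; have /andP[] := h01 (m + w).
by exists (h (m + y)), y => //=; rewrite in_itv/= lexx ltrDl.
Qed.

Lemma cell_has_inf (m : R) (h : R -> R) (d y : R) : (forall x, 0 <= h x <= 1) -> 0 < d ->
  has_inf [set h (m + w) | w in `[y, y + d[].
Proof.
move=> h01 d0; split; last by exists 0 => _ [w _ <-]; have /andP[] := h01 (m + w).
by exists (h (m + y)), y => //=; rewrite in_itv/= lexx ltrDl.
Qed.

Lemma measurable_normal_pdfM (m : R) (h : R -> R) (D : set R) : measurable_fun setT h ->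
  measurable_fun D (fun x : R => (normal_pdf m 1 x * h x)%:E : \bar R).
Proof.
move=> mh; apply/measurable_EFinP; apply: measurable_funTS.
by apply: measurable_funM => //; exact: measurable_normal_pdf.
Qed.

(** By contradiction, a deficit [kap] is distributed over the errors: shifting [z] and the radius by
    [t] each costs at most [kap / 4], the floor of the step function for [K] costs at most
    [kap / 2], and [kap / 4] remains. *)
Lemma normal_isoperimetry_supp (m eps : R) (G K : R -> R) (N z : R) :
  0 < eps -> measurable_fun setT G -> measurable_fun setT K ->
  (forall x, 0 <= G x <= 1) -> (forall x, 0 <= K x <= 1) ->
  (forall x y z s, 0 < s -> (x - y) ^+ 2 + s ^+ 2 < eps ^+ 2 ->
    Phi z <= G x -> Phi (z + s) <= K y) ->
  0 < N ->
  (forall x, 0 < G x -> m - N <= x < m + N) ->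
  ((Phi z)%:E <= \int[leb]_x (normal_pdf m 1 x * G x)%:E)%E ->
  ((Phi (z + eps))%:E <= \int[leb]_x (normal_pdf m 1 x * K x)%:E)%E.
Proof.
move=> eps0 mG mK G01 K01 GK N0 GN zG.
pose G0 := cell_sup m G; pose K0 := cell_inf m K.
have G0_has d y := @cell_has_sup m G d y G01.
have K0_has d y := @cell_has_inf m K d y K01.
rewrite leNgt; apply/negP => Kz.
set IK := (X in (X < _)%E) in Kz.
have IK0 : (0 <= IK)%E.
  apply: integral_ge0 => x _; rewrite lee_fin mulr_ge0 ?normal_pdf_ge0//.
  by have /andP[] := K01 x.
have IKfin : IK \is a fin_num by rewrite ge0_fin_numE// (lt_trans Kz)// ltry.
pose kk := fine IK; have kkE : IK = kk%:E by rewrite fineK.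
pose kap := Phi (z + eps) - kk.
have kap0 : 0 < kap by rewrite subr_gt0 -lte_fin -kkE.
have ph0 : 0 < phi 0 :> R := phi_gt0 0.
pose t := Num.min (eps / 2) (kap / (8 * phi 0)).
have t0 : 0 < t by rewrite lt_min !divr_gt0// mulr_gt0.
have teps : t <= eps / 2 by rewrite ge_min lexx.
have tkap : 2 * t * phi 0 <= kap / 4.
  have : t <= kap / (8 * phi 0) by rewrite ge_min lexx orbT.
  rewrite ler_pdivlMr ?mulr_gt0//; clear; lra.
have big : kk + 3 / 4 * kap <= Phi ((z - t) + (eps - t)).
  have a1 := Phi_lip (z + eps) t0; have a2 := Phi_lip (z + eps - t) t0.
  rewrite (_ : z - t + (eps - t) = z + eps - t - t); last by ring.
  by move: a1 a2 tkap; rewrite /kap; clear; lra.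
(* The room available on the side of [G], where only [z - t] has to be reached. *)
pose rho := Phi z - Phi (z - t).
have rho0 : 0 < rho by rewrite subr_gt0 Phi_lt ltrBlDr ltrDl.
have [T1 HT1] : exists M, forall x, x <= M -> Phi x < kap / 2 by apply: Phi_small; rewrite divr_gt0.
have [T2 HT2] : exists M, forall x, x <= M -> Phi x < rho / 4 by apply: Phi_small; rewrite divr_gt0.
pose M := `|eps - T1| + `|T2|.
have M1 : Phi (- M + eps) < kap / 2.
  apply: HT1; have := ler_norm (eps - T1); have := normr_ge0 T2; rewrite /M; clear; lra.
have M2 : Phi (- M) < rho / 4.
  apply: HT2; have := ler_norm (- T2); rewrite normrN.
  have := normr_ge0 (eps - T1); rewrite /M; clear; lra.
have M0 : 0 <= M by rewrite addr_ge0.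
(* Midway between [eps - t] and [eps]: the upper half absorbs the [2 * d] lost by sampling on cells,
   the lower half the [4 * d] of the step inequality. *)
pose e' := eps - t / 2.
pose L := N + eps + 2.
have L0 : 0 < L by rewrite /L; move: N0 eps0; clear; lra.
have [k] : exists k : nat, 0 + k.+1%:R^-1 < Num.min (t / 16) 1 / (2 * L).
  by apply: ltr_add_invr; rewrite divr_gt0 ?mulr_gt0// lt_min ltr01 divr_gt0.
rewrite add0r => kL; pose n := k.+1; pose d := 2 * L / n%:R.
have n0 : (0 : R) < n%:R by rewrite ltr0n.
have d0 : 0 < d by rewrite divr_gt0// mulr_gt0.
have [d1 d2] : d < t / 16 /\ d < 1.
  apply/andP; rewrite -lt_min /d mulrC.
  by move: kL; rewrite ltr_pdivlMr// mulr_gt0.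
pose xs (i : nat) := - L + i%:R * d.
have xs_nd : {homo xs : i j / (i <= j)%N >-> i <= j}.
  by move=> i j ij; rewrite lerD2l ler_wpM2r ?ler_nat// ltW.
have xs0 : xs 0%N = - L by rewrite /xs mul0r addr0.
have xsn : xs n = L by rewrite /xs /d; field; rewrite gt_eqF.
have xsS i : xs i.+1 = xs i + d by rewrite /xs -natr1; ring.
(* A supremum need not be attained: lowering it by [rho / 4] guarantees a point of the cell where
   [G] is larger, and keeps [g] below [Phi M]. A cell meeting the support of [G] may have its left
   end as low as [- N - d]. *)
pose g y := if (- N - d <= y <= N) then Num.max (Phi (- M)) (G0 d y - rho / 4)
            else Phi (- M).
pose kf y := Num.max (Phi (- M + e')) (K0 d y).
have G0le1 y : G0 d y <= 1.
  apply: ge_sup; first by have [] := G0_has d y d0.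
  by move=> _ [w _ <-]; have /andP[] := G01 (m + w).
have K0ge0 y : 0 <= K0 d y.
  apply: lb_le_inf; first by have [] := K0_has d y d0.
  by move=> _ [w _ <-]; have /andP[] := K01 (m + w).
have K0le1 y : K0 d y <= 1.
  have /andP[_ ] := K01 (m + y); apply: le_trans.
  apply: ge_inf; first by have [] := K0_has d y d0.
  by exists y => //=; rewrite in_itv/= lexx ltrDl.
have gM y : Phi (- M) <= g y <= Phi M.
  have MM : Phi (- M) <= Phi M by rewrite Phi_le; move: M0; clear; lra.
  rewrite /g; case: ifPn => _; last by rewrite lexx.
  rewrite le_max lexx/= ge_max MM/=.
  by have := G0le1 y; move: M2; rewrite PhiN; clear; lra.
have kM y : Phi (- M + e') <= kf y <= 1.
  by rewrite /kf le_max lexx/= ge_max Phi_le1 K0le1.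
have e'0 : 0 < e' by rewrite /e'; move: teps eps0; clear; lra.
have gsupp x : Phi (- M) < g x -> xs 0 + e' <= x <= xs n - e'.
  rewrite /g xs0 xsn; case: ifPn => [/andP[a b _]|]; last by rewrite ltxx.
  by move: a b d2 t0; rewrite /L /e'; clear; lra.
have gk x y z' s : 0 <= s -> Phi z' <= g x -> (x - y) ^+ 2 + s ^+ 2 <= e' ^+ 2 ->
    Phi (z' + s) <= kf y.
  move=> s0 zg xys; have [zM|zM] := leP z' (- M).
    have se : s <= e'.
      rewrite -(@ler_pXn2r _ 2) ?nnegrE// ?(ltW e'0)// (le_trans _ xys)// lerDr.
      exact: sqr_ge0.
    rewrite /kf le_max; apply/orP; left; rewrite Phi_le.
    by move: zM se; clear; lra.
  have [w /= wI zGw] : exists2 w, w \in `[x, x + d[ & Phi z' < G (m + w).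
    move: zg; rewrite /g; case: ifPn => [_|_]; last by rewrite Phi_le leNgt zM.
    rewrite le_max Phi_le [z' <= _]leNgt zM/= => zG0.
    have [|_ [w wI <-] zw] := @sup_adherent _ _ (rho / 4) _ (G0_has d x d0).
      by rewrite divr_gt0.
    by exists w => //; exact: le_lt_trans zw.
  rewrite /kf le_max; apply/orP; right.
  apply: lb_le_inf; first by have [] := K0_has d y d0.
  (* [GK] wants a positive vertical part, whereas [s] may be 0; hence [s + d]. *)
  move=> _ [w' /= w'I <-]; apply: (@le_trans _ _ (Phi (z' + (s + d)))).
    by rewrite Phi_le; move: d0; clear; lra.
  apply: (GK (m + w) (m + w') z' (s + d)); [|idtac|exact: ltW].
    by rewrite ltr_wpDl.
  move: wI w'I; rewrite !in_itv/= => /andP[w1 w2] /andP[w1' w2'].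
  have ww : `|m + w - (m + w')| <= `|x - y| + d.
    have := ler_norm (x - y); have := ler_norm (- (x - y)); rewrite normrN.
    by rewrite ler_norml; move: w1 w2 w1' w2'; clear; lra.
  have Dse : `|x - y| ^+ 2 + s ^+ 2 <= e' ^+ 2 by rewrite real_normK ?num_real.
  have := sqr_sum_le (normr_ge0 _) s0 d0 (ltW e'0) Dse.
  have le1 : (m + w - (m + w')) ^+ 2 <= (`|x - y| + d) ^+ 2.
    by rewrite -real_normK ?num_real// lerXn2r ?nnegrE// addr_ge0// ltW.
  have le2 : (e' + 2 * d) ^+ 2 <= eps ^+ 2.
    rewrite lerXn2r ?nnegrE//; move: d1 d0 e'0 eps0; rewrite /e'; clear; lra.
  by move: le1 le2; clear; lra.
have mesh i : (i < n)%N -> xs i.+1 <= xs i + d by rewrite xsS.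
have r0 : 0 <= eps - t by move: teps eps0; clear; lra.
have re : (eps - t) + 4 * d < e' by move: d1 t0; rewrite /e'; clear; lra.
have := @step_isoperimetry _ xs n xs_nd M e' d (eps - t) g kf d0 r0 re mesh gM kM gsupp gk.
set P := step_mass xs n (Phi (- M)) g; set Q := step_mass _ _ _ kf.
have P01 : 0 < P < 1.
  rewrite /P -(mollify_end _ _ _ _ 1).
  rewrite (lt_le_trans (Phi_gt0 (- M)))/=.
    apply: le_lt_trans (Phi_lt1 M); apply: mollify_le => //.
      by have /andP[] := gM 0; exact: le_trans.
    by move=> y; have /andP[] := gM y.
  by apply: mollify_ge => // y; have /andP[] := gM y.
have w0 i : 0 <= Phi (xs i.+1) - Phi (xs i) by rewrite subr_ge0 Phi_le xs_nd.
pose W := \sum_(i < n) (Phi (xs i.+1) - Phi (xs i)).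
have W1 : W <= 1.
  rewrite /W -(big_mkord xpredT (fun i => Phi (xs i.+1) - Phi (xs i))).
  rewrite (telescope_sumr (fun i => Phi (xs i)))//.
  by have := Phi_le1 (xs n); have := Phi_ge0 (xs 0); clear; lra.
have massE c h : step_mass xs n c h = c * (1 - W) +
    \sum_(i < n) h (xs i) * (Phi (xs i.+1) - Phi (xs i)).
  rewrite /step_mass; under eq_bigr do rewrite mulrBl.
  by rewrite sumrB -mulr_sumr -/W; ring.
have PG : Phi (z - t) <= P.
  have : ((Phi z)%:E <= (\sum_(i < n) (g (xs i) + rho / 2) *
      (Phi (xs i.+1) - Phi (xs i)))%:E)%E.
    apply: (le_trans zG).
    have H i x : (i < n)%N -> m + xs i <= x < m + xs i.+1 -> G x <= g (xs i) + rho / 2.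
      move=> i_n /andP[xi ix]; have [Gx|Gx] := leP (G x) 0.
        rewrite (le_trans Gx)// addr_ge0 ?divr_ge0 ?(ltW rho0)//.
        by have /andP[+ _] := gM (xs i); apply: le_trans; exact: Phi_ge0.
      have /andP[xN Nx] := GN x Gx.
      have GG : G x <= G0 d (xs i).
        apply: sup_upper_bound; first exact: G0_has.
        exists (x - m); last by rewrite subrKC.
        by rewrite /= in_itv/= -xsS; move: xi ix; clear; lra.
      have -> : g (xs i) = Num.max (Phi (- M)) (G0 d (xs i) - rho / 4).
        by rewrite /g ifT//; move: xi ix xN Nx; rewrite xsS; clear; lra.
      have : G0 d (xs i) - rho / 4 <= Num.max (Phi (- M)) (G0 d (xs i) - rho / 4).
        by rewrite le_max lexx orbT.
      by move: GG rho0; clear; lra.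
    have Gge0 x : 0 <= G x by have /andP[] := G01 x.
    have b0 i : 0 <= g (xs i) + rho / 2.
      rewrite addr_ge0 ?divr_ge0 ?(ltW rho0)//.
      by have /andP[+ _] := gM (xs i); apply: le_trans; exact: Phi_ge0.
    have := normal_integral_cell_le xs_nd mG Gge0 b0 H.
    have G0out x : ~ (m - N <= x < m + N) -> G x = 0.
      move=> xN; apply/le_anti; rewrite Gge0 andbT leNgt; apply/negP => /GN.
      by move/xN.
    have -> : (\int[leb]_(x in `]-oo, (m + xs 0)%R[) (normal_pdf m 1 x * G x)%:E = 0)%E.
      apply: integral0_eq => x /=; rewrite in_itv/= xs0 => xL.
      rewrite G0out ?mulr0// => /andP[+ _].
      by move: xL eps0; rewrite /L; clear; lra.
    rewrite add0e; apply: le_trans.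
    rewrite le_eqVlt; apply/orP; left; apply/eqP.
    rewrite [RHS]integral_mkcond; apply: eq_integral => x _.
    rewrite patchE; case: ifPn => //; rewrite notin_setE/= in_itv/= xsn => /negP xL.
    rewrite G0out ?mulr0// => /andP[_ +].
    by move: xL eps0; rewrite -leNgt /L; clear; lra.
  rewrite lee_fin; under eq_bigr do rewrite mulrDl.
  rewrite big_split/= -mulr_sumr -/W /P massE.
  have : 0 <= Phi (- M) * (1 - W) by rewrite mulr_ge0 ?Phi_ge0// subr_ge0.
  have : rho / 2 * W <= rho / 2 by rewrite ler_piMr// divr_ge0// ltW.
  by rewrite /rho; move: rho0; rewrite /rho; clear; lra.
have QK : Q <= kk + kap / 2.
  have H i x : (i < n)%N -> m + xs i <= x < m + xs i.+1 -> K0 d (xs i) <= K x.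
    move=> i_n /andP[xi ix]; apply: ge_inf; first by have [] := K0_has d (xs i) d0.
    exists (x - m); last by rewrite subrKC.
    by rewrite /= in_itv/= -xsS; move: xi ix; clear; lra.
  have Kge0 x : 0 <= K x by have /andP[] := K01 x.
  have S : \sum_(i < n) K0 d (xs i) * (Phi (xs i.+1) - Phi (xs i)) <= kk.
    rewrite -lee_fin -kkE.
    apply: (le_trans (normal_integral_cell_ge (b := fun i => K0 d (xs i))
      xs_nd mK Kge0 (fun i => K0ge0 _) H)).
    apply: ge0_subset_integral => //; first exact: measurable_normal_pdfM.
    by move=> x _; rewrite lee_fin mulr_ge0 ?normal_pdf_ge0.
  have k0k : Phi (- M + e') <= kap / 2.
    apply: (le_trans _ (ltW M1)); rewrite Phi_le /e'.
    by move: t0; clear; lra.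
  apply: (@le_trans _ _ (kk + Phi (- M + e'))); last by rewrite lerD2l.
  rewrite /Q massE.
  have : \sum_(i < n) kf (xs i) * (Phi (xs i.+1) - Phi (xs i)) <=
      \sum_(i < n) K0 d (xs i) * (Phi (xs i.+1) - Phi (xs i)) + Phi (- M + e') * W.
    rewrite /W mulr_sumr -big_split/=; apply: ler_sum => i _.
    rewrite -mulrDl ler_wpM2r// /kf ge_max lerDr K0ge0/= lerDl Phi_ge0//.
  by move: S; clear; lra.
have zP : z - t <= quantile P by rewrite -Phi_le quantileK.
have : Phi (z - t + (eps - t)) <= Phi (quantile P + (eps - t)).
  by rewrite Phi_le lerD2r.
by move: big QK kap0; clear; lra.
Qed.

End normal_isoperimetry.


Section gaussian_isoperimetry.
Context {R : realType}.
Local Notation leb := (@lebesgue_measure R).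

(** Restricting [G] to a bounded interval loses at most [Phi z - Phi (z - t)], which is compensated
    by lowering [z] to [z - t]; the resulting loss [t * phi 0] is the arbitrary [kap]. Where the
    restricted [G] vanishes the hypothesis is void, since [Phi] is positive. *)
Lemma normal_isoperimetry (m eps : R) (G K : R -> R) (z : R) :
  0 < eps -> measurable_fun setT G -> measurable_fun setT K ->
  (forall x, 0 <= G x <= 1) -> (forall x, 0 <= K x <= 1) ->
  (forall x y z s, 0 < s -> (x - y) ^+ 2 + s ^+ 2 < eps ^+ 2 ->
    Phi z <= G x -> Phi (z + s) <= K y) ->
  ((Phi z)%:E <= \int[leb]_x (normal_pdf m 1 x * G x)%:E)%E ->
  ((Phi (z + eps))%:E <= \int[leb]_x (normal_pdf m 1 x * K x)%:E)%E.
Proof.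
move=> eps0 mG mK G01 K01 GK zG; apply/lee_addgt0Pr => kap kap0.
have ph0 : 0 < phi 0 :> R := phi_gt0 0.
pose t := kap / phi 0; have t0 : 0 < t by rewrite divr_gt0.
apply: (@le_trans _ _ ((Phi (z - t + eps))%:E + kap%:E)%E).
  rewrite -EFinD lee_fin (le_trans (Phi_lip (z + eps) t0))//.
  by rewrite divfK ?gt_eqF// lerD2r Phi_le; lra.
apply: leeD2r.
pose rho := Phi z - Phi (z - t).
have rho0 : 0 < rho by rewrite subr_gt0 Phi_lt ltrBlDr ltrDl.
have [T HT] : exists M, forall x, x <= M -> Phi x < rho / 2 by apply: Phi_small; rewrite divr_gt0.
pose N := `|T| + 1.
have NT : Phi (- N) < rho / 2.
  by apply: HT; have := ler_norm (- T); rewrite normrN /N; lra.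
have N0 : 0 < N by rewrite ltr_wpDl.
pose I : set R := `[m - N, m + N[%classic.
have mI : measurable I by exact: measurable_itv.
pose G1 x := G x * \1_I x.
have G1E x : G1 x = if x \in I then G x else 0.
  by rewrite /G1 indicE; case: (x \in I); rewrite ?mulr1 ?mulr0.
have G0 x : 0 <= G x by have /andP[] := G01 x.
apply: (@normal_isoperimetry_supp _ m eps G1 K N) => //.
- by apply: measurable_funM => //; exact: measurable_indic.
- by move=> x; rewrite G1E; case: ifP => // _; rewrite lexx ler01.
- move=> x y w s s0 xys; rewrite G1E; case: ifP => _; first exact: GK.
  by rewrite leNgt Phi_gt0.
- move=> x; rewrite G1E; case: ifPn => [|_]; last by rewrite ltxx.
  by rewrite inE /I/= in_itv.
have : (\int[leb]_x (normal_pdf m 1 x * G x)%:E <=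
    \int[leb]_x (normal_pdf m 1 x * G1 x)%:E + rho%:E)%E.
  rewrite -(setUv I) ge0_integral_setU//=; last 4 first.
  - exact: measurableC.
  - by rewrite setUv; exact: measurable_normal_pdfM.
  - by move=> x _; rewrite lee_fin mulr_ge0 ?normal_pdf_ge0.
  - by rewrite disj_set2E setICr.
  apply: leeD.
    rewrite integral_mkcond le_eqVlt; apply/orP; left; apply/eqP.
    rewrite setUv; apply: eq_integral => x _; rewrite patchE G1E.
    by case: ifP => //; rewrite mulr0.
  apply: (@le_trans _ _ (normal_prob m 1 (~` I))).
    apply: ge0_le_integral => //.
    - exact: measurableC.
    - by move=> x _; rewrite lee_fin mulr_ge0 ?normal_pdf_ge0.
    - exact: measurable_normal_pdfM.
    - exact: measurable_normal_pdfE.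
    - move=> x _; rewrite lee_fin ler_piMr ?normal_pdf_ge0//.
      by have /andP[] := G01 x.
  rewrite probability_setC//.
  rewrite [X in (_ - X)%E](_ : _ = (Phi N - Phi (- N))%:E); last first.
    rewrite /I; apply: (etrans (normal_prob_co m _)); first lra.
    by congr (_ - _)%:E; congr Phi; ring.
  by rewrite -EFinB lee_fin -[N]opprK PhiN opprK; lra.
move=> /(le_trans zG); rewrite -leeBlDr// -EFinB /rho; congr (_ <= _)%E.
by congr EFin; ring.
Qed.

End gaussian_isoperimetry.

(** * Gaussian isoperimetric inequality *)


Section gaussian_measure.
Context {R : realType}.
Local Notation leb := (@lebesgue_measure R).

(** Taking the mixture of a Gaussian with itself provides the probability structure at once. *)
Definition gauss n (a : 'rV[R]_n) : probability 'rV[R]_n R := gaussian_mixture a a.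

Lemma gaussE n (a : 'rV[R]_n) A :
  gauss a A = (\int[lebesgue_rV R n]_(x in A) (gaussian_pdf (x - a))%:E)%E.
Proof.
apply: eq_integral => x _; congr EFin.
by rewrite /gaussian_mixture_pdf; field.
Qed.

Lemma gaussian_mixtureE n (a b : 'rV[R]_n) A : measurable A ->
  gaussian_mixture a b A = ((2^-1)%:E * gauss a A + (2^-1)%:E * gauss b A)%E.
Proof.
move=> mA; have half_ge0 : (0 <= (2^-1 : R)%:E)%E by rewrite lee_fin.
have mg c : measurable_fun A (fun x : 'rV[R]_n => (gaussian_pdf (x - c))%:E).
  by apply/measurable_EFinP; apply: measurable_funTS; exact: measurable_gaussian_pdf.
have g0 c (x : 'rV[R]_n) : (0 <= (gaussian_pdf (x - c))%:E)%E.
  by rewrite lee_fin gaussian_pdf_ge0.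
have E c : ((2^-1)%:E * gauss c A =
    \int[lebesgue_rV R n]_(x in A) ((2^-1)%:E * (gaussian_pdf (x - c))%:E))%E.
  by rewrite gaussE ge0_integralZl.
transitivity (\int[lebesgue_rV R n]_(x in A) ((2^-1)%:E * (gaussian_pdf (x - a))%:E) +
    \int[lebesgue_rV R n]_(x in A) ((2^-1)%:E * (gaussian_pdf (x - b))%:E))%E; last first.
  by congr (_ + _)%E; exact/esym/E.
rewrite -ge0_integralD//.
- by move=> x _; rewrite mule_ge0.
- exact: measurable_funeM.
- by move=> x _; rewrite mule_ge0.
- exact: measurable_funeM.
Qed.

Definition rV_slice n (A : set 'rV[R]_n.+1) (x : R) : set 'rV[R]_n :=
  [set v | A (rV_cons (x, v))].

Lemma measurable_rV_cons_preimage n (A : set 'rV[R]_n.+1) : measurable A ->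
  measurable (@rV_cons R n @^-1` A).
Proof.
by move=> mA; rewrite -[X in measurable X]setTI; exact: measurable_rV_cons.
Qed.

Lemma measurable_rV_slice n (A : set 'rV[R]_n.+1) x : measurable A ->
  measurable (rV_slice A x).
Proof.
move=> /measurable_rV_cons_preimage mA.
rewrite (_ : rV_slice A x = xsection (@rV_cons R n @^-1` A) x); first exact: measurable_xsection.
by apply/seteqP; split => v; rewrite /xsection/= inE.
Qed.

Definition rV_tail n (a : 'rV[R]_n.+1) : 'rV[R]_n := \row_i a 0 (lift 0 i).

Lemma gaussian_pdf_cons n (a : 'rV[R]_n.+1) x v :
  gaussian_pdf (rV_cons (x, v) - a) =
  normal_pdf (a 0 0) 1 x * gaussian_pdf (v - rV_tail a).
Proof.
rewrite !gaussian_pdf_prod big_ord_recl rV_cons0; congr (_ * _).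
by apply: eq_bigr => i _; rewrite rV_consS mxE.
Qed.

Let sliceF n (a : 'rV[R]_n) (B : set (R * 'rV[R]_n)) (p : R * 'rV[R]_n) : \bar R :=
  ((gaussian_pdf (p.2 - a))%:E * (\1_B p)%:E)%E.

Let m_sliceF n (a : 'rV[R]_n) B : measurable B -> measurable_fun setT (sliceF a B).
Proof.
move=> mB; apply: emeasurable_funM; apply/measurable_EFinP.
  apply: (measurableT_comp (measurable_gaussian_pdf a)); exact: measurable_snd.
exact: measurable_indic.
Qed.

Let sliceFE n (a : 'rV[R]_n.+1) A x :
  (\int[lebesgue_rV R n]_v sliceF (rV_tail a) (@rV_cons R n @^-1` A) (x, v) =
   gauss (rV_tail a) (rV_slice A x))%E.
Proof.
rewrite gaussE [RHS]integral_mkcond; apply: eq_integral => v _.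
rewrite /sliceF patchE indicE/= [in RHS](_ : (v \in rV_slice A x) = ((x, v) \in @rV_cons R n @^-1` A)).
  by case: ifPn => _; rewrite ?mule1 ?mule0.
by apply/idP/idP; rewrite !inE.
Qed.

Lemma measurable_gauss_slice n (a : 'rV[R]_n.+1) A : measurable A ->
  measurable_fun setT (fun x : R => fine (gauss (rV_tail a) (rV_slice A x))).
Proof.
move=> /measurable_rV_cons_preimage mA.
have := measurable_fun_fubini_tonelli_F (m2 := lebesgue_rV R n) _ (m_sliceF (rV_tail a) mA).
have F0 p : (0 <= sliceF (rV_tail a) (@rV_cons R n @^-1` A) p)%E.
  by rewrite mule_ge0// lee_fin ?gaussian_pdf_ge0.
move=> /(_ F0); rewrite (_ : fubini_F _ _ =
    (fun x : R => gauss (rV_tail a) (rV_slice A x))); last first.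
  by apply/funext => x; exact: sliceFE.
by move=> m; apply: measurableT_comp m; exact: fine_measurable.
Qed.

Lemma gauss_slice n (a : 'rV[R]_n.+1) A : measurable A ->
  (gauss a A = \int[leb]_x
    (normal_pdf (a 0 0) 1 x * fine (gauss (rV_tail a) (rV_slice A x)))%:E)%E.
Proof.
move=> mA; have mA' := measurable_rV_cons_preimage mA.
have mg : measurable_fun A (fun x : 'rV[R]_n.+1 => (gaussian_pdf (x - a))%:E).
  by apply/measurable_EFinP; apply: measurable_funTS; exact: measurable_gaussian_pdf.
rewrite gaussE/= ge0_integral_pushforward//=; last 2 first.
  exact: measurable_rV_cons.
  by move=> x _; rewrite lee_fin gaussian_pdf_ge0.
rewrite integral_mkcond.
pose f (p : R * 'rV[R]_n) : \bar R := ((normal_pdf (a 0 0) 1 p.1)%:E *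
  sliceF (rV_tail a) (@rV_cons R n @^-1` A) p)%E.
transitivity (\int[leb \x lebesgue_rV R n]_p f p)%E.
  apply: eq_integral => -[x v] _; rewrite /f /sliceF patchE indicE/=.
  by case: ifPn => _; rewrite ?mule1 ?mule0// gaussian_pdf_cons EFinM.
have F0 p : (0 <= sliceF (rV_tail a) (@rV_cons R n @^-1` A) p)%E.
  by rewrite mule_ge0// lee_fin ?gaussian_pdf_ge0.
have mF := m_sliceF (rV_tail a) mA'.
rewrite fubini_tonelli1//=; last 2 first.
- apply: emeasurable_funM => //; apply/measurable_EFinP.
  by apply: (measurableT_comp (measurable_normal_pdf _ _)); exact: measurable_fst.
- by move=> p; rewrite mule_ge0// lee_fin normal_pdf_ge0.
apply: eq_integral => x _; rewrite /fubini_F /f /=.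
rewrite ge0_integralZl//; last 2 first.
- by apply: measurableT_comp mF _; exact: measurable_pair1.
- by rewrite lee_fin normal_pdf_ge0.
by rewrite sliceFE EFinM fineK// fin_num_measure//; exact: measurable_rV_slice.
Qed.

End gaussian_measure.


Section isoperimetry.
Context {R : realType}.

Lemma enorm_sqr n (x : 'rV[R]_n) : enorm x ^+ 2 = \sum_(i < n) x 0 i ^+ 2.
Proof.
rewrite /enorm sqr_sqrtr; first by apply: eq_bigr => i _; rewrite expr2.
by apply: sumr_ge0 => i _; rewrite -expr2 sqr_ge0.
Qed.

Lemma enorm_ge0 n (x : 'rV[R]_n) : 0 <= enorm x.
Proof. exact: sqrtr_ge0. Qed.

Lemma enorm_lt n (x : 'rV[R]_n) (e : R) : 0 < e ->
  (enorm x < e) = (\sum_(i < n) x 0 i ^+ 2 < e ^+ 2).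
Proof.
by move=> e0; rewrite -enorm_sqr ltr_pXn2r// ?nnegrE ?enorm_ge0// ltW.
Qed.

Lemma continuous_enorm n : continuous (@enorm R n).
Proof.
have c : continuous (fun x : 'rV[R]_n => dotv x x).
  apply: continuous_big => [|i _ y]; first exact: add_continuous.
  by apply: continuousM; exact: coord_continuous.
by move=> x; apply: continuous_comp; [exact: c|exact: sqrt_continuous].
Qed.

Lemma open_nbhdP n (A : set 'rV[R]_n) (e : R) x :
  open_nbhd A e x <-> exists2 y, A y & enorm (x - y) < e.
Proof.
split=> [/ereal_inf_lt[_ [y Ay <-]]|[y Ay xy]].
  by rewrite lte_fin => xy; exists y.
by apply: (@le_lt_trans _ _ (enorm (x - y))%:E) => //; apply: ereal_inf_lbound; exists y.
Qed.

Lemma open_open_nbhd n (A : set 'rV[R]_n) (e : R) : open (open_nbhd A e).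
Proof.
rewrite (_ : open_nbhd A e = \bigcup_(y in A) [set x | enorm (x - y) < e]).
  apply: bigcup_open => y Ay.
  rewrite (_ : [set x | _] = (fun x => enorm (x - y)) @^-1` `]-oo, e[%classic).
    apply: open_comp; last exact: interval_open.
    move=> x _; apply: (@continuous_comp _ _ _ (fun z : 'rV[R]_n => z - y) (@enorm R n)).
      by apply: continuousB; [exact: cvg_id|exact: cst_continuous].
    exact: continuous_enorm.
  by apply/seteqP; split => x; rewrite /= in_itv.
by apply/seteqP; split => x; rewrite open_nbhdP => -[y Ay xy]; exists y.
Qed.

Lemma measurable_open_nbhd n (A : set 'rV[R]_n) (e : R) : measurable (open_nbhd A e).
Proof. by apply: open_measurable_rV; exact: open_open_nbhd. Qed.

Lemma sub_open_nbhd n (A : set 'rV[R]_n) (e : R) : 0 < e -> A `<=` open_nbhd A e.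
Proof.
move=> e0 x Ax; rewrite open_nbhdP; exists x => //.
by rewrite enorm_lt// subrr big1 ?exprn_gt0// => i _; rewrite mxE expr0n.
Qed.

Lemma gauss_le n (a : 'rV[R]_n) A B : measurable A -> measurable B ->
  A `<=` B -> (gauss a A <= gauss a B)%E.
Proof. by move=> mA mB AB; apply: le_measure => //; rewrite inE. Qed.

Lemma gauss_fine n (a : 'rV[R]_n) A : measurable A ->
  (fine (gauss a A))%:E = gauss a A.
Proof. by move=> mA; rewrite fineK// fin_num_measure. Qed.

Lemma fine_gauss01 n (a : 'rV[R]_n) A : measurable A -> 0 <= fine (gauss a A) <= 1.
Proof.
by move=> mA; rewrite -!lee_fin gauss_fine// measure_ge0 probability_le1.
Qed.

(* The slice of [A^e] at [y] contains the [s]-neighbourhood of the slice of  *)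
(* [A] at [x] as soon as [(x - y)^2 + s^2 < e^2].                            *)
Lemma gaussian_isoperimetry n (a : 'rV[R]_n) A (z e : R) :
  measurable A -> 0 < e ->
  ((Phi z)%:E <= gauss a A -> (Phi (z + e))%:E <= gauss a (open_nbhd A e))%E.
Proof.
elim: n a A z e => [|n IH] a A z e mA e0 zA.
  (* Dimension 0 has a single point, and [Phi z > 0] excludes the empty set. *)
  have [A0|/set0P[x Ax]] := eqVneq A set0.
    by move: zA; rewrite A0 measure0 lee_fin leNgt Phi_gt0.
  rewrite (_ : open_nbhd A e = setT) ?probability_setT ?lee_fin ?Phi_le1//.
  apply/seteqP; split => // y _; apply: sub_open_nbhd => //.
  by rewrite (_ : y = x)//; apply/rowP => -[].
have mAe := measurable_open_nbhd A e.
have ms (B : set 'rV[R]_n.+1) (x : R) : measurable B -> measurable (rV_slice B x).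
  exact: measurable_rV_slice.
rewrite gauss_slice//; rewrite gauss_slice// in zA; move: zA.
apply: normal_isoperimetry => //.
- exact: measurable_gauss_slice.
- exact: measurable_gauss_slice.
- by move=> x; apply: fine_gauss01; exact: ms.
- by move=> x; apply: fine_gauss01; exact: ms.
move=> x y w s s0 xys; rewrite -!lee_fin !gauss_fine; [|exact: ms..].
move=> /(IH _ _ _ _ (ms A x mA) s0) /le_trans; apply.
apply: gauss_le; [exact: measurable_open_nbhd|exact: ms|].
move=> v /open_nbhdP[v' Av' vv']; apply/open_nbhdP; exists (rV_cons (x, v')) => //.
have subE k (u u' : 'rV[R]_k) i : (u - u') 0 i = u 0 i - u' 0 i by rewrite !mxE.
rewrite enorm_lt// big_ord_recl subE !rV_cons0/=.
under eq_bigr do rewrite subE !rV_consS /=.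
move: vv'; rewrite enorm_lt// => vv'.
rewrite -(sqrrN (y - x)) opprB.
have : \sum_(i < n) (v 0 i - v' 0 i) ^+ 2 < s ^+ 2.
  by apply: le_lt_trans vv'; apply: ler_sum => i _; rewrite !mxE.
by lra.
Qed.

End isoperimetry.

(** * Half-spaces and the Neyman-Pearson lemma *)


Section linear_functionals.
Context {R : realType}.
Local Notation leb := (@lebesgue_measure R).

(** The joint density of [X], normal with mean [m] and variance 1, and of [S = al X + Z], with [Z]
    an independent standard normal: completing the square factors it as the law of [S] times the
    conditional law of [X] given [S]. *)
Lemma phi_phi (x s m al : R) : let k := Num.sqrt (1 + al ^+ 2) in
  phi (x - m) * phi (s - al * x) =
  normal_pdf (al * m) k s * normal_pdf ((m + al * s) / k ^+ 2) k^-1 x.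
Proof.
move=> k; have k2 : k ^+ 2 = 1 + al ^+ 2 by rewrite sqr_sqrtr// addr_ge0// sqr_ge0.
have k0 : 0 < k by rewrite sqrtr_gt0 ltr_pwDl// sqr_ge0.
have k0' : k != 0 by rewrite gt_eqF.
rewrite !normal_pdf_scale ?invr_gt0// !phiE invrK.
set c := (Num.sqrt _)^-1.
transitivity (c * c * expR (- ((x - m) ^+ 2 / 2) + - ((s - al * x) ^+ 2 / 2))).
  by rewrite expRD; ring.
set e1 := - (((s - _) / k) ^+ 2 / 2); set e2 := - (((x - _) * k) ^+ 2 / 2).
transitivity (c * c * expR (e1 + e2)); last by rewrite expRD; field.
congr (_ * expR _); rewrite /e1 /e2.
rewrite !exprMn exprVn k2.
have K : 1 + al ^+ 2 != 0 by rewrite -k2 expf_neq0.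
by field.
Qed.

(** Both sides are the probability of [al X + Z <= b], with [X] and [Z] as in [phi_phi]: the left
    side conditions on [X], the right side uses the law of the sum. *)
Lemma normal_Phi_integral (m al b : R) :
  (\int[leb]_x (normal_pdf m 1 x * Phi (b - al * x))%:E =
   (Phi ((b - al * m) / Num.sqrt (1 + al ^+ 2)))%:E)%E.
Proof.
set k := Num.sqrt _; have k0 : 0 < k by rewrite sqrtr_gt0 ltr_pwDl// sqr_ge0.
pose I : set R := `]-oo, b]%classic.
have mI : measurable I by exact: measurable_itv.
pose f (p : R * R) : \bar R :=
  (normal_pdf m 1 p.1 * (phi (p.2 - al * p.1) * \1_I p.2))%:E.
have m1 : measurable_fun [set: R * R] (fun p : R * R => p.1) by exact: measurable_fst.
have m2 : measurable_fun [set: R * R] (fun p : R * R => p.2) by exact: measurable_snd.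
have mf : measurable_fun setT f.
  apply/measurable_EFinP; apply: measurable_funM.
    by apply: measurableT_comp m1; exact: measurable_normal_pdf.
  apply: measurable_funM.
    apply: (measurableT_comp measurable_phi).
    by apply: measurable_funB => //; exact: measurable_funM.
  by apply: measurableT_comp m2; exact: measurable_indic.
have f0 p : (0 <= f p)%E.
  by rewrite lee_fin !mulr_ge0 ?normal_pdf_ge0 ?(ltW (phi_gt0 _)).
transitivity (\int[leb]_x \int[leb]_s f (x, s))%E.
  apply: eq_integral => x _; rewrite EFinM -[b - _]/(b - _).
  rewrite -normal_prob_Nyc /normal_prob [X in (_ * X)%E]integral_mkcond.
  rewrite -ge0_integralZl_EFin ?normal_pdf_ge0//; last 2 first.
    by move=> s _; rewrite patchE; case: ifPn => _ //; rewrite lee_fin normal_pdf_ge0.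
    apply/(measurable_restrictT _ _).1; first exact: measurable_itv.
    exact: measurable_normal_pdfE.
  apply: eq_integral => s _; rewrite patchE /f/= indicE.
  rewrite -normal_pdf_phi.
  by case: ifPn => _; rewrite ?mulr1 ?mulr0 ?mule0// EFinM.
rewrite fubini_tonelli//.
rewrite -(normal_prob_sigma_Nyc (al * m) b k0) /normal_prob [RHS]integral_mkcond.
apply: eq_integral => s _; rewrite patchE /f/=.
transitivity (\int[leb]_x ((normal_pdf (al * m) k s * \1_I s)%:E *
   (normal_pdf ((m + al * s) / k ^+ 2) k^-1 x)%:E))%E.
  apply: eq_integral => x _; rewrite -EFinM normal_pdf_phi mulrA phi_phi -/k.
  by congr EFin; ring.
rewrite ge0_integralZl_EFin//; last 3 first.
- by move=> x _; rewrite lee_fin normal_pdf_ge0.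
- by apply/measurable_EFinP; exact: measurable_normal_pdf.
- by rewrite mulr_ge0 ?normal_pdf_ge0.
rewrite integral_normal_pdf mule1 indicE.
by case: ifPn => _; rewrite ?mulr1 ?mulr0.
Qed.

End linear_functionals.


Section halfspaces.
Context {R : realType}.
Local Notation leb := (@lebesgue_measure R).

Lemma dotvE n (x y : 'rV[R]_n) : dotv x y = \sum_(i < n) x 0 i * y 0 i.
Proof. by []. Qed.

Lemma dotvC n (x y : 'rV[R]_n) : dotv x y = dotv y x.
Proof. by apply: eq_bigr => i _; rewrite mulrC. Qed.

Lemma dotvDl n (x y z : 'rV[R]_n) : dotv (x + y) z = dotv x z + dotv y z.
Proof. by rewrite -big_split/=; apply: eq_bigr => i _; rewrite mxE mulrDl. Qed.

Lemma dotvNl n (x y : 'rV[R]_n) : dotv (- x) y = - dotv x y.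
Proof. by rewrite -sumrN; apply: eq_bigr => i _; rewrite mxE mulNr. Qed.

Lemma dotvBl n (x y z : 'rV[R]_n) : dotv (x - y) z = dotv x z - dotv y z.
Proof. by rewrite dotvDl dotvNl. Qed.

Lemma dotvZl n k (x y : 'rV[R]_n) : dotv (k *: x) y = k * dotv x y.
Proof. by rewrite mulr_sumr; apply: eq_bigr => i _; rewrite mxE mulrA. Qed.

Lemma dotvNr n (x y : 'rV[R]_n) : dotv x (- y) = - dotv x y.
Proof. by rewrite dotvC dotvNl dotvC. Qed.

Lemma dotvZr n k (x y : 'rV[R]_n) : dotv x (k *: y) = k * dotv x y.
Proof. by rewrite dotvC dotvZl dotvC. Qed.

Lemma dotvBr n (x y z : 'rV[R]_n) : dotv z (x - y) = dotv z x - dotv z y.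
Proof. by rewrite dotvC dotvBl dotvC [dotv y z]dotvC. Qed.

Lemma dotv_ge0 n (x : 'rV[R]_n) : 0 <= dotv x x.
Proof. by apply: sumr_ge0 => i _; rewrite -expr2 sqr_ge0. Qed.

Lemma enorm2 n (x : 'rV[R]_n) : enorm x ^+ 2 = dotv x x.
Proof. by rewrite /enorm sqr_sqrtr// dotv_ge0. Qed.

Lemma dotv_eq0 n (x : 'rV[R]_n) : dotv x x = 0 -> x = 0.
Proof.
move=> /eqP; rewrite psumr_eq0 => [/allP x0|i _]; last by rewrite -expr2 sqr_ge0.
apply/rowP => i; have := x0 i (mem_index_enum _).
by rewrite -expr2 sqrf_eq0 => /eqP ->; rewrite mxE.
Qed.

Lemma dotv_recl n (x y : 'rV[R]_n.+1) :
  dotv x y = x 0 0 * y 0 0 + dotv (rV_tail x) (rV_tail y).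
Proof.
by rewrite dotvE big_ord_recl; congr (_ + _); apply: eq_bigr => i _; rewrite !mxE.
Qed.

Lemma dotv_cons n x (v : 'rV[R]_n) (y : 'rV[R]_n.+1) :
  dotv (rV_cons (x, v)) y = x * y 0 0 + dotv v (rV_tail y).
Proof.
rewrite dotvE big_ord_recl rV_cons0; congr (_ + _).
by apply: eq_bigr => i _; rewrite rV_consS mxE.
Qed.

Lemma continuous_dotv n (nu : 'rV[R]_n) : continuous (fun x => dotv x nu).
Proof.
apply: continuous_big => [|i _ y]; first exact: add_continuous.
by apply: continuousM; [exact: coord_continuous|exact: cst_continuous].
Qed.

Lemma measurable_halfspace_lt n c (nu : 'rV[R]_n) : measurable (halfspace_lt c nu).
Proof.
apply: open_measurable_rV.
rewrite (_ : halfspace_lt c nu = (fun x => dotv x nu) @^-1` `]-oo, c[%classic).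
  by apply: open_comp; [move=> x _; exact: continuous_dotv|exact: interval_open].
by apply/seteqP; split => x; rewrite /halfspace_lt/= in_itv.
Qed.

Lemma halfspace_gtE n c (nu : 'rV[R]_n) : halfspace_gt c nu = halfspace_lt (- c) (- nu).
Proof.
by apply/seteqP; split => x; rewrite /halfspace_gt /halfspace_lt/= dotvNr ltrN2.
Qed.

Lemma measurable_halfspace_gt n c (nu : 'rV[R]_n) : measurable (halfspace_gt c nu).
Proof. by rewrite halfspace_gtE; exact: measurable_halfspace_lt. Qed.

Lemma rV_slice_halfspace n c (nu : 'rV[R]_n.+1) x :
  rV_slice (halfspace_lt c nu) x = halfspace_lt (c - x * nu 0 0) (rV_tail nu).
Proof.
apply/seteqP; split => v; rewrite /rV_slice /halfspace_lt/= dotv_cons;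
  by rewrite ltrBrDl.
Qed.

Let normal_indic (m : R) (A : set R) : measurable A ->
  (\int[leb]_x (normal_pdf m 1 x * \1_A x)%:E = normal_prob m 1 A)%E.
Proof.
move=> mA; rewrite /normal_prob [RHS]integral_mkcond; apply: eq_integral => x _.
by rewrite patchE indicE; case: ifPn => _; rewrite ?mulr1 ?mulr0.
Qed.

Let gauss_halfspace0 n (a : 'rV[R]_n) c :
  fine (gauss a (halfspace_lt c 0)) = ((0 < c)%R)%:R.
Proof.
have d0 (x : 'rV[R]_n) : dotv x 0 = 0 by apply: big1 => i _; rewrite mxE mulr0.
case: (boolP (0 < c)) => c0.
  rewrite (_ : halfspace_lt c 0 = setT) ?probability_setT//.
  by apply/seteqP; split => // x _; rewrite /halfspace_lt/= d0.
rewrite (_ : halfspace_lt c 0 = set0) ?measure0//.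
by rewrite -subset0 => x; rewrite /halfspace_lt/= d0; exact/negP.
Qed.

(** By induction through slices, which are half-spaces with normal [rV_tail nu]. The tail of a unit
    vector is not a unit vector, whence a statement for every nonzero normal. *)
Lemma gauss_halfspace n (a nu : 'rV[R]_n) c : 0 < dotv nu nu ->
  gauss a (halfspace_lt c nu) = (Phi ((c - dotv a nu) / enorm nu))%:E.
Proof.
elim: n a nu c => [|n IH] a nu c; first by rewrite dotvE big_ord0 ltxx.
move=> nu0; rewrite gauss_slice; last exact: measurable_halfspace_lt.
have [t0|t0] := ltP 0 (dotv (rV_tail nu) (rV_tail nu)).
  set s := enorm (rV_tail nu); have s0 : 0 < s by rewrite sqrtr_gt0.
  have s0' : s != 0 by rewrite gt_eqF.
  transitivity (\int[leb]_x (normal_pdf (a 0 0) 1 x *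
      Phi ((c - dotv (rV_tail a) (rV_tail nu)) / s - nu 0 0 / s * x))%:E)%E.
    apply: eq_integral => x _; rewrite rV_slice_halfspace IH//=.
    by congr (_ * Phi _)%:E; rewrite -/s; field.
  rewrite normal_Phi_integral; congr (Phi _)%:E.
  have E : enorm nu = s * Num.sqrt (1 + (nu 0 0 / s) ^+ 2).
    transitivity (Num.sqrt (s ^+ 2 * (1 + (nu 0 0 / s) ^+ 2))); last first.
      by rewrite sqrtrM ?sqr_ge0// sqrtr_sqr gtr0_norm.
    rewrite /enorm; congr Num.sqrt; rewrite dotv_recl -enorm2 -/s; field.
    exact: s0'.
  rewrite E dotv_recl; set q := Num.sqrt _.
  have q0 : q != 0 by rewrite gt_eqF// sqrtr_gt0 ltr_pwDl// sqr_ge0.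
  by field; apply/andP.
(* The half-space now constrains the first coordinate only: each slice is everything or empty. *)
have tail0 : rV_tail nu = 0.
  by apply: dotv_eq0; apply/le_anti; rewrite t0 dotv_ge0.
have v0 : nu 0 0 != 0.
  by apply: contraTneq nu0 => v0; rewrite dotv_recl v0 mul0r add0r -leNgt.
have d0 (x : 'rV[R]_n) : dotv x 0 = 0 by apply: big1 => i _; rewrite mxE mulr0.
have En : enorm nu = `|nu 0 0|.
  by rewrite /enorm dotv_recl tail0 d0 addr0 -expr2 sqrtr_sqr.
rewrite En dotv_recl tail0 d0 addr0.
pose A : set R := [set x | x * nu 0 0 < c].
transitivity (\int[leb]_x (normal_pdf (a 0 0) 1 x * \1_A x)%:E)%E.
  apply: eq_integral => x _; congr (_ * _)%:E.
  rewrite rV_slice_halfspace tail0 gauss_halfspace0 subr_gt0 indicE.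
  by congr (nat_of_bool _)%:R; apply/idP/idP; rewrite inE.
have [vneg|vpos] := ltP (nu 0 0) 0.
  have -> : A = ~` `]-oo, (c / nu 0 0)]%classic.
    apply/seteqP; split => x; rewrite /A/= in_itv/= => H.
      by apply/negP; rewrite -ltNge ltr_ndivrMr.
    by move/negP: H; rewrite -ltNge ltr_ndivrMr.
  rewrite normal_indic; last by apply: measurableC; exact: measurable_itv.
  rewrite probability_setC; last exact: measurable_itv.
  rewrite [X in (_ - X)%E](_ : _ = (Phi (c / nu 0 0 - a 0 0))%:E); last first.
    exact: normal_prob_Nyc.
  rewrite -EFinB -PhiN ltr0_norm//; congr (Phi _)%:E; field.
  exact: v0.
have {}vpos : 0 < nu 0 0 by rewrite lt_def v0.
have -> : A = `]-oo, (c / nu 0 0)[%classic.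
  by apply/seteqP; split => x; rewrite /A/= in_itv/= ltr_pdivlMr.
rewrite normal_indic; last exact: measurable_itv.
rewrite [LHS]normal_prob_Nyo gtr0_norm//; congr (Phi _)%:E; field.
exact: v0.
Qed.

End halfspaces.


(** * The Neyman-Pearson lemma and its equality case *)

Section neyman_pearson.
Context {R : realType}.
Local Notation leb n := (lebesgue_rV R n).

Lemma gaussian_pdf_gt0 n (x : 'rV[R]_n) : 0 < gaussian_pdf x.
Proof. by rewrite mulr_gt0 ?expR_gt0// powR_gt0// mulr_gt0// pi_gt0. Qed.

Lemma measurable_gaussian_pdfE n (a : 'rV[R]_n) (A : set 'rV[R]_n) :
  measurable_fun A (fun x : 'rV[R]_n => (gaussian_pdf (x - a))%:E : \bar R).
Proof.
by apply/measurable_EFinP; apply: measurable_funTS; exact: measurable_gaussian_pdf.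
Qed.

Lemma gt0_integral_null n (S : set 'rV[R]_n) (f : 'rV[R]_n -> R) :
  measurable S -> measurable_fun S f -> (forall x, S x -> 0 < f x) ->
  (\int[leb n]_(x in S) (f x)%:E = 0 -> leb n S = 0)%E.
Proof.
move=> mS mf f0 I0.
have mfE : measurable_fun S (EFin \o f) by apply/measurable_EFinP.
have : (\int[leb n]_(x in S) `|(EFin \o f) x| = 0)%E.
  rewrite -[RHS]I0; apply: eq_integral => x /set_mem Sx /=.
  by rewrite ger0_norm// ltW// f0.
move=> /(ae_eq_integral_abs _ mS mfE).1 [N [mN N0 SN]].
apply/le_anti/andP; split; last exact: measure_ge0.
rewrite -[X in (_ <= X)%E]N0; apply: le_measure; rewrite ?inE// => x Sx.
apply: SN => /= /(_ Sx) [] fx0; have := f0 x Sx; by rewrite fx0 ltxx.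
Qed.

Lemma gauss_null n (a : 'rV[R]_n) A : measurable A ->
  gauss a A = 0%E <-> leb n A = 0%E.
Proof.
move=> mA; rewrite gaussE; split => [|A0].
  apply: gt0_integral_null => //.
    by apply: measurable_funTS; exact: measurable_gaussian_pdf.
  by move=> x _; exact: gaussian_pdf_gt0.
by apply: null_set_integral => //; exact: measurable_gaussian_pdfE.
Qed.

(** The likelihood ratio depends on [x] only through [dotv x nu], and increases with it when
    [D > 0]: this is why half-spaces are the optimal tests. *)
Lemma gaussian_pdf_shift n (a nu x : 'rV[R]_n) (D : R) : dotv nu nu = 1 ->
  gaussian_pdf (x - (a + D *: nu)) =
  expR (D * (dotv x nu - dotv a nu) - D ^+ 2 / 2) * gaussian_pdf (x - a).
Proof.
move=> nu1; rewrite /gaussian_pdf mulrCA; congr (_ * _).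
rewrite -expRD; congr expR.
rewrite !enorm2 opprD addrA; set y := x - a.
have -> : dotv x nu - dotv a nu = dotv y nu by rewrite dotvBl.
clearbody y; rewrite dotvBl !dotvBr !dotvZl !dotvZr nu1 [dotv nu y]dotvC.
by field.
Qed.

Lemma gauss_shift_ge n (a nu : 'rV[R]_n) (D c : R) S : dotv nu nu = 1 -> 0 <= D ->
  measurable S -> (forall x, S x -> c <= dotv x nu) ->
  ((expR (D * (c - dotv a nu) - D ^+ 2 / 2))%:E * gauss a S <=
   gauss (a + D *: nu) S)%E.
Proof.
move=> nu1 D0 mS Sc; set l := expR _.
have E1 := gaussE (a + D *: nu) S; have E2 := gaussE a S.
apply: (@le_trans _ _ (\int[leb n]_(x in S) (l%:E * (gaussian_pdf (x - a))%:E))%E).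
  rewrite ge0_integralZl_EFin ?expR_ge0//.
  - by rewrite -E2.
  - by move=> x _; rewrite lee_fin gaussian_pdf_ge0.
  - exact: measurable_gaussian_pdfE.
apply: (@le_trans _ _ (\int[leb n]_(x in S) (gaussian_pdf (x - (a + D *: nu)))%:E)%E); last first.
  by rewrite -E1.
apply: ge0_le_integral => //.
- by move=> x _; rewrite -EFinM lee_fin mulr_ge0 ?expR_ge0 ?gaussian_pdf_ge0.
- apply: measurable_funeM; exact: measurable_gaussian_pdfE.
- exact: measurable_gaussian_pdfE.
- move=> x Sx; rewrite -EFinM lee_fin gaussian_pdf_shift// ler_wpM2r ?gaussian_pdf_ge0//.
  by rewrite ler_expR lerD2r ler_wpM2l// lerD2r Sc.
Qed.

Lemma gauss_shift_le n (a nu : 'rV[R]_n) (D c : R) S : dotv nu nu = 1 -> 0 <= D ->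
  measurable S -> (forall x, S x -> dotv x nu <= c) ->
  (gauss (a + D *: nu) S <=
   (expR (D * (c - dotv a nu) - D ^+ 2 / 2))%:E * gauss a S)%E.
Proof.
move=> nu1 D0 mS Sc; set l := expR _.
have E1 := gaussE (a + D *: nu) S; have E2 := gaussE a S.
apply: (@le_trans _ _ (\int[leb n]_(x in S) (l%:E * (gaussian_pdf (x - a))%:E))%E); last first.
  rewrite ge0_integralZl_EFin ?expR_ge0//.
  - by rewrite -E2.
  - by move=> x _; rewrite lee_fin gaussian_pdf_ge0.
  - exact: measurable_gaussian_pdfE.
apply: (@le_trans _ _ (\int[leb n]_(x in S) (gaussian_pdf (x - (a + D *: nu)))%:E)%E).
  by rewrite -E1.
apply: ge0_le_integral => //.
- by move=> x _; rewrite lee_fin gaussian_pdf_ge0.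
- exact: measurable_gaussian_pdfE.
- apply: measurable_funeM; exact: measurable_gaussian_pdfE.
- move=> x Sx; rewrite -EFinM lee_fin gaussian_pdf_shift// ler_wpM2r ?gaussian_pdf_ge0//.
  by rewrite ler_expR lerD2r ler_wpM2l// lerD2r Sc.
Qed.

(** On [S] the difference [f] of the densities is strictly positive, while the hypothesis makes its
    integral at most zero. *)
Lemma gauss_shift_gt_null n (a nu : 'rV[R]_n) (D c : R) S : dotv nu nu = 1 -> 0 < D ->
  measurable S -> (forall x, S x -> c < dotv x nu) ->
  (gauss (a + D *: nu) S <=
   (expR (D * (c - dotv a nu) - D ^+ 2 / 2))%:E * gauss a S)%E -> leb n S = 0%E.
Proof.
move=> nu1 D0 mS Sc; set l := expR _ => le.
pose f x := gaussian_pdf (x - (a + D *: nu)) - l * gaussian_pdf (x - a).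
have f0 x : S x -> 0 < f x.
  move=> Sx; rewrite subr_gt0 gaussian_pdf_shift// ltr_pM2r ?gaussian_pdf_gt0//.
  by rewrite ltr_expR ltrD2r ltr_pM2l// ltrD2r Sc.
have mf : measurable_fun S f.
  apply: measurable_funTS; apply: measurable_funB; first exact: measurable_gaussian_pdf.
  by apply: measurable_funM => //; exact: measurable_gaussian_pdf.
apply: (gt0_integral_null mS mf f0).
have mfE : measurable_fun S (fun x => (f x)%:E) by apply/measurable_EFinP.
have If0 : (0 <= \int[leb n]_(x in S) (f x)%:E)%E.
  by apply: integral_ge0 => x Sx; rewrite lee_fin ltW// f0.
apply/le_anti; rewrite If0 andbT.
have lS : ((l%:E * gauss a S)%E \is a fin_num) by rewrite fin_numM// fin_num_measure.
have E : (gauss (a + D *: nu) S = \int[leb n]_(x in S) (f x)%:E + l%:E * gauss a S)%E.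
  have E2 := gaussE a S; apply: (etrans (gaussE _ _)).
  transitivity (\int[leb n]_(x in S) ((f x)%:E + l%:E * (gaussian_pdf (x - a))%:E))%E.
    by apply: eq_integral => x _; rewrite -EFinM -EFinD /f subrK.
  rewrite ge0_integralD//.
  - congr (_ + _)%E; rewrite ge0_integralZl_EFin ?expR_ge0//.
    + by rewrite -E2.
    + by move=> x _; rewrite lee_fin gaussian_pdf_ge0.
    + exact: measurable_gaussian_pdfE.
  - by move=> x Sx; rewrite lee_fin ltW// f0.
  - by move=> x _; rewrite -EFinM lee_fin mulr_ge0 ?expR_ge0 ?gaussian_pdf_ge0.
  - apply: measurable_funeM; exact: measurable_gaussian_pdfE.
move: le; rewrite E => le; rewrite -(leeD2rE _ _ lS).
by rewrite add0e.
Qed.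

Lemma gauss_halfspace_gt n (a nu : 'rV[R]_n) c : dotv nu nu = 1 ->
  gauss a (halfspace_gt c nu) = (Phi (dotv a nu - c))%:E.
Proof.
move=> nu1; have nn : dotv (- nu) (- nu) = 1 by rewrite dotvNl dotvNr opprK.
rewrite halfspace_gtE gauss_halfspace ?nn ?ltr01// /enorm nn sqrtr1 divr1 dotvNr.
by congr (Phi _)%:E; ring.
Qed.

Lemma gauss_halfspace_lt n (a nu : 'rV[R]_n) c : dotv nu nu = 1 ->
  gauss a (halfspace_lt c nu) = (Phi (c - dotv a nu))%:E.
Proof. by move=> nu1; rewrite gauss_halfspace ?nu1 ?ltr01// /enorm nu1 sqrtr1 divr1. Qed.

(** [H] and [A] have the same measure under [gauss a], hence so do their two differences; the
    likelihood ratio is at least its boundary value [l] on [H] minus [A], and at most [l] on [A]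
    minus [H]. In the equality case the first difference is null because the ratio is strictly above
    [l] there, and the second because it has the same measure. *)
Lemma neyman_pearson n (a nu : 'rV[R]_n) (D u : R) A : dotv nu nu = 1 -> 0 <= D ->
  measurable A -> gauss a A = (Phi u)%:E ->
  (gauss (a + D *: nu) A <= (Phi (u + D))%:E)%E /\
  (0 < D -> gauss (a + D *: nu) A = (Phi (u + D))%:E ->
    leb n (A `+` halfspace_gt (dotv a nu - u) nu) = 0%E).
Proof.
move=> nu1 D0 mA aA; set H := halfspace_gt _ _; set b := a + D *: nu.
have mH : measurable H by exact: measurable_halfspace_gt.
have mAH : measurable (A `\` H) by exact: measurableD.
have mHA : measurable (H `\` A) by exact: measurableD.
have aH : gauss a H = (Phi u)%:E.
  by rewrite gauss_halfspace_gt//; congr (Phi _)%:E; ring.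
have bH : gauss b H = (Phi (u + D))%:E.
  by rewrite gauss_halfspace_gt//; congr (Phi _)%:E; rewrite dotvDl dotvZl nu1; ring.
set l := expR (D * ((dotv a nu - u) - dotv a nu) - D ^+ 2 / 2).
have l0 : 0 < l by exact: expR_gt0.
have le1 : ((l%:E * gauss a (H `\` A)) <= gauss b (H `\` A))%E.
  by apply: gauss_shift_ge => // x [Hx _]; exact: ltW.
have le2 : (gauss b (A `\` H) <= l%:E * gauss a (A `\` H))%E.
  by apply: gauss_shift_le => // x [_ /negP]; rewrite /H /halfspace_gt /= -leNgt.
have fin (c : 'rV[R]_n) S : measurable S -> exists r, gauss c S = r%:E.
  by move=> mS; exists (fine (gauss c S)); rewrite gauss_fine.
have [p1 P1] := fin a _ mAH; have [p2 P2] := fin a _ mHA.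
have [q1 Q1] := fin b _ mAH; have [q2 Q2] := fin b _ mHA.
have mI := measurableI _ _ mA mH.
have [p3 P3] := fin a _ mI; have [q3 Q3] := fin b _ mI.
have eaA : Phi u = p1 + p3.
  by apply: EFin_inj; rewrite EFinD -aA -P1 -P3; exact: measureDI.
have eaH : Phi u = p2 + p3.
  by apply: EFin_inj; rewrite EFinD -aH -P2 -P3 setIC; exact: measureDI.
have ebA : gauss b A = (q1 + q3)%:E.
  by rewrite EFinD -Q1 -Q3; exact: measureDI.
have ebH : Phi (u + D) = q2 + q3.
  by apply: EFin_inj; rewrite EFinD -bH -Q2 -Q3 setIC; exact: measureDI.
have {}le1 : l * p2 <= q2 by rewrite -lee_fin EFinM -P2 -Q2.
have {}le2 : q1 <= l * p1 by rewrite -lee_fin EFinM -P1 -Q1.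
have p12 : p1 = p2 by lra.
split.
  rewrite ebA lee_fin ebH; rewrite p12 in le2; lra.
move=> Dgt0 ebA'.
have q12 : q1 = q2.
  have : q1 + q3 = q2 + q3 by rewrite -ebH; apply: EFin_inj; rewrite -ebA'.
  exact: addIr.
have HA0 : leb n (H `\` A) = 0%E.
  apply: (gauss_shift_gt_null (a := a) nu1 Dgt0 mHA (c := dotv a nu - u)).
    by move=> x [].
  rewrite -/b Q2; apply: le_trans (_ : (l * p2)%:E <= _)%E.
      by rewrite lee_fin -q12 -p12.
    by rewrite EFinM P2.
have AH0 : leb n (A `\` H) = 0%E.
  apply/(gauss_null a mAH); apply: (etrans P1); rewrite p12 -P2.
  exact/(gauss_null a mHA).
by rewrite /setY measureU0.
Qed.

End neyman_pearson.

(** * The optimal profile *)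


Section profile.
Context {R : realType}.
Implicit Types (x y m d t u v : R).

(** The hyperbolic tangent of [d * x]. *)
Let th d x : R := 1 - 2 / (expR (2 * d * x) + 1).

Let th_den d x : expR (2 * d * x) + 1 != 0.
Proof. by rewrite gt_eqF// addr_gt0// expR_gt0. Qed.

Let dth d x : is_derive x 1 (th d) (d * (1 - th d x ^+ 2)).
Proof.
have D := is_deriveDE (@is_derive_compE _ expR (fun y => 2 * d * y) _ _ _
  (is_derive_expR _) (is_deriveZE (2 * d) (is_derive_idE x))) (is_derive_cstE 1 x).
have DV := is_deriveBE (is_derive_cstE 1 x) (is_deriveZE 2
  (@is_deriveV _ (fun y => expR (2 * d * y) + 1) x _ 1 (th_den d x) D)).
apply: is_derive_eq DV _; rewrite /th /GRing.scale/=.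
by have := th_den d x; set e := expR _ => e0; field.
Qed.

Let th0 d : th d 0 = 0.
Proof. by rewrite /th mulr0 expR0; field. Qed.

Let th_le d x y : 0 <= d -> x <= y -> th d x <= th d y.
Proof.
move=> d0 xy; rewrite lerD2l lerN2 ler_pM2l// lef_pV2 ?posrE ?addr_gt0 ?expR_gt0//.
by rewrite lerD2r ler_expR ler_wpM2l// mulr_ge0.
Qed.

Let th_sqr_le d x y : 0 <= d -> 0 <= x -> x <= y -> th d x ^+ 2 <= th d y ^+ 2.
Proof.
move=> d0 x0 xy; have a := th_le d0 xy; have b := th_le d0 x0; rewrite th0 in b.
by rewrite lerXn2r// nnegrE// (le_trans b).
Qed.

(** Concavity on the positive half-line: the slope at [x] is at most that of the chord from 0. *)
Let th_tangent d x : 0 <= d -> 0 < x -> x * (d * (1 - th d x ^+ 2)) <= th d x.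
Proof.
move=> d0 x0; have [c [c0 cx]] := mean_value (dth d) x0.
rewrite th0 !subr0 => e; rewrite [leRHS]e mulrC ler_pM2r// ler_wpM2l// lerD2l lerN2.
by rewrite th_sqr_le// ltW.
Qed.

(* The sign of the derivative of the profile gap at [m = - x]. *)
Let psi d x : R := x - 2 * phi d - d * th d x.

Let dpsi d x : is_derive x 1 (psi d) (1 - d * (d * (1 - th d x ^+ 2))).
Proof.
have D := is_deriveBE (is_deriveBE (is_derive_idE x) (is_derive_cstE (2 * phi d) x))
  (is_deriveZE d (dth d x)).
by apply: is_derive_eq D _; rewrite subr0.
Qed.

(** [psi] changes sign at most once on the positive half-line. Where it is nonnegative,
    [d * th d x < x], so [th_tangent] makes its derivative positive, and the derivative stays
    positive further right because the square of [th] grows. *)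
Let psi_crossing d x y : 0 <= d -> 0 < x -> x < y -> 0 <= psi d x -> 0 < psi d y.
Proof.
move=> d0 x0 xy p0; have [c [xc cy e]] := mean_value (dpsi d) xy.
have px := @phi_gt0 R d.
have H1 : d * th d x < x by move: p0; rewrite /psi; lra.
have H2 : x * (d * (d * (1 - th d x ^+ 2))) <= d * th d x.
  by rewrite mulrCA ler_wpM2l// th_tangent.
have H3 : d * (d * (1 - th d x ^+ 2)) < 1.
  by rewrite -(ltr_pM2l x0) mulr1 (le_lt_trans H2).
have H4 : d * (d * (1 - th d c ^+ 2)) <= d * (d * (1 - th d x ^+ 2)).
  by do 2 rewrite ler_wpM2l//; rewrite lerD2l lerN2 th_sqr_le// ltW.
have : 0 < (1 - d * (d * (1 - th d c ^+ 2))) * (y - x).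
  by rewrite mulr_gt0 ?subr_gt0// (le_lt_trans H4).
by rewrite -e; move: p0; lra.
Qed.

Let gap d m : R := phi (m + d) + phi (m - d) - 2 * phi d * (Phi (m + d) + Phi (m - d)).

(** The ratio of [phi (m + d)] to [phi (m - d)] is [exp (- 2 d m)], which is how the hyperbolic
    tangent enters. *)
Let dgap d m : is_derive m 1 (gap d) ((phi (m + d) + phi (m - d)) * psi d (- m)).
Proof.
have Dp := is_deriveDE (is_derive_idE m) (is_derive_cstE d m).
have Dm := is_deriveBE (is_derive_idE m) (is_derive_cstE d m).
have cmp (f df : R -> R) (fdf : forall y, is_derive y 1 f (df y)) :
    is_derive m 1 (fun z => f (z + d) + f (z - d)) (df (m + d) + df (m - d)).
  have D := is_deriveDE (@is_derive_compE _ f (fun z => z + d) _ _ _ (fdf _) Dp)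
    (@is_derive_compE _ f (fun z => z - d) _ _ _ (fdf _) Dm).
  by apply: is_derive_eq D _; rewrite addr0 subr0 !mulr1.
have D := is_deriveBE (cmp phi _ is_derive_phi) (is_deriveZE (2 * phi d) (cmp Phi _ is_derive_Phi)).
apply: is_derive_eq D _; rewrite /psi /th.
have E : phi (m + d) = phi (m - d) * expR (2 * d * - m).
  rewrite !phiE -[RHS]mulrA -expRD; congr (_ * expR _).
  by field.
have := th_den d (- m); rewrite E; set e := expR _ => e0.
by field.
Qed.

Let gap0 d : gap d 0 = 0.
Proof. by rewrite /gap add0r sub0r phiN PhiN; ring. Qed.

(** As [m] runs from [-oo] to 0, the single sign change of [psi] makes [gap] first increase and then
    decrease. It tends to 0 at [-oo] and vanishes at 0, so it is positive in between. *)
Let gap_gt0 d m : 0 <= d -> m < 0 -> 0 < gap d m.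
Proof.
move=> d0 m0; rewrite ltNge; apply/negP => g0.
have ps z : 0 < phi (z + d) + phi (z - d) by rewrite addr_gt0 ?phi_gt0.
have [psi0|psi0] := leP 0 (psi d (- m)).
  have incr m1 m2 : m1 < m2 -> m2 <= m -> gap d m1 < gap d m2.
    move=> m12 m2m; have [c [m1c cm2 e]] := mean_value (dgap d) m12.
    rewrite -subr_gt0 e mulr_gt0 ?subr_gt0// mulr_gt0//.
    by apply: (psi_crossing d0 _ _ psi0); lra.
  have g1 : gap d (m - 1) < 0 by apply: lt_le_trans g0; apply: incr; lra.
  have pd := @phi_gt0 R d.
  (* With this [e] the subtracted term of [gap] at [m1] is at most [- gap d (m - 1)], so the gap at
     [m1] exceeds the one at [m - 1], against monotonicity. *)
  pose e := - gap d (m - 1) / (4 * phi d).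
  have e0 : 0 < e by rewrite divr_gt0 ?oppr_gt0// mulr_gt0.
  have [M HM] := Phi_small e0.
  pose m1 := Num.min (M - d) (m - 2).
  have m1M : m1 <= M - d by rewrite ge_min lexx.
  have m1m : m1 <= m - 2 by rewrite ge_min lexx orbT.
  have : gap d m1 < gap d (m - 1) by apply: incr; lra.
  rewrite ltNge => /negP; apply.
  have P1 : Phi (m1 + d) < e by apply: HM; lra.
  have P2 : Phi (m1 - d) < e by apply: HM; lra.
  have : 2 * phi d * (Phi (m1 + d) + Phi (m1 - d)) <= 2 * phi d * (e + e).
    by rewrite ler_pM2l ?mulr_gt0//; lra.
  have -> : 2 * phi d * (e + e) = - gap d (m - 1).
    by rewrite /e; field; rewrite gt_eqF.
  by move=> H; rewrite [leRHS]/gap; have := ps m1; lra.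
have [c [mc c0 e]] := mean_value (dgap d) m0.
have pc : psi d (- c) < 0.
  rewrite ltNge; apply/negP => pc.
  have : 0 < psi d (- m) by apply: (psi_crossing d0 _ _ pc); lra.
  by move: psi0; lra.
have : (phi (c + d) + phi (c - d)) * psi d (- c) * (0 - m) < 0.
  by rewrite pmulr_llt0 ?pmulr_rlt0//; lra.
by rewrite -e gap0; move: g0; lra.
Qed.

Lemma phi_le_abs t u : `|u| <= t -> phi t <= phi u.
Proof.
move=> ut; apply: phi_decr; rewrite -real_normK ?num_real// lerXn2r ?nnegrE//.
exact: le_trans ut.
Qed.

Lemma phi_eq_abs t u : `|u| <= t -> phi t = phi u -> `|u| = t.
Proof.
move=> ut; have t0 : 0 <= t := le_trans (normr_ge0 _) ut.
have c0 : 0 < (Num.sqrt (2 * pi))^-1 :> R by rewrite invr_gt0 sqrtr_gt0 mulr_gt0// pi_gt0.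
rewrite !phiE => /(mulfI (lt0r_neq0 c0)) /expR_inj e.
have : u ^+ 2 = t ^+ 2 by lra.
rewrite -real_normK ?num_real// => /eqP; rewrite eqrXn2// => /eqP //.
Qed.

(** Writing [u] and [v] as [m + d] and [m - d], up to order, leaves two losses: [gap d m >= 0], and
    [phi t <= phi d] because [d <= t]. Equality cancels both, so [m = 0] and [d = t]. *)
Lemma profile_le t u v : `|u - v| <= 2 * t -> u + v <= 0 ->
  2 * phi t * (Phi u + Phi v) <= phi u + phi v /\
  (2 * phi t * (Phi u + Phi v) = phi u + phi v -> u + v = 0 /\ `|u - v| = 2 * t).
Proof.
move=> uvt uv0; pose d := `|u - v| / 2; pose m := (u + v) / 2.
have d0 : 0 <= d by rewrite divr_ge0.
have dt : `|d| <= t by rewrite ger0_norm// /d; lra.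
have ptd := phi_le_abs dt.
have sym (f : R -> R) : f u + f v = f (m + d) + f (m - d).
  have [vu|uv] := leP v u.
    by rewrite /m /d ger0_norm ?subr_ge0//; congr (f _ + f _); field.
  by rewrite addrC /m /d ltr0_norm ?subr_lt0//; congr (f _ + f _); field.
rewrite !sym; set S := Phi _ + Phi _.
have S0 : 0 < S by rewrite addr_gt0 ?Phi_gt0.
have gE : phi (m + d) + phi (m - d) = gap d m + 2 * phi d * S by rewrite /gap subrK.
have le : 2 * phi t * S <= 2 * phi d * S by rewrite ler_pM2r// ler_pM2l.
have [m0|m0] := ltP m 0.
  have := gap_gt0 d0 m0; rewrite gE => g0.
  by split; lra.
have mE : m = 0 by apply/le_anti; rewrite m0 andbT /m; lra.
rewrite gE mE gap0 add0r; split => // e; split.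
  by move: mE; rewrite /m; lra.
have ptde : phi t = phi d.
  by move: e => /(mulIf (lt0r_neq0 S0)) /(mulfI _) ->//; rewrite pnatr_eq0.
have := phi_eq_abs dt ptde; rewrite ger0_norm// /d; lra.
Qed.

End profile.

(** * The Cheeger constant of the mixture *)


Section mixture.
Context {R : realType}.

Lemma gauss_real n (a : 'rV[R]_n) A : measurable A ->
  exists p, [/\ gauss a A = p%:E, 0 <= p & p <= 1].
Proof.
move=> mA; exists (fine (gauss a A)); split; first exact/esym/gauss_fine.
  by have /andP[] := fine_gauss01 a mA.
by have /andP[] := fine_gauss01 a mA.
Qed.

Lemma limf_einf_ge (f : R -> \bar R) (L : R) :
  (forall k, 0 < k -> \forall e \near (0 : R)^'+, ((L - k)%:E <= f e)%E) ->
  (L%:E <= limf_einf f (0 : R)^'+)%E.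
Proof.
move=> H; apply/lee_subgt0Pr => k k0; rewrite limf_einfE -EFinB.
apply: le_ereal_sup_tmp; exists (ereal_inf (f @` [set e | ((L - k)%:E <= f e)%E])).
  by exists [set e | ((L - k)%:E <= f e)%E] => //; exact: H.
by apply: le_ereal_inf_tmp => _ [e /= ? <-].
Qed.

Lemma limf_einf_le (f : R -> \bar R) (L : R) :
  (forall k, 0 < k -> \forall e \near (0 : R)^'+, (f e <= (L + k)%:E)%E) ->
  (limf_einf f (0 : R)^'+ <= L%:E)%E.
Proof.
move=> H; apply/lee_addgt0Pr => k k0; rewrite limf_einfE -EFinD.
apply: ge_ereal_sup => _ [V V0 <-].
have [e [Ve fe]] : exists e, V e /\ (f e <= (L + k)%:E)%E.
  near (0 : R)^'+ => e; exists e; split; near: e; [exact: V0|exact: H].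
by apply: le_trans fe; apply: ereal_inf_lbound; exists e.
Unshelve. all: by end_near. Qed.

Lemma derive_right_bounds (F : R -> R) (L k : R) : is_derive (0 : R) 1 F L -> 0 < k ->
  \forall e \near (0 : R)^'+, (L - k) * e <= F e - F 0 <= (L + k) * e.
Proof.
move=> FL k0.
have D1 := is_deriveBE FL (is_deriveZE (L - k) (is_derive_idE (0 : R))).
have D2 := is_deriveBE (is_deriveZE (L + k) (is_derive_idE (0 : R))) FL.
have := derive_gt0_right D1; rewrite mulr1 (_ : L - (L - k) = k); last by ring.
have := derive_gt0_right D2; rewrite mulr1 (_ : L + k - L = k); last by ring.
move=> /(_ k0) near2 /(_ k0) near1; near=> e.
have h1 : F 0 - (L - k) * 0 < F e - (L - k) * e by near: e.
have h2 : (L + k) * 0 - F 0 < (L + k) * e - F e by near: e.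
by move: h1 h2; rewrite !mulr0; lra.
Unshelve. all: by end_near. Qed.

Variables (n : nat) (a b : 'rV[R]_n).
Let mu : probability 'rV[R]_n R := gaussian_mixture a b.

Lemma mixture_value A (x y : R) : measurable A -> gauss a A = x%:E ->
  gauss b A = y%:E -> mu A = ((x + y) / 2)%:E.
Proof.
move=> mA aA bA; apply: (etrans (gaussian_mixtureE a b mA)).
apply: (etrans (congr2 (fun p q => (2^-1)%:E * p + (2^-1)%:E * q)%E aA bA)).
by rewrite -!EFinM -EFinD -mulrDr mulrC.
Qed.

Lemma mixture_null A : measurable A -> mu A = 0%E <-> lebesgue_rV R n A = 0%E.
Proof.
move=> mA; have [p [ea p0 _]] := gauss_real a mA; have [q [eb q0 _]] := gauss_real b mA.
have muE := mixture_value mA ea eb.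
split=> [mu0|A0].
  apply/(gauss_null a mA); apply: (etrans ea); congr EFin.
  by have [] := etrans (esym muE) mu0; lra.
have /(gauss_null a mA) a00 := A0; have /(gauss_null b mA) b00 := A0.
have [pE] := etrans (esym ea) a00; have [qE] := etrans (esym eb) b00.
by apply: (etrans muE); rewrite pE qE addr0 mul0r.
Qed.

(** Both Gaussians and the mixture have the null sets of Lebesgue measure, so neither Gaussian
    measure of [A] can be 0 or 1. *)
Lemma mixture_gauss_range A : measurable A -> (0 < mu A < 1)%E ->
  exists u v, gauss a A = (Phi u)%:E /\ gauss b A = (Phi v)%:E.
Proof.
move=> mA /andP[mu0 mu1]; have mCA : measurable (~` A) by exact: measurableC.
have nA : lebesgue_rV R n A != 0%E.
  by apply/eqP => /(mixture_null mA) h; rewrite h ltxx in mu0.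
have nCA : lebesgue_rV R n (~` A) != 0%E.
  apply/eqP => /(mixture_null mCA); rewrite probability_setC// => h.
  have : (0 < 1 - mu A)%E by rewrite sube_gt0.
  by rewrite h ltxx.
have quant (c : 'rV[R]_n) : exists u, gauss c A = (Phi u)%:E.
  have [p [ec c0 c1]] := gauss_real c mA.
  have [|u uE] := @Phi_surj R p; last by exists u; rewrite uE.
  rewrite !lt_def c0 c1 !andbT; apply/andP; split.
    apply/eqP => h; move/eqP: nA; apply; apply/(gauss_null c mA).
    by apply: (etrans ec); rewrite h.
  apply/eqP => h; move/eqP: nCA; apply; apply/(gauss_null c mCA).
  apply: (etrans (probability_setC _ mA)).
  by rewrite [X in (_ - X)%E]ec -h subee.
by have [u ?] := quant a; have [v ?] := quant b; exists u, v.
Qed.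

Lemma mixture_shell A e (x x' : R) : measurable A -> 0 < e ->
  mu A = x%:E -> mu (open_nbhd A e) = x'%:E ->
  mu (open_nbhd A e `\` A) = (x' - x)%:E.
Proof.
move=> mA e0 Ax Aex'; have mAe := measurable_open_nbhd A e.
have fin : (mu (open_nbhd A e) < +oo)%E by apply: (@le_lt_trans _ _ x'%:E); rewrite ?Aex' ?ltry.
apply: (etrans (measureD mAe mA fin)); rewrite EFinB; congr (_ - _)%E => //.
by rewrite setIC setIidl//; exact: sub_open_nbhd.
Qed.

Let mean_Phi u v e : R := (Phi (u + e) + Phi (v + e)) / 2.

Let dmean_Phi u v : is_derive (0 : R) 1 (mean_Phi u v) ((phi u + phi v) / 2).
Proof.
have Dw w : is_derive (0 : R) 1 (fun e => Phi (w + e)) (phi w).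
  have D := is_deriveDE (is_derive_cstE w (0 : R)) (is_derive_idE (0 : R)).
  have D' := @is_derive_compE _ Phi (fun e => w + e) _ _ _ (is_derive_Phi _) D.
  by apply: is_derive_eq D' _; rewrite addr0 add0r mulr1.
have D := is_deriveME (is_deriveDE (Dw u) (Dw v)) (is_derive_cstE 2^-1 (0 : R)).
by apply: is_derive_eq D _; rewrite mulr0 add0r mulrC.
Qed.

Let mean_Phi0 u v : mean_Phi u v 0 = (Phi u + Phi v) / 2.
Proof. by rewrite /mean_Phi !addr0. Qed.

Let divE (x : \bar R) e : 0 < e -> (x / e%:E = x * (e^-1)%:E)%E.
Proof. by move=> e0; rewrite inver gt_eqF. Qed.

(** Isoperimetry for each component bounds the mass of the shell below by the increment of
    [mean_Phi u v], whose derivative at 0 is the stated bound. *)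
Lemma mixture_minkowski_ge A u v : measurable A ->
  gauss a A = (Phi u)%:E -> gauss b A = (Phi v)%:E ->
  (((phi u + phi v) / 2)%:E <= lower_minkowski mu A)%E.
Proof.
move=> mA aA bA; apply: limf_einf_ge => k k0.
have := derive_right_bounds (dmean_Phi u v) k0; apply: filterS2 (nbhs_right_gt 0).
move=> e e0 /andP[lo _]; rewrite divE// lee_pdivlMr//.
have mAe := measurable_open_nbhd A e.
have eq_le c w : gauss c A = (Phi w)%:E -> ((Phi w)%:E <= gauss c A)%E.
  by move=> ->.
have [p [ea _ _]] := gauss_real a mAe; have [q [eb _ _]] := gauss_real b mAe.
rewrite (mixture_shell mA e0 (mixture_value mA aA bA) (mixture_value mAe ea eb)).
rewrite -EFinM lee_fin.
have Ha : Phi (u + e) <= p.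
  rewrite -lee_fin; apply: (le_trans (gaussian_isoperimetry mA e0 (eq_le _ _ aA))).
  by rewrite [X in (X <= _)%E]ea.
have Hb : Phi (v + e) <= q.
  rewrite -lee_fin; apply: (le_trans (gaussian_isoperimetry mA e0 (eq_le _ _ bA))).
  by rewrite [X in (X <= _)%E]eb.
by apply: (le_trans lo); rewrite mean_Phi0 /mean_Phi; lra.
Qed.

Lemma cauchy_schwarz_unit (x nu : 'rV[R]_n) : dotv nu nu = 1 -> dotv x nu <= enorm x.
Proof.
move=> nu1; have := dotv_ge0 (x - dotv x nu *: nu).
rewrite dotvBl !dotvBr !dotvZl !dotvZr nu1 [dotv nu x]dotvC => H.
have {}H : dotv x nu ^+ 2 <= enorm x ^+ 2 by rewrite enorm2; lra.
apply: (le_trans (ler_norm _)).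
by rewrite -(@ler_pXn2r _ 2) ?nnegrE ?enorm_ge0// real_normK ?num_real.
Qed.

Lemma open_nbhd_halfspace c nu e : dotv nu nu = 1 -> 0 < e ->
  open_nbhd (halfspace_lt c nu) e = halfspace_lt (c + e) nu :> set 'rV[R]_n.
Proof.
move=> nu1 e0; apply/seteqP; split => x.
  move=> /open_nbhdP[y yc xy]; rewrite /halfspace_lt/= in yc *.
  have := cauchy_schwarz_unit (x - y) nu1; rewrite dotvBl; lra.
rewrite /halfspace_lt/= => xc; apply/open_nbhdP.
(* Halfway between the distance to cover, [dotv x nu - c], and the allowed [e]; 0 if that is
   negative. *)
pose d := Num.max 0 ((dotv x nu - c + e) / 2).
have d0 : 0 <= d by rewrite le_max lexx.
exists (x - d *: nu).
  rewrite /halfspace_lt/= dotvBl dotvZl nu1 mulr1.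
  have : (dotv x nu - c + e) / 2 <= d by rewrite le_max lexx orbT.
  lra.
rewrite opprB addrC subrK /enorm dotvZl dotvZr nu1 mulr1 -expr2 sqrtr_sqr ger0_norm//.
by rewrite gt_max e0/=; lra.
Qed.

Lemma mixture_halfspace c nu : dotv nu nu = 1 ->
  mu (halfspace_lt c nu) = ((Phi (c - dotv a nu) + Phi (c - dotv b nu)) / 2)%:E.
Proof.
move=> nu1; apply: mixture_value; first exact: measurable_halfspace_lt.
- exact: gauss_halfspace_lt.
- exact: gauss_halfspace_lt.
Qed.

Lemma mixture_minkowski_halfspace c nu : dotv nu nu = 1 ->
  (lower_minkowski mu (halfspace_lt c nu) <=
   ((phi (c - dotv a nu) + phi (c - dotv b nu)) / 2)%:E)%E.
Proof.
move=> nu1; apply: limf_einf_le => k k0.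
set u := c - dotv a nu; set v := c - dotv b nu.
have := derive_right_bounds (dmean_Phi u v) k0; apply: filterS2 (nbhs_right_gt 0).
move=> e e0 /andP[_ hi]; rewrite divE// lee_pdivrMr//.
have mH := @measurable_halfspace_lt R n c nu.
have He : mu (open_nbhd (halfspace_lt c nu) e) = (mean_Phi u v e)%:E.
  rewrite open_nbhd_halfspace// mixture_halfspace// /mean_Phi /u /v.
  by congr ((Phi _ + Phi _) / 2)%:E; ring.
rewrite (mixture_shell mH e0 (mixture_halfspace c nu1) He).
by rewrite -EFinM lee_fin -mean_Phi0.
Qed.

End mixture.


(** * Cheeger ratios and optimal sets *)

Section cheeger_bounds.
Context {R : realType}.
Variables (n : nat) (a b : 'rV[R]_n).
Let mu : probability 'rV[R]_n R := gaussian_mixture a b.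

Let ratioE A (p : R) : mu A = p%:E -> 0 < p < 1 ->
  cheeger_ratio mu A = (lower_minkowski mu A * ((Num.min p (1 - p))^-1)%:E)%E.
Proof.
move=> Ap /andP[p0 p1].
have E : (mine (mu A) (1 - mu A) = (Num.min p (1 - p))%:E)%E.
  by rewrite Ap -EFinB -EFin_min.
by rewrite /cheeger_ratio E inver gt_eqF// lt_min p0 subr_gt0.
Qed.

(** The hyperplane is equidistant from the two centres, so the half-space has measure 1/2. The sign
    of [w] is left free to cover both sides: [w = t] with normal [nu], and [w = - t] with normal
    [- nu]. *)
Lemma cheeger_ratio_halfspace (c w : R) nu : dotv nu nu = 1 ->
  c - dotv a nu = w -> c - dotv b nu = - w ->
  admissible mu (halfspace_lt c nu) /\
  (cheeger_ratio mu (halfspace_lt c nu) <= (2 * phi w)%:E)%E.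
Proof.
move=> nu1 aw bw; have muH := mixture_halfspace a b c nu1.
have {}muH : mu (halfspace_lt c nu) = (2^-1)%:E.
  by apply: (etrans muH); rewrite aw bw PhiN; congr EFin; field.
have half01 : 0 < (2^-1 : R) < 1 by apply/andP; split; lra.
split.
  split; first exact: measurable_halfspace_lt.
  by have /andP[h0 h1] := half01; rewrite [mu _]muH !lte_fin h0 h1.
rewrite (ratioE muH half01) (_ : 1 - 2^-1 = 2^-1); last by field.
rewrite minxx lee_pdivrMr; last by rewrite invr_gt0.
apply: (le_trans (mixture_minkowski_halfspace a b c nu1)).
by rewrite aw bw phiN -EFinM lee_fin; lra.
Qed.

Variables (nu : 'rV[R]_n) (t : R).
Hypotheses (nu1 : dotv nu nu = 1) (t0 : 0 <= t) (bE : b = a + (2 * t) *: nu).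

Let aE : a = b + (2 * t) *: - nu.
Proof. by rewrite bE scalerN addrK. Qed.

Let nuN1 : dotv (- nu) (- nu) = 1.
Proof. by rewrite dotvNl dotvNr opprK. Qed.

(** Neyman-Pearson from [a] towards [b], then from [b] towards [a]. *)
Let gauss_close A u v : measurable A -> gauss a A = (Phi u)%:E ->
  gauss b A = (Phi v)%:E -> `|u - v| <= 2 * t.
Proof.
move=> mA aA bA; have D0 : 0 <= 2 * t by rewrite mulr_ge0.
have [vu _] := neyman_pearson nu1 D0 mA aA.
have [uv _] := neyman_pearson nuN1 D0 mA bA.
have {}vu : v <= u + 2 * t.
  by rewrite -Phi_le -lee_fin; apply: le_trans vu; rewrite -bE bA.
have {}uv : u <= v + 2 * t.
  by rewrite -Phi_le -lee_fin; apply: le_trans uv; rewrite -aE aA.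
by rewrite ler_norml; lra.
Qed.

Lemma cheeger_ratio_ge A : admissible mu A ->
  ((2 * phi t)%:E <= cheeger_ratio mu A)%E /\
  (0 < t -> cheeger_ratio mu A = (2 * phi t)%:E ->
   lebesgue_rV R n (A `+` halfspace_gt (dotv a nu + t) nu) = 0%E \/
   lebesgue_rV R n (A `+` halfspace_lt (dotv a nu + t) nu) = 0%E).
Proof.
move=> [mA A01]; have [u [v [aA bA]]] := mixture_gauss_range mA A01.
have uvt := gauss_close mA aA bA.
have Ap := mixture_value mA aA bA.
have [u0 u1] := (Phi_gt0 u, Phi_lt1 u); have [v0 v1] := (Phi_gt0 v, Phi_lt1 v).
have pt := phi_gt0 t.
have p01 : 0 < (Phi u + Phi v) / 2 < 1 by apply/andP; split; lra.
rewrite (ratioE Ap p01); set mm := Num.min _ _.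
have mm0 : 0 < mm by rewrite lt_min; lra.
have mink := mixture_minkowski_ge mA aA bA.
have [le eq] : 2 * phi t * mm <= (phi u + phi v) / 2 /\
    ((phi u + phi v) / 2 <= 2 * phi t * mm -> u + v = 0 /\ `|u - v| = 2 * t).
  have [uv0|uv0] := leP (u + v) 0.
    have [le eq] := profile_le uvt uv0.
    have : 2 * phi t * mm <= 2 * phi t * ((Phi u + Phi v) / 2).
      by rewrite ler_pM2l ?mulr_gt0// ge_min lexx.
    move=> h; split; first by lra.
    by move=> h'; apply: eq; lra.
  (* For [u + v > 0] the complement, with quantiles [- u] and [- v], is the smaller side; equality
     would force [u + v = 0], so it does not occur here. *)
  have uvt' : `|- u - - v| <= 2 * t by rewrite -opprD normrN.
  have [|le eq] := profile_le uvt'; first by lra.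
  rewrite !PhiN !phiN in le eq.
  have : 2 * phi t * mm <= 2 * phi t * (1 - (Phi u + Phi v) / 2).
    by rewrite ler_pM2l ?mulr_gt0// ge_min lexx orbT.
  move=> h; split; first by lra.
  by move=> h'; case: eq => [|e _]; [lra|move: e uv0; lra].
split.
  by rewrite lee_pdivlMr// -EFinM; apply: le_trans mink; rewrite lee_fin.
move=> tpos ratio.
have : (lower_minkowski mu A <= (2 * phi t * mm)%:E)%E.
  by rewrite EFinM -lee_pdivrMr// ratio.
move=> /(le_trans mink); rewrite lee_fin => /eq[uv0 uvE].
have D0 : 0 <= 2 * t by rewrite mulr_ge0.
have Dpos : 0 < 2 * t by rewrite mulr_gt0.
(* If [u <= v], the passage from [a] to [b] attains the Neyman-Pearson bound and yields the upper
   half-space; otherwise the passage from [b] to [a], with direction [- nu], yields the lower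
   one. *)
have [uv|vu] := leP u v.
  have vE : v = u + 2 * t by rewrite -uvE ler0_norm ?subr_le0//; ring.
  have uE : u = - t by lra.
  left; have [_ /(_ Dpos)] := neyman_pearson nu1 D0 mA aA.
  by rewrite -bE bA vE uE opprK; apply.
have uE : u = v + 2 * t by rewrite -uvE gtr0_norm ?subr_gt0//; ring.
have vE : v = - t by lra.
right; have [_ /(_ Dpos)] := neyman_pearson nuN1 D0 mA bA.
rewrite -aE aA uE vE => /(_ erefl).
rewrite halfspace_gtE !opprK (_ : - (dotv b (- nu) + t) = dotv a nu + t)//.
by rewrite bE dotvDl dotvZl !dotvNr nu1; ring.
Qed.

Lemma cheeger_constant_mixture : cheeger_constant mu = (2 * phi t)%:E.
Proof.
apply/le_anti/andP; split; last first.
  by apply: le_ereal_inf_tmp => _ [A Aadm <-]; have [] := cheeger_ratio_ge Aadm.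
have [||adm le] := @cheeger_ratio_halfspace (dotv a nu + t) t nu nu1.
- by ring.
- by rewrite bE dotvDl dotvZl nu1; ring.
by apply: le_trans le; apply: ereal_inf_lbound; exists (halfspace_lt (dotv a nu + t) nu).
Qed.

Lemma halfspace_cheeger :
  is_cheeger_set mu (halfspace_lt (dotv a nu + t) nu) /\
  is_cheeger_set mu (halfspace_gt (dotv a nu + t) nu).
Proof.
have cheeger A : admissible mu A -> (cheeger_ratio mu A <= (2 * phi t)%:E)%E ->
    is_cheeger_set mu A.
  move=> Aadm le; split => //; rewrite cheeger_constant_mixture; apply/le_anti.
  by rewrite le; have [-> _] := cheeger_ratio_ge Aadm.
split.
  have [||adm le] := @cheeger_ratio_halfspace (dotv a nu + t) t nu nu1.
  - by ring.
  - by rewrite bE dotvDl dotvZl nu1; ring.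
  exact: cheeger.
rewrite halfspace_gtE.
have [||adm le] := @cheeger_ratio_halfspace (- (dotv a nu + t)) (- t) (- nu) nuN1.
- by rewrite dotvNr; ring.
- by rewrite bE dotvNr dotvDl dotvZl nu1; ring.
by apply: cheeger => //; rewrite phiN in le.
Qed.

Lemma cheeger_set_mod_nullP E : 0 < t -> measurable E ->
  is_cheeger_set_mod_null mu E <->
  eq_mod_null mu E (halfspace_lt (dotv a nu + t) nu) \/
  eq_mod_null mu E (halfspace_gt (dotv a nu + t) nu).
Proof.
move=> tpos mE; have [Clt Cgt] := halfspace_cheeger.
split=> [[S [Sadm Sratio] ES]|[EH|EH]]; last 2 first.
- by exists (halfspace_lt (dotv a nu + t) nu).
- by exists (halfspace_gt (dotv a nu + t) nu).
have mS : measurable S by case: Sadm.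
have mY (B B' : set 'rV[R]_n) : measurable B -> measurable B' -> measurable (B `+` B').
  by move=> mB mB'; apply: measurableU; exact: measurableD.
have trans H : measurable H -> lebesgue_rV R n (S `+` H) = 0%E -> eq_mod_null mu E H.
  move=> mH SH0; apply/(mixture_null a b (mY _ _ mE mH)).
  have /(mixture_null a b (mY _ _ mE mS)) ES0 := ES.
  apply/(negligibleP _ (mY _ _ mE mH)).
  apply: (@negligibleS _ _ _ _ ((E `+` S) `|` (S `+` H))).
    move=> x [[Ex nHx]|[Hx nEx]]; have [Sx|nSx] := pselect (S x).
    - by right; left.
    - by left; left.
    - by left; right.
    - by right; right.
  by apply: negligibleU; apply/negligibleP => //; exact: mY.
rewrite cheeger_constant_mixture in Sratio.
have [_ /(_ tpos Sratio)] := cheeger_ratio_ge Sadm.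
by case=> h; [right|left]; apply: trans h;
  [exact: measurable_halfspace_gt|exact: measurable_halfspace_lt].
Qed.

End cheeger_bounds.

Lemma two_phi_half (R : realType) (d : R) :
  2 * phi (2^-1 * d) = Num.sqrt (2 / pi) * expR (- (8^-1 * d ^+ 2)).
Proof.
rewrite phiE mulrA; congr (_ * expR _); last by lra.
have p0 : (0 : R) < pi := pi_gt0 R.
have -> : 2 / pi = 2 ^+ 2 * (2 * pi)^-1 :> R.
  by rewrite invfM mulrA expr2 mulfK// pnatr_eq0.
by rewrite [in RHS]sqrtrM ?sqr_ge0// sqrtr_sqr ger0_norm// sqrtrV// mulr_ge0// ltW.
Qed.

Theorem theorem1p2 (R : realType) (n : nat) (n_gt0 : (0 < n)%N)
    (a b : 'rV[R]_n) :
  let mu : probability 'rV[R]_n R := gaussian_mixture a b in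
  cheeger_constant mu
    = (Num.sqrt (2 / pi) * expR (- (8^-1 * enorm (a - b) ^+ 2)))%:E /\
  (a != b ->
    let nu : 'rV[R]_n := (enorm (b - a))^-1 *: (b - a) in
    let t : R := 2^-1 * enorm (a - b) in
    let Hlt := halfspace_lt (dotv a nu + t) nu in
    let Hgt := halfspace_gt (dotv a nu + t) nu in
    [/\ forall E : set 'rV[R]_n, measurable E ->
          (is_cheeger_set_mod_null mu E <->
           eq_mod_null mu E Hlt \/ eq_mod_null mu E Hgt),
        is_cheeger_set mu Hlt
      & is_cheeger_set mu Hgt]).
Proof.
case: n n_gt0 a b => // n _ a b mu.
have enormN (x : 'rV[R]_n.+1) : enorm (- x) = enorm x.
  by rewrite /enorm dotvNl dotvNr opprK.
have [ab|ab] := eqVneq a b.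
  (* For [a = b] no direction is distinguished: a coordinate vector serves, with [t = 0]. *)
  have nu1 : dotv (delta_mx 0 0 : 'rV[R]_n.+1) (delta_mx 0 0) = 1.
    rewrite dotvE (bigD1 0)//= !mxE !eqxx mulr1 big1 ?addr0// => i i0.
    by rewrite !mxE (negbTE i0) andbF mulr0.
  split=> //.
  have bE : b = a + (2 * 0) *: delta_mx 0 0 by rewrite mulr0 scale0r addr0.
  rewrite (cheeger_constant_mixture nu1 (lexx 0) bE) ab subrr.
  have -> : enorm (0 : 'rV[R]_n.+1) = 0.
    by rewrite /enorm dotvE big1 ?sqrtr0// => i _; rewrite mxE mul0r.
  by rewrite -two_phi_half mulr0.
pose d := enorm (b - a).
have d0 : 0 < d.
  rewrite lt_def enorm_ge0 andbT; apply: contra_neq ab => d0.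
  apply/esym/subr0_eq/dotv_eq0.
  by rewrite -enorm2 -/d d0 expr0n.
have dE : enorm (a - b) = d by rewrite -opprB enormN.
pose nu : 'rV[R]_n.+1 := d^-1 *: (b - a).
have nu1 : dotv nu nu = 1.
  by rewrite dotvZl dotvZr -enorm2 -/d; field; rewrite gt_eqF.
have t0 : 0 < 2^-1 * d by rewrite mulr_gt0// invr_gt0.
have bE : b = a + (2 * (2^-1 * d)) *: nu.
  by rewrite mulVKf// /nu scalerA divff ?gt_eqF// scale1r subrKC.
split.
  by rewrite (cheeger_constant_mixture nu1 (ltW t0) bE) two_phi_half dE.
move=> _; rewrite /= dE -/nu.
have [Clt Cgt] := halfspace_cheeger nu1 (ltW t0) bE.
split => // E mE; exact: cheeger_set_mod_nullP nu1 (ltW t0) bE E t0 mE.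
Qed.
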